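(* Let $E\subset\mathbb{C}$ be a regular compact set. Suppose that the sets of points $Z_n=\{z_{k,n}\}_{k=1}^n\subset\mathbb{C}$, $n\ge2$, satisfy $$\lim_{n\to\infty}\hat I[\tau(Z_n)]=V_E,$$ and let $P_n(z)=\prod_{k=1}^n(z-z_{k,n})$. Then the following three conditions are equivalent: (a) $\displaystyle\lim_{n\to\infty}\|P_n\|_E^{1/n}=\mathrm{cap}(E)$; (b) $\displaystyle\lim_{n\to\infty}m_E(Z_n)=0$; (c) $\tau(Z_n)\stackrel{*}{\rightarrow}\mu_E$ as $n\to\infty$, and $\displaystyle\lim_{R\to\infty}\lim_{n\to\infty}\frac1n\sum_{|z_{k,n}|\ge R}\log|z_{k,n}|=0$.
   Context: For a Borel measure $\mu$ with compact support in $\mathbb{C}$, its energy is $I[\mu]=\iint\log\frac{1}{|z-t|}\,d\mu(t)\,d\mu(z)$. For compact $E\subset\mathbb{C}$, let $\mathcal{M}(E)$ be the set of all Borel probability measures supported on $E$; Robin's constant is $V_E=\inf_{\mu\in\mathcal{M}(E)}I[\mu]$ and the capacity is $\mathrm{cap}(E)=e^{-V_E}$. If $\mathrm{cap}(E)>0$, the infimum is attained by a unique measure $\mu_E\in\mathcal{M}(E)$, the equilibrium measure of $E$. $\Omega_E$ is the unbounded connected component of $\overline{\mathbb{C}}\setminus E$, and $g_E(z,\infty)$ is the Green function of $\Omega_E$ with pole at $\infty$; for $z\in\Omega_E\setminus\{\infty\}$ it equals $g_E(z,\infty)=V_E-\int\log\frac{1}{|z-t|}\,d\mu_E(t)$.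 The set $E$ is regular if it is regular for the Dirichlet problem in $\Omega_E$, i.e. the limiting boundary values of $g_E(z,\infty)$ from within $\Omega_E$ are zero at every point of $\partial\Omega_E$; regularity includes $\mathrm{cap}(E)>0$. For a set of $n$ points $Z_n=\{z_{k,n}\}_{k=1}^n$ (points listed with possible repetition), the counting measure is $\tau(Z_n)=\frac1n\sum_{k=1}^n\delta_{z_{k,n}}$, where $\delta_z$ is the unit point mass at $z$. For $n\ge2$ the discrete energy is $$\hat I[\tau(Z_n)]=\frac{2}{n(n-1)}\sum_{1\le j<k\le n}\log\frac{1}{|z_{j,n}-z_{k,n}|},$$ which is finite if and only if the points are distinct (and is $+\infty$ otherwise). Also $$m_E(Z_n)=\frac1n\sum_{z_{k,n}\in\Omega_E}g_E(z_{k,n},\infty),$$ with $m_E(Z_n)=0$ if $Z_n\cap\Omega_E=\emptyset$. $\|P\|_E=\sup_{z\in E}|P(z)|$. $\tau(Z_n)\stackrel{*}{\rightarrow}\mu_E$ means $\int\phi\,d\tau(Z_n)\to\int\phi\,d\mu_E$ for every continuous $\phi:\mathbb{C}\to\mathbb{R}$ with compact support. In (c), the inner limit is understood to exist for all sufficiently large $R$. *)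

(* Defs.v *)
From HB Require Import structures.
From mathcomp Require Import all_boot all_order all_algebra.
From mathcomp Require Import all_classical all_reals all_analysis.
From mathcomp Require Import complex.
Set Implicit Arguments.
Unset Strict Implicit.
Unset Printing Implicit Defensive.
Import Order.TTheory GRing.Theory Num.Theory.
Import numFieldNormedType.Exports.
Local Open Scope classical_set_scope.
Local Open Scope complex_scope.
Local Open Scope ring_scope.

(* The norm topology is available on R[i]^o but not on R[i].  The module
   structure of R[i]^o is not copied: R[i] is already a module, over R. *)
HB.instance Definition _ (R : rcfType) :=
  PseudoMetricNormedZmod.copy R[i] R[i]^o.

HB.instance Definition _ (R : rcfType) :=
  Measurable.copy R[i] (g_sigma_algebraType (@open R[i])).

(* The modulus with values in R; the library norm `|z| has values in R[i]. *)
Notation normc := Normc.normc.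

Section potential_theory.
Context {R : realType}.
Implicit Types (E : set R[i]) (mu : {measure set R[i] -> \bar R}).
Local Open Scope ereal_scope.

(* log (1 / |z - t|), equal to +oo for z = t because lne 0 = -oo. *)
Definition log_kernel (z t : R[i]) : \bar R := - lne (normc (z - t))%:E.

Definition potential mu (z : R[i]) : \bar R := \int[mu]_t log_kernel z t.

Definition energy mu : \bar R := \int[mu]_z \int[mu]_t log_kernel z t.

Definition supported_probabilities E : set (probability R[i] R) :=
  [set mu | mu (~` E) = 0].

Definition robin E : \bar R :=
  ereal_inf [set energy mu | mu in supported_probabilities E].

Definition capacity E : \bar R := expeR (- robin E).

(* The default value \d_0 is only used when the infimum is not attained. *)
Definition equilibrium E : probability R[i] R :=
  xget (\d_(0%R : R[i]) : probability R[i] R)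
    [set mu | supported_probabilities E mu /\ energy mu = robin E].

(* In one_point_compactification R[i], None is the point at infinity. *)
Definition outer_domain E : set (one_point_compactification R[i]) :=
  @connected_component (one_point_compactification R[i]) (~` (Some @` E)) None.

Definition finite_outer_domain E : set R[i] := Some @^-1` outer_domain E.

(* The Green function with pole at infinity, on the finite part of the outer
   domain. *)
Definition green E (z : R[i]) : \bar R :=
  robin E - potential (equilibrium E) z.

(* The point at infinity is interior to the outer domain, so the boundary of
   the outer domain is that of its finite part, taken in R[i]. *)
Definition outer_boundary E : set R[i] :=
  closure (finite_outer_domain E) `\` (finite_outer_domain E)°.

Definition regular E :=
  0 < capacity E /\
  forall w, outer_boundary E w ->
    green E @ within (finite_outer_domain E) (nbhs w) --> 0.

(* Finite families of points, with repetition, are sequences Z; the number of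
   points n is size Z. *)
Definition tau (Z : seq R[i]) : {measure set R[i] -> \bar R} :=
  mscale ((size Z)%:R^-1 : R)%:nng%R (msum (fun k => \d_(Z`_k)) (size Z)).

Definition discrete_energy (Z : seq R[i]) : \bar R :=
  let n := size Z in
  (2%:R / (n%:R * (n%:R - 1)))%R%:E *
  \sum_(j < n) \sum_(k < n | (j < k)%N) log_kernel Z`_j Z`_k.

Definition mean_green E (Z : seq R[i]) : \bar R :=
  ((size Z)%:R^-1)%R%:E *
  \sum_(z <- Z | z \in finite_outer_domain E) green E z.

Definition node_poly (Z : seq R[i]) : {poly R[i]} :=
  (\prod_(z <- Z) ('X - z%:P))%R.

Definition sup_norm E (p : {poly R[i]}) : R :=
  sup [set normc p.[z]%R | z in E].

Definition log_tail (Z : seq R[i]) (r : R) : R :=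
  ((size Z)%:R^-1 * \sum_(z <- Z | r <= normc z) ln (normc z))%R.

Definition weak_star_cvg (mu_ : nat -> {measure set R[i] -> \bar R}) mu :=
  forall phi : R[i] -> R, continuous phi ->
    compact (closure [set z | phi z != 0%R]) ->
    \int[mu_ n]_z (phi z)%:E @[n --> \oo] --> \int[mu]_z (phi z)%:E.

End potential_theory.

(* Main.v *)
(* On the Riemann sphere log 1/|z-w| equals f(z) + f(w) - 1/2 log(1 - K(z,w))
   where f(z) = -1/2 log(1+|z|^2), K(z,w) is the scalar product of four bounded
   continuous features of z and of w, and sqrt(1 - K) is the chordal distance.
   The power series of -1/2 log(1 - K) has positive coefficients, so its partial
   sums are positive definite kernels B_N, and their quadratic form at P - Q is
   a weighted sum of squared differences of moments of the features; if it is
   small then P and Q are weakly close.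
   Regularity forces the equilibrium potential h to be continuous, with h <= V
   everywhere and h = V off the outer domain, so that g = V - h is the Green
   function; and the potentials of mu_E for the kernels B_N then converge
   uniformly.  Since B_N is bounded on the diagonal, the quadratic form at
   tau(Z_n) - mu_E is at most I^[tau(Z_n)] - V + 2 m_E(Z_n), up to a vanishing
   error.  Hence (b) implies the weak convergence, and the tails are controlled
   by g(z) ~ log|z|; conversely (c) gives (b) after cutting g off.  Integrating
   log|P_n| against mu_E gives exp(m_E(Z_n) - V) <= ||P_n||^(1/n), so (a)
   implies (b); the bound of log 1/|z-w| from below by the truncated kernel gives
   the converse upper bound on ||P_n||^(1/n) under (b). *)
From HB Require Import structures.
Require Import Defs.
From mathcomp Require Import all_boot all_order all_algebra.
From mathcomp Require Import all_classical all_reals all_analysis.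
From mathcomp Require Import complex.
From mathcomp Require Import measurable_realfun.
From mathcomp Require Import ring lra.
Set Implicit Arguments.
Unset Strict Implicit.
Unset Printing Implicit Defensive.
Import Order.TTheory GRing.Theory Num.Theory.
Import numFieldNormedType.Exports.
Local Open Scope classical_set_scope.
Local Open Scope complex_scope.
Local Open Scope ring_scope.

(** * Continuity and the topology of the complex plane *)

(** The nodes may run off to infinity, where log 1/|z-w| is unbounded below, and two of them may be
    close, where it is unbounded above. On the sphere the first defect sits entirely in the weight
    [cweight], which is unbounded and hence out of reach of weak convergence: in the estimate of the
    quadratic form it cancels, and its average over the nodes is recovered separately from the
    truncated energies. What remains is the nonnegative [lkern], to which Tonelli and monotone
    convergence apply without integrability conditions. Since the nodes lie anywhere in the plane,
    pointwise convergence of the truncated potentials of mu_E would say nothing about their averages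
    over Z_n; this is why convergence uniform on the whole plane is sought. It comes from Dini's
    theorem on the set where the potential equals V, followed by a comparison with nearest points of
    that set. No weak compactness enters. Weak closeness is quantitative, from finitely many
    moments, and the same estimate shows that [robin E] is attained, without which [equilibrium E]
    would only be a default value. *)

Section continuous_real_functions.
Context {R : realType} {T : topologicalType}.
Implicit Types f g : T -> R.

Lemma ctsD f g : continuous f -> continuous g -> continuous (fun x => f x + g x).
Proof. by move=> cf cg x; exact: cvgD (cf x) (cg x). Qed.

Lemma ctsB f g : continuous f -> continuous g -> continuous (fun x => f x - g x).
Proof. by move=> cf cg x; exact: cvgB (cf x) (cg x). Qed.

Lemma ctsN f : continuous f -> continuous (fun x => - f x).
Proof. by move=> cf x; exact: cvgN (cf x). Qed.

Lemma ctsM f g : continuous f -> continuous g -> continuous (fun x => f x * g x).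
Proof. by move=> cf cg x; exact: cvgM (cf x) (cg x). Qed.

Lemma ctsV f : (forall x, f x != 0) -> continuous f -> continuous (fun x => (f x)^-1).
Proof. by move=> f0 cf x; exact: cvgV (f0 x) (cf x). Qed.

Lemma ctsX f n : continuous f -> continuous (fun x => f x ^+ n).
Proof.
move=> cf; elim: n => [|n ih]; first by under eq_fun do rewrite expr0; exact: cst_continuous.
by under eq_fun do rewrite exprS; exact: ctsM.
Qed.

Lemma cts_prod I (s : seq I) (f : I -> T -> R) :
  (forall i, continuous (f i)) -> continuous (fun x => \prod_(i <- s) f i x).
Proof.
move=> cf; elim: s => [|i s ih].
  by under eq_fun do rewrite big_nil; exact: cst_continuous.
by under eq_fun do rewrite big_cons; exact: ctsM.
Qed.

Lemma cts_sum I (s : seq I) (f : I -> T -> R) :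
  (forall i, continuous (f i)) -> continuous (fun x => \sum_(i <- s) f i x).
Proof.
move=> cf; elim: s => [|i s ih].
  by under eq_fun do rewrite big_nil; exact: cst_continuous.
by under eq_fun do rewrite big_cons; exact: ctsD.
Qed.

Lemma cts_ln f : (forall x, 0 < f x) -> continuous f -> continuous (fun x => ln (f x)).
Proof.
by move=> f0 cf x; apply: continuous_comp; [exact: cf|apply: continuous_ln].
Qed.

End continuous_real_functions.

Section complex_plane.
Context {R : realType}.
Implicit Types (z w a : R[i]) (e r : R).

Lemma normc_ge0 z : 0 <= normc z.
Proof. by case: z => a b /=; exact: sqrtr_ge0. Qed.

Lemma normcD z w : normc (z + w) <= normc z + normc w.
Proof. exact: le_normcD. Qed.

Lemma normcN z : normc (- z) = normc z.
Proof. exact: complex.normcN. Qed.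

Lemma normcC z w : normc (z - w) = normc (w - z).
Proof. by rewrite -normcN opprB. Qed.

Lemma normc_eq0 z : (normc z == 0) = (z == 0).
Proof.
apply/eqP/eqP => [|->]; first exact: Normc.eq0_normc.
exact: Normc.normc0.
Qed.

Lemma normc_gt0 z : (0 < normc z) = (z != 0).
Proof. by rewrite lt_def normc_ge0 andbT normc_eq0. Qed.

Lemma normc_ge_distl z w : normc z - normc w <= normc (z - w).
Proof. by rewrite lerBlDr -{1}(subrK w z) normcD. Qed.

Lemma normc_ge_dist z w : `|normc z - normc w| <= normc (z - w).
Proof.
by rewrite ler_norml normc_ge_distl andbT lerNl opprB normcC normc_ge_distl.
Qed.

Lemma sqr_normc z : normc z ^+ 2 = complex.Re z ^+ 2 + complex.Im z ^+ 2.
Proof. by case: z => a b /=; rewrite sqr_sqrtr ?addr_ge0 ?sqr_ge0. Qed.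

Lemma normc_real r : normc r%:C = `|r|.
Proof. by rewrite /= expr0n addr0 sqrtr_sqr. Qed.

Lemma Re_le_normc z : `|complex.Re z| <= normc z.
Proof. by rewrite -ler_sqr ?nnegrE ?normc_ge0// sqr_normc real_normK ?num_real// lerDl sqr_ge0. Qed.

Lemma Im_le_normc z : `|complex.Im z| <= normc z.
Proof. by rewrite -ler_sqr ?nnegrE ?normc_ge0// sqr_normc real_normK ?num_real// lerDr sqr_ge0. Qed.

Lemma ReB z w : complex.Re (z - w) = complex.Re z - complex.Re w.
Proof. by case: z => ? ?; case: w. Qed.

Lemma ImB z w : complex.Im (z - w) = complex.Im z - complex.Im w.
Proof. by case: z => ? ?; case: w. Qed.

Lemma normc_le_ReIm z : normc z <= `|complex.Re z| + `|complex.Im z|.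
Proof.
rewrite -ler_sqr ?nnegrE ?normc_ge0 ?addr_ge0// sqr_normc sqrrD !real_normK ?num_real//.
by rewrite -addrA lerD2l lerDr mulrn_wge0// mulr_ge0.
Qed.

(** The radii of balls in [R[i]] are themselves elements of [R[i]]; positivity there forces a zero
    imaginary part, so real radii suffice. *)
Lemma nbhs_normcP z (A : set R[i]) :
  nbhs z A <-> exists2 e, 0 < e & forall w, normc (w - z) < e -> A w.
Proof.
rewrite nbhs_ballP; split => -[e e0 eA].
  have [er e'] : e \is Num.real /\ 0 < complex.Re e.
    by move: e0 => /=; case: e {eA} => a b; rewrite ltcE/= => /andP[/eqP -> a0];
      rewrite complex_real eqxx.
  exists (complex.Re e) => // w wz; apply: eA; rewrite -ball_normE/= /ball_/=.
  by rewrite -(RRe_real er) distrC ltcR.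
exists e%:C; first by rewrite /= ltcE/= eqxx.
move=> w; rewrite -ball_normE/= /ball_/= distrC => wz; apply: eA.
by rewrite -ltcR.
Qed.

Lemma continuous_normcP z (f : R[i] -> R) :
  {for z, continuous f} <->
  forall e, 0 < e -> exists2 d, 0 < d & forall w, normc (w - z) < d -> `|f w - f z| < e.
Proof.
split=> [fz e e0|fz].
  have /nbhs_normcP[d d0 dw] := @cvgr_dist_lt R R _ (nbhs z) (nbhs_filter z) f (f z) fz e e0.
  by exists d => // w /dw; rewrite distrC.
apply/(@cvgrPdist_lt R R _ (nbhs z) (nbhs_filter z)) => e e0; apply/nbhs_normcP.
by have [d d0 dw] := fz e e0; exists d => // w /dw; rewrite distrC.
Qed.

Lemma continuous_normc : continuous (@Normc.normc R).
Proof.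
move=> z; apply/continuous_normcP => e e0; exists e => // w wz.
exact: le_lt_trans (normc_ge_dist _ _) wz.
Qed.

Lemma continuous_Re : continuous (@complex.Re R : R[i] -> R).
Proof.
move=> z; apply/continuous_normcP => e e0; exists e => // w wz.
by apply: le_lt_trans wz; rewrite -ReB Re_le_normc.
Qed.

Lemma continuous_Im : continuous (@complex.Im R : R[i] -> R).
Proof.
move=> z; apply/continuous_normcP => e e0; exists e => // w wz.
by apply: le_lt_trans wz; rewrite -ImB Im_le_normc.
Qed.

Lemma continuous_shift_normc a : continuous (fun z => normc (z - a)).
Proof.
move=> z; apply/continuous_normcP => e e0; exists e => // w wz.
apply: le_lt_trans (normc_ge_dist _ _) _.
by rewrite opprB addrA subrK.
Qed.

Lemma hausdorffC : hausdorff_space R[i].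
Proof. exact: norm_hausdorff. Qed.

Lemma closed_ballC a r : closed [set z | normc (z - a) <= r].
Proof.
rewrite (_ : [set _ | _] = (fun z => normc (z - a)) @^-1` [set x | x <= r])//.
by apply: preimage_closed; [move=> ? _; exact: continuous_shift_normc|exact: closed_le].
Qed.

Lemma compact_normc_le r : compact [set z : R[i] | normc z <= r].
Proof.
pose h (x : R * R) := x.1 +i* x.2 : R[i].
have ch : continuous h.
  move=> x A /nbhs_normcP[e e0 eA].
  rewrite /nbhs/=; near=> y; apply: eA.
  apply: le_lt_trans (normc_le_ReIm _) _ => /=; rewrite [ltRHS]splitr ltrD//.
  - near: y; exists (ball x.1 (e / 2), ball x.2 (e / 2)) => /=.
      by split; apply: nbhsx_ballx; rewrite divr_gt0.
    by move=> [a b] /= [? _]; rewrite distrC.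
  - near: y; exists (ball x.1 (e / 2), ball x.2 (e / 2)) => /=.
      by split; apply: nbhsx_ballx; rewrite divr_gt0.
    by move=> [a b] /= [_ ?]; rewrite distrC.
have /(continuous_compact (continuous_subspaceT ch)) hc :
    compact (`[- r, r]%classic `*` `[- r, r]%classic : set (R * R)).
  by apply: compact_setX; exact: segment_compact.
apply: subclosed_compact hc _.
  have := @closed_ballC 0 r; rewrite (_ : [set _ | _] = [set z | normc z <= r])//.
  by apply/seteqP; split => z /=; rewrite subr0.
move=> [a b] /= zr; exists (a, b) => //; split; rewrite /= in_itv/= -ler_norml.
- exact: le_trans (Re_le_normc (a +i* b)) zr.
- exact: le_trans (Im_le_normc (a +i* b)) zr.
Unshelve. all: by end_near. Qed.

Lemma compact_bounded_normc (K : set R[i]) : compact K ->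
  exists2 r, 0 < r & forall z, K z -> normc z <= r.
Proof.
move=> cK.
have := @continuous_compact _ _ (@Normc.normc R) K
  (continuous_subspaceT continuous_normc) cK.
have [->|/set0P[z0 Kz0]] := eqVneq K set0.
  by move=> _; exists 1.
move=> /compact_has_sup[|_ [m mb]]; first by exists (normc z0), z0.
exists (`|m| + 1); first by rewrite ltr_wpDl.
move=> z Kz; apply: (@le_trans _ _ m); first by apply: mb; exists z.
by rewrite (le_trans (ler_norm _))// lerDl.
Qed.

Lemma compact_normcP (K : set R[i]) r :
  closed K -> (forall z, K z -> normc z <= r) -> compact K.
Proof. by move=> cK Kr; exact: (subclosed_compact cK (@compact_normc_le r) Kr). Qed.

Lemma compact_closedC (K : set R[i]) : compact K -> closed K.
Proof. exact: compact_closed hausdorffC. Qed.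

(** Lower semicontinuity is encoded as closedness of sublevel sets. The sublevel sets through points
    of [K] generate a proper filter, and a cluster point of it lies in all of them. *)
Lemma compact_lsc_min (K : set R[i]) (h : R[i] -> \bar R) :
  K !=set0 -> compact K -> (forall c, closed [set z | (h z <= c)%E]) ->
  exists2 p, K p & forall z, K z -> (h p <= h z)%E.
Proof.
move=> [z0 Kz0] cK ch.
pose F := filter_from K (fun z => K `&` [set w | (h w <= h z)%E]).
have FF : ProperFilter F.
  apply: filter_from_proper; last by move=> z Kz; exists z; split => /=.
  apply: filter_from_filter; first by exists z0.
  move=> u v Ku Kv; case: (leP (h u) (h v)) => huv; [exists u|exists v] => //.
  - by move=> w [Kw wu]; split; split => //=; exact: le_trans wu huv.
  - by move=> w [Kw wv]; split; split => //=; apply: le_trans wv (ltW huv).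
have [|p [Kp clp]] := cK F FF; first by exists z0 => // w [].
exists p => // z Kz; apply: (ch (h z)) => B Bp.
have [|w [[_ wz] Bw]] := clp (K `&` [set w | (h w <= h z)%E]) B _ Bp; first by exists z.
by exists w.
Qed.

Lemma EVT_maxC (K : set R[i]) (f : R[i] -> R) : K !=set0 -> compact K ->
  continuous f -> exists2 p, K p & forall z, K z -> f z <= f p.
Proof.
move=> K0 cK cf.
have [|p Kp pmin] := @compact_lsc_min K (fun z => (- f z)%:E) K0 cK.
  move=> [c| |].
  - rewrite (_ : [set _ | _] = f @^-1` [set x | - c <= x]).
      by apply: preimage_closed => //; exact: closed_ge.
    by apply/seteqP; split => z /=; rewrite lee_fin lerNl.
  - have -> : [set z | ((- f z)%:E <= +oo)%E] = setT; last exact: closedT.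
    by apply/seteqP; split => z //= _; rewrite leey.
  - have -> : [set z | ((- f z)%:E <= -oo)%E] = set0; last exact: closed0.
    by apply/seteqP; split => z.
by exists p => // z /pmin; rewrite lee_fin lerN2.
Qed.

End complex_plane.

(** * The logarithmic kernel on the Riemann sphere *)

Section log_tail_kernel.
Context {R : realType}.
Implicit Types (x y : R) (N : nat).

(** The Taylor polynomial of degree [N] at 0 of [- 2^-1 * ln (1 - x)]. *)
Definition bern N x : R := \sum_(k < N) x ^+ k.+1 / (2 * k.+1%:R).

Definition log_rem N x : R := - 2^-1 * ln (1 - x) - bern N x.

Lemma bern_ge0 N x : 0 <= x -> 0 <= bern N x.
Proof. by move=> x0; apply: sumr_ge0 => k _; rewrite divr_ge0 ?exprn_ge0 ?mulr_ge0. Qed.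

Lemma bernS N x : bern N.+1 x = bern N x + x ^+ N.+1 / (2 * N.+1%:R).
Proof. by rewrite /bern big_ord_recr. Qed.

Lemma le_bern N x y : 0 <= x -> x <= y -> bern N x <= bern N y.
Proof.
move=> x0 xy; apply: ler_sum => k _; rewrite ler_wpM2r ?invr_ge0 ?mulr_ge0//.
by rewrite lerXn2r ?nnegrE// (le_trans x0).
Qed.

Lemma nondecreasing_bern x : 0 <= x -> nondecreasing_seq (bern ^~ x).
Proof.
move=> x0; apply/nondecreasing_seqP => N; rewrite bernS lerDl.
by rewrite divr_ge0 ?exprn_ge0 ?mulr_ge0.
Qed.

(** Differentiating [bern N] gives half a geometric sum, so the derivative of the remainder
    collapses to one term. That term is nonnegative on [[0, 1[], which yields the sign, the
    monotonicity and the size of the remainder. *)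
Lemma is_derive_log_rem N x : x < 1 ->
  is_derive x 1 (log_rem N) (2^-1 * (x ^+ N / (1 - x))).
Proof.
move=> x1; elim: N => [|N ih].
  have -> : log_rem 0 = (fun y => - 2^-1 * ln (1 - y)).
    by apply/funext => y; rewrite /log_rem /bern big_ord0 subr0.
  have x10 : 0 < 1 - x by rewrite subr_gt0.
  have h : is_derive x 1 (fun y : R => 1 - y) (- 1).
    have -> : (fun y : R => 1 - y) = (cst 1 - id) by [].
    by apply: is_derive_eq; rewrite sub0r.
  have h' := is_derive1_ln x10.
  have k := @is_derive1_comp R (@ln R) (fun y => 1 - y) x _ _ h' h.
  have := is_deriveZ (- 2^-1) k.
  rewrite (_ : _ *: _ = 2^-1 * (x ^+ 0 / (1 - x)))//.
  by rewrite expr0 mulrN1 mul1r scalerN scaleNr opprK.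
pose p : {poly R} := (2 * N.+1%:R)^-1 *: 'X^(N.+1).
have -> : log_rem N.+1 = log_rem N - horner p.
  apply/funext => y; rewrite /log_rem/= bernS opprD addrA fctE /=.
  by congr (_ - _); rewrite [p.[y]]hornerZ hornerXn mulrC.
have x1' : 1 - x != 0 by rewrite subr_eq0 gt_eqF.
apply: is_derive_eq.
rewrite /p derivZ derivXn hornerZ hornerMn hornerXn /= exprS -mulr_natl; field.
by rewrite x1' /= nat1r pnatr_eq0.
Qed.

Lemma log_rem0 N : log_rem N 0 = 0.
Proof.
rewrite /log_rem subr0 ln1 mulr0 sub0r /bern big1 ?oppr0// => k _.
by rewrite expr0n mul0r.
Qed.

Lemma log_rem_MVT N x y : 0 <= x -> x <= y -> y < 1 ->
  exists2 c, x <= c <= y & log_rem N y - log_rem N x = 2^-1 * (c ^+ N / (1 - c)) * (y - x).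
Proof.
move=> x0 xy y1.
have [z||c] := @MVT_segment R (log_rem N) (fun c => 2^-1 * (c ^+ N / (1 - c))) x y xy.
- by rewrite in_itv/= => /andP[_ zy]; apply: is_derive_log_rem; exact: lt_trans zy y1.
- apply: derivable_within_continuous => z; rewrite in_itv/= => /andP[_ zy].
  by apply: ex_derive; apply: is_derive_log_rem; exact: le_lt_trans zy y1.
by rewrite in_itv/=; exists c.
Qed.

Lemma le_log_rem N x y : 0 <= x -> x <= y -> y < 1 -> log_rem N x <= log_rem N y.
Proof.
move=> x0 xy y1; have [c /andP[xc cy] h] := log_rem_MVT N x0 xy y1.
rewrite -subr_ge0 h !mulr_ge0 ?subr_ge0 ?invr_ge0 ?exprn_ge0//.
- exact: le_trans xc.
- by rewrite subr_ge0 (le_trans cy)// ltW.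
Qed.

Lemma log_rem_ge0 N x : 0 <= x -> x < 1 -> 0 <= log_rem N x.
Proof. by move=> x0 x1; rewrite -(log_rem0 N) le_log_rem. Qed.

Lemma log_rem_le N x : 0 <= x -> x < 1 -> log_rem N x <= x ^+ N / (1 - x).
Proof.
move=> x0 x1; have [c /andP[xc cy]] := log_rem_MVT N (lexx 0) x0 x1.
rewrite log_rem0 !subr0 => ->.
have c1 : c < 1 by exact: le_lt_trans cy x1.
have h : c ^+ N / (1 - c) <= x ^+ N / (1 - x).
  rewrite ler_pM ?exprn_ge0 ?invr_ge0 ?subr_ge0 ?(ltW c1)//.
    by rewrite lerXn2r ?nnegrE.
  by rewrite lef_pV2 ?posrE ?subr_gt0// lerD2l lerN2.
have h0 : 0 <= c ^+ N / (1 - c) by rewrite divr_ge0 ?exprn_ge0 ?subr_ge0 // ltW.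
nra.
Qed.

Lemma log_rem_cvg0 x : 0 <= x -> x < 1 -> log_rem N x @[N --> \oo] --> 0.
Proof.
move=> x0 x1.
have h : x ^+ N / (1 - x) @[N --> \oo] --> 0.
  rewrite -[X in _ --> X](mul0r (1 - x)^-1); apply: cvgMr_tmp.
  by apply: cvg_expr; rewrite ger0_norm.
apply: squeeze_cvgr h; last exact: cvg_cst.
by apply: nearW => N; rewrite log_rem_ge0// log_rem_le.
Qed.

(* [4] is the constant in the comparison of [1 - skern u w] with
   [1 - skern z w] when [z] is the point of a set that is closest to [u]. *)
Lemma log_rem_quarter N x : 0 < x -> x <= 1 ->
  log_rem N (1 - x / 4) <= log_rem N (1 - x) + ln 2.
Proof.
move=> x0 x1.
have h : bern N (1 - x) <= bern N (1 - x / 4).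
  by apply: le_bern; [rewrite subr_ge0|lra].
have -> : log_rem N (1 - x / 4) = - 2^-1 * ln (x / 4) - bern N (1 - x / 4).
  by rewrite /log_rem subKr.
rewrite /log_rem subKr lnM ?posrE ?invr_gt0// lnV ?posrE//.
have -> : ln 4 = 2 * ln 2 :> R.
  by have -> : 4 = 2 ^+ 2 :> R; [rewrite -natrX|rewrite lnXn// mulr_natl].
lra.
Qed.

End log_tail_kernel.

Section spherical_kernel.
Context {R : realType}.
Implicit Types (z w : R[i]).

(* The four features embed the plane in the unit sphere of [R^4] in such a way
   that [1 - skern z w] is the square of the chordal distance. *)
Definition feat (i : 'I_4) z : R :=
  nth 0 [:: 1; normc z ^+ 2; Num.sqrt 2 * complex.Re z; Num.sqrt 2 * complex.Im z] i
  / (1 + normc z ^+ 2).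

Definition skern z w : R := \sum_i feat i z * feat i w.

Lemma den_gt0 z : 0 < 1 + normc z ^+ 2.
Proof. by rewrite ltr_pwDl// sqr_ge0. Qed.

Lemma sum4 (F : 'I_4 -> R) : \sum_i F i = F (inord 0) + F (inord 1) + F (inord 2) + F (inord 3).
Proof.
rewrite !big_ord_recr big_ord0 /= add0r; do !congr (_ + _); congr F;
  by apply/val_inj; rewrite /= inordK.
Qed.

(** Without denominators this is [(1 + |z|^2)(1 + |w|^2) - 1 - |z|^2 |w|^2 - 2 Re(z conj w) = |z -
    w|^2]; the factors [sqrt 2] in the features supply the coefficient 2. *)
Lemma skernE z w : 1 - skern z w =
  normc (z - w) ^+ 2 / ((1 + normc z ^+ 2) * (1 + normc w ^+ 2)).
Proof.
have dz := lt0r_neq0 (den_gt0 z); have dw := lt0r_neq0 (den_gt0 w).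
rewrite /skern sum4 /feat !inordK//= !mulf_div -!mulrDl.
rewrite -[X in X - _](divff (mulf_neq0 dz dw)) -mulrBl; congr (_ / _).
have s2 : Num.sqrt 2 * Num.sqrt 2 = 2 :> R by rewrite -expr2 sqr_sqrtr.
rewrite !(mulrACA (Num.sqrt 2) _ (Num.sqrt 2)) s2 !sqr_normc ReB ImB.
case: z {dz} => a b; case: w {dw} => c d /=; ring.
Qed.

Lemma skernC z w : skern z w = skern w z.
Proof. by apply: eq_bigr => i _; rewrite mulrC. Qed.

Lemma skern_le1 z w : skern z w <= 1.
Proof. by rewrite -subr_ge0 skernE divr_ge0 ?sqr_ge0 ?mulr_ge0 ?(ltW (den_gt0 _)). Qed.

Lemma skern_ge0 z w : 0 <= skern z w.
Proof.
rewrite -lerN2 oppr0 -(lerD2l 1) addr0 skernE ler_pdivrMr ?mulr_gt0 ?den_gt0// mul1r.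
rewrite !sqr_normc ReB ImB; case: z => a b; case: w => c d /=.
(* The difference is [|1 + z conj w|^2]. *)
rewrite -subr_ge0 (_ : _ - _ = (1 + a * c + b * d) ^+ 2 + (b * c - a * d) ^+ 2); last by ring.
by rewrite addr_ge0 ?sqr_ge0.
Qed.

Lemma skernzz z : skern z z = 1.
Proof. by apply/eqP; rewrite eq_sym -subr_eq0 skernE subrr Normc.normc0 expr0n mul0r. Qed.

Lemma skern_lt1 z w : (skern z w < 1) = (z != w).
Proof.
rewrite -subr_gt0 skernE; have [<-|zw] := eqVneq z w.
  by rewrite subrr Normc.normc0 expr0n mul0r ltxx.
by rewrite divr_gt0 ?exprn_gt0 ?mulr_gt0 ?den_gt0// normc_gt0 subr_eq0.
Qed.

Lemma sqr_feat_dist z w : \sum_i (feat i z - feat i w) ^+ 2 = 2 * (1 - skern z w).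
Proof.
under eq_bigr do rewrite sqrrB -mulr_natl.
rewrite big_split sumrB/= -!mulr_sumr.
have -> : \sum_i feat i z ^+ 2 = 1 by rewrite -(skernzz z).
have -> : \sum_i feat i w ^+ 2 = 1 by rewrite -(skernzz w).
by rewrite -/(skern z w); ring.
Qed.

(** The triangle inequality for feature vectors, squared by means of
    [(x + y)^2 <= 2 x^2 + 2 y^2]. *)
Lemma skern_quasi_triangle u z w :
  1 - skern u w <= 2 * (1 - skern u z) + 2 * (1 - skern z w).
Proof.
have h (x y : R) : (x + y) ^+ 2 <= 2 * x ^+ 2 + 2 * y ^+ 2.
  by rewrite -subr_ge0 (_ : _ - _ = (x - y) ^+ 2) ?sqr_ge0//; ring.
suff : 2 * (1 - skern u w) <= 2 * (2 * (1 - skern u z) + 2 * (1 - skern z w)).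
  by rewrite ler_pM2l.
rewrite -sqr_feat_dist mulrDr !(mulrCA 2 2) -!sqr_feat_dist !mulr_sumr -big_split/=.
by apply: ler_sum => i _; rewrite -(subrKA (feat i z)).
Qed.

Lemma le_feat1 i z : `|feat i z| <= 1.
Proof.
rewrite -ler_sqr ?nnegrE// expr1n real_normK ?num_real//.
rewrite -(skernzz z) /skern (bigD1 i)//= -expr2 lerDl.
by apply: sumr_ge0 => j _; rewrite -expr2 sqr_ge0.
Qed.

Lemma continuous_sqr_normc : continuous (fun z => normc z ^+ 2).
Proof. exact: ctsX continuous_normc. Qed.

Lemma continuous_den : continuous (fun z => 1 + normc z ^+ 2).
Proof. by apply: ctsD; [exact: cst_continuous|exact: continuous_sqr_normc]. Qed.

Lemma continuous_feat i : continuous (feat i).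
Proof.
apply: ctsM; last first.
  by apply: ctsV continuous_den => z; rewrite lt0r_neq0// den_gt0.
case: i => -[|[|[|[|//]]]] /= _.
- exact: cst_continuous.
- exact: continuous_sqr_normc.
- by apply: ctsM; [exact: cst_continuous|exact: continuous_Re].
- by apply: ctsM; [exact: cst_continuous|exact: continuous_Im].
Qed.

(** Monomials are indexed by words rather than by exponents, so that the expansion of
    [skern z w ^+ k] has all its coefficients equal to 1. *)
Definition mono k (v : {ffun 'I_k -> 'I_4}) z : R := \prod_j feat (v j) z.

Lemma le_mono1 k (v : {ffun 'I_k -> 'I_4}) z : `|mono v z| <= 1.
Proof. by rewrite normr_prod prodr_ile1// => i; rewrite normr_ge0 le_feat1. Qed.

Lemma continuous_mono k (v : {ffun 'I_k -> 'I_4}) : continuous (mono v).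
Proof. by apply: cts_prod => i; exact: continuous_feat. Qed.

Lemma skernX k z w : skern z w ^+ k = \sum_(v : {ffun 'I_k -> 'I_4}) mono v z * mono v w.
Proof.
transitivity (\prod_(j < k) \sum_i feat i z * feat i w); first by rewrite prodr_const card_ord.
by rewrite bigA_distr_bigA; apply: eq_bigr => v _; rewrite /mono big_split.
Qed.

Definition cweight z : R := - 2^-1 * ln (1 + normc z ^+ 2).

(** The diagonal is a separate case because [ln 0] is 0. *)
Definition lkern z w : \bar R :=
  if z == w then +oo%E else (- 2^-1 * ln (1 - skern z w))%:E.

Lemma cweight_le0 z : cweight z <= 0.
Proof. by rewrite /cweight mulNr oppr_le0 mulr_ge0 ?invr_ge0// ln_ge0// lerDl sqr_ge0. Qed.

Lemma continuous_cweight : continuous cweight.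
Proof.
apply: ctsM; first exact: cst_continuous.
by apply: cts_ln continuous_den; exact: den_gt0.
Qed.

Lemma lkernC z w : lkern z w = lkern w z.
Proof. by rewrite /lkern eq_sym skernC. Qed.

Lemma log_kernel_neq z w : z != w -> log_kernel z w = (- ln (normc (z - w)))%:E.
Proof. by move=> zw; rewrite /log_kernel lne_EFin ?normc_gt0 ?subr_eq0. Qed.

Lemma log_kernelzz z : log_kernel z z = +oo%E.
Proof. by rewrite /log_kernel subrr Normc.normc0 /= lexx. Qed.

Lemma log_kernelE z w : log_kernel z w = ((cweight z + cweight w)%:E + lkern z w)%E.
Proof.
rewrite /lkern; have [<-|zw] := eqVneq z w; first by rewrite log_kernelzz.
rewrite log_kernel_neq// -EFinD; congr _%:E.
have zw0 : 0 < normc (z - w) by rewrite normc_gt0 subr_eq0.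
rewrite skernE ln_div ?posrE ?mulr_gt0 ?exprn_gt0 ?den_gt0//.
rewrite lnXn// lnM ?posrE ?den_gt0// /cweight -mulr_natl.
by field.
Qed.

Lemma lkern_bern N z w : z != w ->
  lkern z w = ((bern N (skern z w))%:E + (log_rem N (skern z w))%:E)%E.
Proof. by move=> zw; rewrite /lkern (negbTE zw) -EFinD /log_rem addrCA subrr addr0. Qed.

Lemma lkern_ge_bern N z w : ((bern N (skern z w))%:E <= lkern z w)%E.
Proof.
have [<-|zw] := eqVneq z w; first by rewrite /lkern eqxx leey.
by rewrite (lkern_bern N zw) leeDl// lee_fin log_rem_ge0 ?skern_ge0 ?skern_lt1.
Qed.

Lemma lkern_ge0 z w : (0 <= lkern z w)%E.
Proof. by apply: le_trans (lkern_ge_bern 0 z w); rewrite lee_fin bern_ge0// skern_ge0. Qed.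

Lemma bern1_unbounded (c : R) : exists N, c < bern N 1.
Proof.
(* Chosen so that [- 2^-1 * ln (1 - x)] is [|c| + 1]; once the remainder at [x] is below 1,
   [bern N x] exceeds [c], and [bern N 1] is larger still. *)
pose x : R := 1 - expR (- (2 * (`|c| + 1))).
have x1 : x < 1 by rewrite ltrBlDr ltrDl expR_gt0.
have x0 : 0 <= x by rewrite subr_ge0 -[leRHS]expR0 ler_expR oppr_le0 mulr_ge0 ?addr_ge0.
have : \forall N \near \oo, log_rem N x < 1.
  by have /cvgrPdist_lt/(_ _ ltr01) := log_rem_cvg0 x0 x1; apply: filterS => N;
     rewrite sub0r normrN; exact: le_lt_trans (ler_norm _).
move=> [N _ /(_ N (leqnn N))] hN; exists N.
apply: lt_le_trans (le_bern N x0 (ltW x1)).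
move: hN; rewrite /log_rem /x subKr expRK; have := ler_norm c; lra.
Qed.

Lemma cvg_bern_lkern z w : ((bern N (skern z w))%:E @[N --> \oo] --> lkern z w)%E.
Proof.
have [<-|zw] := eqVneq z w; last first.
  rewrite /lkern (negbTE zw); apply/cvg_EFin; first exact: nearW.
  have sz0 := skern_ge0 z w.
  have szw : skern z w < 1 by rewrite skern_lt1.
  have h := log_rem_cvg0 sz0 szw.
  have -> : fine \o (fun N => (bern N (skern z w))%:E) =
      (fun N => - 2^-1 * ln (1 - skern z w) - log_rem N (skern z w)).
    by apply/funext => N /=; rewrite /log_rem subKr.
  by rewrite -[X in _ --> X]subr0; apply: cvgB => //; exact: cvg_cst.
rewrite /lkern eqxx skernzz; apply/cvgeyPgt => c.
have [N cN] := bern1_unbounded c.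
exists N => // n /= Nn; rewrite lte_fin.
exact: lt_le_trans cN (nondecreasing_bern ler01 Nn).
Qed.

End spherical_kernel.

(** * Measurability and integration on the plane *)

Section measure_lemmas.
Local Open Scope ereal_scope.

(** The integral of [f] may be infinite. In that case [f <= (f + g)^+ + |g|] makes the positive part
    of the sum have infinite integral, while its negative part is at most [|g|], so the integral of
    the sum is also infinite. *)
Lemma ge0_integralD_integrable d (T : measurableType d) (R : realType)
    (m : {measure set T -> \bar R}) (f g : T -> \bar R) :
  measurable_fun setT f -> (forall x, 0 <= f x) -> m.-integrable setT g ->
  (forall x, g x \is a fin_num) ->
  \int[m]_x (f x + g x) = \int[m]_x f x + \int[m]_x g x.
Proof.
move=> mf f0 ig gfin.
have mg := measurable_int _ ig.
have [foo|] := ltP (\int[m]_x f x) +oo.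
  rewrite integralD//; apply/integrableP; split => //.
  by under eq_integral do rewrite gee0_abs//.
rewrite leye_eq => /eqP fy.
pose h x := f x + g x.
have mfg : measurable_fun setT h by exact: emeasurable_funD.
have gy : \int[m]_x `|g x| < +oo by have /integrableP[] := ig.
have /eqP : \int[m]_x (h^\+ x + `|g x|) = +oo.
  apply/eqP; rewrite -leye_eq -fy; apply: ge0_le_integral => //.
  - apply: emeasurable_funD; first exact: measurable_funepos.
    exact: measurableT_comp.
  - move=> x _; rewrite funeposE /h.
    move: (gfin x) (f0 x); case: (f x) => [a||]//; case: (g x) => [b||]// _ a0.
    rewrite -EFinD -EFin_max.
      have := ler_norm (- b); rewrite normrN => hb.
      have : (a + b <= Num.max (a + b) 0)%R by rewrite le_max lexx.
      rewrite -EFinD lee_fin; lra.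
rewrite [X in X == _](@ge0_integralD _ _ _ m setT measurableT h^\+ (fun x => `|g x|))//;
  last 2 first.
- exact: measurable_funepos.
- exact: measurableT_comp.
move=> hy; have {hy}fgy : \int[m]_x h^\+ x = +oo.
  apply/eqP; rewrite -leye_eq leNgt; apply/negP => hfin.
  by have := lte_add_pinfty hfin gy; rewrite (eqP hy) ltxx.
have nfg : \int[m]_x h^\- x < +oo.
  apply: le_lt_trans gy; apply: ge0_le_integral => //.
  - exact: measurable_funeneg.
  - exact: measurableT_comp.
  - move=> x _; rewrite funenegE /h.
    move: (gfin x) (f0 x); case: (f x) => [a||]//; case: (g x) => [b||]// _ a0.
    rewrite -EFinD -EFinN -EFin_max lee_fin ge_max normr_ge0 andbT.
      move: a0; rewrite lee_fin => a0.
      have := ler_norm (- b); rewrite normrN; lra.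
    by rewrite addye// maxNye abse_ge0.
rewrite fy -/(h _) integralE fgy.
have : \int[m]_x g x \is a fin_num by exact: integrable_fin_num.
by move: nfg; case: (\int[m]_x g x) => //; case: (integral m setT h^\-).
Qed.

End measure_lemmas.

Section borel.
Context {R : realType}.
Implicit Types (z w : R[i]) (A : set R[i]).

Lemma open_measurableC A : open A -> measurable A.
Proof. by move=> oA; exact: sub_sigma_algebra. Qed.

Lemma closed_measurableC A : closed A -> measurable A.
Proof. by move=> cA; rewrite -(setCK A); apply: measurableC; apply: open_measurableC;
  exact: closed_openC. Qed.

Lemma continuous_measurableC (f : R[i] -> R) : continuous f -> measurable_fun setT f.
Proof.
move=> cf; apply: (measurability _ (RGenOpens.measurableE R)).
move=> /= _ [_ [a [b ->] <-]].
apply: measurableI => //; apply: open_measurableC.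
by apply: open_comp => // x _; exact: cf.
Qed.

Lemma lsc_measurableC (h : R[i] -> \bar R) : (forall c, closed [set z | (h z <= c)%E]) ->
  measurable_fun setT h.
Proof.
move=> ch; apply: (measurability _ (ErealGenOInfty.measurableE R)).
move=> /= _ [_ [a ->]] <-; apply: measurableI => //; apply: open_measurableC.
rewrite preimage_itvoy (_ : [set _ | _] = ~` [set z | (h z <= a%:E)%E]).
  exact: closed_openC.
by apply/seteqP; split => z /=; rewrite ltNge => /negP.
Qed.

Lemma measurable_bern N : measurable_fun setT (bern N : R -> R).
Proof.
apply: continuous_measurable_fun; apply: cts_sum => k.
by apply: ctsM; [apply: ctsX => ?; exact: cvg_id|exact: cst_continuous].
Qed.

(** Measurability is for the product of the two Borel sigma-algebras, as Tonelli requires: [lkern]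
    is a pointwise limit of polynomials in functions of one variable. *)
Lemma measurable_lkern : measurable_fun setT (fun x : R[i] * R[i] => lkern x.1 x.2).
Proof.
apply: (emeasurable_fun_cvg (fun N (x : R[i] * R[i]) => (bern N (skern x.1 x.2))%:E)).
  move=> N; apply/measurable_EFinP; apply: measurableT_comp (measurable_bern N) _.
  apply: measurable_sum => i; apply: measurable_funM.
    by apply: measurableT_comp measurable_fst; apply: continuous_measurableC;
      exact: continuous_feat.
  by apply: measurableT_comp measurable_snd; apply: continuous_measurableC; exact: continuous_feat.
by move=> x _; exact: cvg_bern_lkern.
Qed.

Lemma measurable_lkern1 z : measurable_fun setT (lkern z).
Proof.
have -> : lkern z = (fun x : R[i] * R[i] => lkern x.1 x.2) \o pair z by [].
by apply: measurableT_comp measurable_lkern _; exact: measurable_pair1.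
Qed.

Lemma continuous_skern z : continuous (skern z).
Proof. by apply: cts_sum => i; apply: ctsM; [exact: cst_continuous|exact: continuous_feat]. Qed.

Lemma continuous_bern_skern N z : continuous (fun w => bern N (skern z w)).
Proof.
apply: cts_sum => k.
by apply: ctsM; [apply: ctsX; exact: continuous_skern|exact: cst_continuous].
Qed.

End borel.

Section bounded_integrals.
Context {R : realType} (P : {measure set R[i] -> \bar R}).
Hypothesis P1 : P setT = 1%E.
Implicit Types (f g : R[i] -> R).

Lemma bounded_integrable f M : measurable_fun setT f -> (forall z, `|f z| <= M) ->
  P.-integrable setT (EFin \o f).
Proof.
move=> mf fM; apply: measurable_bounded_integrable => //.
  by rewrite P1 ltry.
exists M; split; first exact: num_real.
by move=> x Mx y _; apply: le_trans (fM y) (ltW Mx).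
Qed.

Lemma integral_EFin f : P.-integrable setT (EFin \o f) ->
  (\int[P]_z (f z)%:E)%E = (\int[P]_z f z)%:E.
Proof. by move=> fi; rewrite /Rintegral fineK// integrable_fin_num. Qed.

Lemma RintegralM1 c : \int[P]_z c = c.
Proof. by rewrite Rintegral_cst// P1 mulr1. Qed.

Lemma Rintegral_sum I (s : seq I) (F : I -> R[i] -> R) :
  (forall i, P.-integrable setT (EFin \o F i)) ->
  \int[P]_z (\sum_(i <- s) F i z) = \sum_(i <- s) \int[P]_z F i z.
Proof.
move=> iF; elim: s => [|i s ih].
  by rewrite big_nil; under eq_Rintegral do rewrite big_nil; rewrite RintegralM1.
rewrite big_cons -ih; under eq_Rintegral do rewrite big_cons.
rewrite RintegralD//.
have -> : EFin \o (fun z => \sum_(j <- s) F j z) = (fun z => \sum_(j <- s) (F j z)%:E)%E.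
  by apply/funext => z /=; rewrite sumEFin.
by apply: integrable_sum => // j _; exact: iF.
Qed.

End bounded_integrals.

(** * Potentials and moments *)

Section moments.
Context {R : realType} (P : {measure set R[i] -> \bar R}).
Hypothesis P1 : P setT = 1%E.

Definition mom k (v : {ffun 'I_k -> 'I_4}) : R := \int[P]_z mono v z.

Lemma integrable_mono k (v : {ffun 'I_k -> 'I_4}) : P.-integrable setT (EFin \o mono v).
Proof.
apply: (bounded_integrable P1 (M := 1)); last exact: le_mono1.
by apply: continuous_measurableC; exact: continuous_mono.
Qed.

Definition bpot N z : R := \int[P]_w bern N (skern z w).

(** The truncated kernel has finite rank, so its potential is a finite combination of the monomials
    whose coefficients are the moments of [P]. Continuity of [bpot] and its control by moments both
    rest on this. *)
Lemma bpotE N z : bpot N z =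
  \sum_(k < N) (\sum_(v : {ffun 'I_k.+1 -> 'I_4}) mono v z * mom v) / (2 * k.+1%:R).
Proof.
have iv k c (v : {ffun 'I_k -> 'I_4}) : P.-integrable setT (EFin \o (fun w => c * mono v w)).
  have -> : EFin \o (fun w => c * mono v w) = (fun w => c%:E * (EFin \o mono v) w)%E.
    by apply/funext => w /=; rewrite EFinM.
  by apply: integrableZl => //; exact: integrable_mono.
have isum k : P.-integrable setT
    (EFin \o (fun w => \sum_(v : {ffun 'I_k -> 'I_4}) mono v z * mono v w)).
  have -> : EFin \o (fun w => \sum_(v : {ffun 'I_k -> 'I_4}) mono v z * mono v w) =
      (fun w => \sum_(v : {ffun 'I_k -> 'I_4}) (mono v z * mono v w)%R%:E)%E.
    by apply/funext => w /=; rewrite sumEFin.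
  by apply: integrable_sum => // v _; exact: iv.
have isum' k c : P.-integrable setT
    (EFin \o (fun w => (\sum_(v : {ffun 'I_k -> 'I_4}) mono v z * mono v w) * c)).
  have -> : EFin \o (fun w => (\sum_(v : {ffun 'I_k -> 'I_4}) mono v z * mono v w) * c) =
      (fun w => c%:E * (EFin \o (fun w => \sum_(v : {ffun 'I_k -> 'I_4}) mono v z * mono v w)%R)
        w)%E.
    by apply/funext => w /=; rewrite -EFinM mulrC.
  by apply: integrableZl => //; exact: isum.
rewrite /bpot /bern.
under eq_Rintegral do under eq_bigr do rewrite skernX.
rewrite Rintegral_sum//; apply: eq_bigr => k _.
rewrite RintegralZr//; congr (_ * _).
rewrite Rintegral_sum//; apply: eq_bigr => v _.
by rewrite RintegralZl//; exact: integrable_mono.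
Qed.

Lemma continuous_bpot N : continuous (bpot N).
Proof.
have -> : bpot N = fun z => \sum_(k < N) (\sum_(v : {ffun 'I_k.+1 -> 'I_4}) mono v z * mom v)
    / (2 * k.+1%:R).
  by apply/funext => z; exact: bpotE.
apply: cts_sum => k; apply: ctsM; last exact: cst_continuous.
by apply: cts_sum => v; apply: ctsM; [exact: continuous_mono|exact: cst_continuous].
Qed.

Lemma integrable_bern_skern N z : P.-integrable setT (EFin \o (fun w => bern N (skern z w))).
Proof.
apply: (bounded_integrable P1 (M := bern N 1)).
  by apply: continuous_measurableC; exact: continuous_bern_skern.
move=> w; rewrite ger0_norm ?bern_ge0 ?skern_ge0//.
by apply: le_bern; [exact: skern_ge0|exact: skern_le1].
Qed.

Definition lpot z : \bar R := (\int[P]_w lkern z w)%E.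

Lemma lpot_ge0 z : (0 <= lpot z)%E.
Proof. by apply: integral_ge0 => w _; exact: lkern_ge0. Qed.

Lemma bpot_le_lpot N z : ((bpot N z)%:E <= lpot z)%E.
Proof.
rewrite -(integral_EFin (integrable_bern_skern N z)).
apply: ge0_le_integral => //.
- by move=> w _; rewrite lee_fin bern_ge0// skern_ge0.
- by apply/measurable_EFinP; apply: continuous_measurableC; exact: continuous_bern_skern.
- exact: measurable_lkern1.
- by move=> w _; exact: lkern_ge_bern.
Qed.

Lemma cvg_bpot z : ((bpot N z)%:E @[N --> \oo] --> lpot z)%E.
Proof.
have -> : (fun N => (bpot N z)%:E) = (fun N => \int[P]_w (bern N (skern z w))%:E)%E.
  by apply/funext => N; rewrite (integral_EFin (integrable_bern_skern N z)).
have -> : lpot z = (\int[P]_w limn (fun N => (bern N (skern z w))%:E))%E.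
  by apply: eq_integral => w _; apply/esym/cvg_lim => //; exact: cvg_bern_lkern.
apply: cvg_monotone_convergence => //.
- by move=> N; apply/measurable_EFinP; apply: continuous_measurableC; exact: continuous_bern_skern.
- by move=> N w _; rewrite lee_fin bern_ge0// skern_ge0.
- by move=> w _ a b ab; rewrite lee_fin; apply: nondecreasing_bern ab; exact: skern_ge0.
Qed.

Lemma nondecreasing_bpot z : nondecreasing_seq (bpot ^~ z).
Proof.
move=> a b ab; apply: le_Rintegral => //; try exact: integrable_bern_skern.
by move=> w _; apply: nondecreasing_bern ab; exact: skern_ge0.
Qed.

Lemma lpot_leP z c : (lpot z <= c)%E <-> forall N, ((bpot N z)%:E <= c)%E.
Proof.
split=> [zc N|bc]; first exact: le_trans (bpot_le_lpot N z) zc.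
have <- := cvg_lim (@ereal_hausdorff R) (@cvg_bpot z).
apply: lime_le; last exact: nearW.
by apply/cvg_ex; exists (lpot z); exact: cvg_bpot.
Qed.

(** [lpot] is the supremum of the continuous functions [bpot N]. The summand [f] leaves room for the
    weight and for the quadratic perturbation of the minimum principle. *)
Lemma lpot_lsc (f : R[i] -> R) c : continuous f ->
  closed [set z | ((f z)%:E + lpot z <= c)%E].
Proof.
move=> cf.
have -> : [set z | ((f z)%:E + lpot z <= c)%E] =
    \bigcap_(N in setT) [set z | ((f z + bpot N z)%:E <= c)%E].
  apply/seteqP; split => z /=.
    by move=> h N _ /=; apply: le_trans h; rewrite EFinD leeD2l// bpot_le_lpot.
  move=> h; rewrite addeC -leeBrDr//; apply/lpot_leP => N.
  by rewrite leeBrDr// addeC -EFinD; exact: h.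
apply: closed_bigI => N _; move: c => [c| |].
- have -> : [set z | ((f z + bpot N z)%:E <= c%:E)%E] = (fun z => f z + bpot N z) @^-1` [set x |
  x <= c].
    by apply/seteqP; split => z /=; rewrite lee_fin.
  apply: preimage_closed; last exact: closed_le.
  by move=> z _; apply: ctsD => //; exact: continuous_bpot.
- have -> : [set z | ((f z + bpot N z)%:E <= +oo)%E] = setT; last exact: closedT.
  by apply/seteqP; split => z //= _; rewrite leey.
- have -> : [set z | ((f z + bpot N z)%:E <= -oo)%E] = set0; last exact: closed0.
  by apply/seteqP; split => z.
Qed.

Lemma measurable_lpot : measurable_fun setT lpot.
Proof.
apply: lsc_measurableC => c.
have := @lpot_lsc (fun=> 0) c (@cst_continuous _ _ _).
by under eq_fun do rewrite add0e.
Qed.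

End moments.

Section quadratic_form.
Context {R : realType}.
Implicit Types (P Q : {measure set R[i] -> \bar R}).

(** The mutual energy of [P] and [Q] for the truncated kernel, as [integral_bpot] shows; in terms of
    moments its symmetry is plain and [qform] becomes a sum of squares. *)
Definition mutual P Q N : R :=
  \sum_(k < N) (\sum_(v : {ffun 'I_k.+1 -> 'I_4}) mom P v * mom Q v) / (2 * k.+1%:R).

Definition qform P Q N : R :=
  \sum_(k < N) (\sum_(v : {ffun 'I_k.+1 -> 'I_4}) (mom P v - mom Q v) ^+ 2) / (2 * k.+1%:R).

Lemma qformE P Q N : qform P Q N = mutual P P N - 2 * mutual P Q N + mutual Q Q N.
Proof.
rewrite /mutual mulr_sumr -sumrB -big_split/=; apply: eq_bigr => k _.
rewrite (mulrA 2) -mulrBl -mulrDl; congr (_ / _).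
rewrite mulr_sumr -sumrB -big_split/=; apply: eq_bigr => v _.
by rewrite sqrrB -mulr_natl !expr2.
Qed.

Lemma le_qform P Q : nondecreasing_seq (qform P Q).
Proof.
apply/nondecreasing_seqP => N; rewrite {2}/qform big_ord_recr/= lerDl.
by rewrite divr_ge0 ?mulr_ge0// sumr_ge0// => v _; exact: sqr_ge0.
Qed.

Lemma mom_diff_le P Q N k (v : {ffun 'I_k.+1 -> 'I_4}) : (k < N)%N ->
  (mom P v - mom Q v) ^+ 2 <= 2 * k.+1%:R * qform P Q N.
Proof.
move=> kN; have := le_qform P Q kN.
rewrite {1}/qform big_ord_recr/= => h.
rewrite mulrC -ler_pdivrMr ?mulr_gt0//; apply: le_trans h.
rewrite -[leLHS]add0r lerD//.
  apply: sumr_ge0 => j _; rewrite divr_ge0 ?mulr_ge0// sumr_ge0// => u _; exact: sqr_ge0.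
rewrite ler_pM2r ?invr_gt0 ?mulr_gt0// (bigD1 v)//= lerDl.
by apply: sumr_ge0 => u _; exact: sqr_ge0.
Qed.

Lemma integral_bpot P Q N : P setT = 1%E -> Q setT = 1%E ->
  \int[P]_z bpot Q N z = mutual P Q N.
Proof.
move=> P1 Q1; under eq_Rintegral do rewrite (bpotE Q1).
have iv k c (v : {ffun 'I_k -> 'I_4}) : P.-integrable setT (EFin \o (fun w => mono v w * c)).
  have -> : EFin \o (fun w => mono v w * c) = (fun w => (EFin \o mono v) w * c%:E)%E.
    by apply/funext => w /=; rewrite EFinM.
  by apply: integrableZr => //; exact: integrable_mono.
have isum k : P.-integrable setT
    (EFin \o (fun w => \sum_(v : {ffun 'I_k -> 'I_4}) mono v w * mom Q v)).
  have -> : EFin \o (fun w => \sum_(v : {ffun 'I_k -> 'I_4}) mono v w * mom Q v) =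
      (fun w => \sum_(v : {ffun 'I_k -> 'I_4}) (mono v w * mom Q v)%R%:E)%E.
    by apply/funext => w /=; rewrite sumEFin.
  by apply: integrable_sum => // v _; exact: iv.
rewrite Rintegral_sum//; last first.
  move=> k; have -> : EFin \o (fun w => (\sum_(v : {ffun 'I_k.+1 -> 'I_4}) mono v w * mom Q v)
      / (2 * k.+1%:R)) = (fun w => (EFin \o (fun w =>
      \sum_(v : {ffun 'I_k.+1 -> 'I_4}) mono v w * mom Q v)%R) w * (2 * k.+1%:R)^-1%R%:E)%E.
    by apply/funext => w /=; rewrite -EFinM.
  by apply: integrableZr.
apply: eq_bigr => k _; rewrite RintegralZr//; congr (_ / _).
rewrite Rintegral_sum//; apply: eq_bigr => v _.
by rewrite RintegralZr//; exact: integrable_mono.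
Qed.

Lemma mutualC P Q N : mutual P Q N = mutual Q P N.
Proof. by apply: eq_bigr => k _; congr (_ / _); apply: eq_bigr => v _; rewrite mulrC. Qed.

Lemma integral_lpotC (P Q : probability R[i] R) :
  (\int[P]_z lpot Q z = \int[Q]_w lpot P w)%E.
Proof.
have := @fubini_tonelli _ _ _ _ R P Q (fun x => lkern x.1 x.2) measurable_lkern
  (fun x => lkern_ge0 x.1 x.2).
move=> /= ->; apply: eq_integral => w _; apply: eq_integral => z _.
by rewrite lkernC.
Qed.

End quadratic_form.

Section concentrated_measure.
Context {R : realType} (P : {measure set R[i] -> \bar R}) (K : set R[i]).
Hypotheses (P1 : P setT = 1%E) (cK : compact K) (PK : P (~` K) = 0%E).

Let mK : measurable K.
Proof. by apply: closed_measurableC; exact: compact_closedC. Qed.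

Lemma concentrated_nonempty : K !=set0.
Proof.
apply/set0P/negP => /eqP K0; move: PK; rewrite K0 setC0 P1 => /eqP.
by rewrite onee_eq0.
Qed.

Lemma concentrated_integrable (f : R[i] -> R) M :
  measurable_fun setT f -> (forall z, K z -> `|f z| <= M) -> P.-integrable setT (EFin \o f).
Proof.
move=> mf fM; apply/(@negligible_integrable _ _ _ P setT (~` K)) => //.
- exact: measurableC.
- exact/measurable_EFinP.
- rewrite setTD setCK; apply: measurable_bounded_integrable => //.
  + have : (P K <= P setT)%E by apply: le_measure; rewrite ?inE.
    by move=> /le_lt_trans; apply; rewrite P1 ltry.
  + exact: measurable_funTS.
  + exists M; split; first exact: num_real.
    by move=> x Mx y Ky; apply: le_trans (fM y Ky) (ltW Mx).
Qed.

Lemma integrable_cts (f : R[i] -> R) : continuous f -> P.-integrable setT (EFin \o f).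
Proof.
move=> cf.
have [p _ fp] := EVT_maxC concentrated_nonempty cK (fun z => cvg_norm (cf z)).
by apply: (concentrated_integrable (M := `|f p|)) => //; exact: continuous_measurableC.
Qed.

Lemma integrable_cst1 (c : R) : P.-integrable setT (fun=> c%:E).
Proof. by apply: (bounded_integrable P1 (f := fun=> c) (M := `|c|)). Qed.

Definition cmean : R := \int[P]_z cweight z.

Lemma integrable_cweight : P.-integrable setT (EFin \o cweight).
Proof. by apply: integrable_cts; exact: continuous_cweight. Qed.

Lemma integral_cweight : (\int[P]_z (cweight z)%:E)%E = cmean%:E.
Proof. by rewrite integral_EFin//; exact: integrable_cweight. Qed.

(** The weight is bounded on the compact [K] that carries [P], hence integrable, so the kernel
    identity integrates even where [lpot P z] is infinite. *)
Lemma potentialE z : (potential P z = (cweight z + cmean)%:E + lpot P z)%E.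
Proof.
rewrite /potential.
under eq_integral do rewrite log_kernelE addeC.
rewrite ge0_integralD_integrable//.
- rewrite addeC; congr (_ + _)%E.
  under eq_integral do rewrite EFinD.
  rewrite integralD//; first by rewrite integral_cst// P1 mule1 integral_cweight.
  + exact: integrable_cst1.
  + exact: integrable_cweight.
- exact: measurable_lkern1.
- by move=> w; exact: lkern_ge0.
- under eq_fun do rewrite EFinD.
  apply: integrableD => //; first exact: integrable_cst1.
  exact: integrable_cweight.
Qed.

Lemma energyE : (energy P = (2 * cmean)%:E + \int[P]_z lpot P z)%E.
Proof.
rewrite /energy -/(potential P).
under eq_integral => z _ do rewrite -/(potential P z) potentialE addeC.
rewrite ge0_integralD_integrable//.
- rewrite addeC; congr (_ + _)%E.
  under eq_integral do rewrite EFinD.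
  rewrite integralD//.
  + by rewrite integral_cst// P1 mule1 integral_cweight -EFinD mulrDl mul1r.
  + exact: integrable_cweight.
  + exact: integrable_cst1.
- exact: measurable_lpot.
- exact: lpot_ge0.
- under eq_fun do rewrite EFinD.
  apply: integrableD => //; first exact: integrable_cweight.
  exact: integrable_cst1.
Qed.

End concentrated_measure.

(** * Uniform convergence of the truncated potentials *)

Section uniform_approximation.
Context {R : realType} (P : {measure set R[i] -> \bar R}) (K : set R[i]).
Hypotheses (P1 : P setT = 1%E) (cK : compact K) (PK : P (~` K) = 0%E).
Variable g : R[i] -> R.
Hypotheses (cg : continuous g) (lg : forall z, K z -> lpot P z = (g z)%:E).

(** Dini's theorem in near-covering form: an index good at [z] is good on a neighbourhood of [z] by
    continuity, and all larger indices are good there by monotonicity. *)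
Lemma lpot_dini (e : R) : 0 < e -> exists N, forall z, K z -> g z - bpot P N z < e.
Proof.
move=> e0.
have : \forall N \near \oo, forall z, K z -> g z - bpot P N z < e.
  move/compact_near_coveringP : cK; apply => z Kz.
  have [N0 _ hN0] : \forall N \near \oo, g z - bpot P N z < e.
    have := @cvg_bpot _ P P1 z; rewrite (lg Kz) => /fine_cvgP[_] /cvgrPdist_lt/(_ _ e0).
    by apply: filterS => N /=; apply: le_lt_trans (ler_norm _).
  have cgb : continuous (fun w => g w - bpot P N0 w).
    by apply: ctsB => //; exact: continuous_bpot.
  have /continuous_normcP/(_ _ (_ : 0 < e - (g z - bpot P N0 z))) := cgb z.
  rewrite subr_gt0 => /(_ (hN0 N0 (leqnn _)))[d d0 hd].
  exists ([set w | normc (w - z) < d], [set N | (N0 <= N)%N]) => /=.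
    by split; [apply/nbhs_normcP; exists d|exists N0].
  move=> [w N] /= [wz NN].
  have := hd w wz; have := nondecreasing_bpot P1 w NN.
  move=> h1 h2; have := le_lt_trans (ler_norm _) h2; lra.
by move=> [N _ /(_ N (leqnn _))] h; exists N.
Qed.

Definition lrem N z w : \bar R := (lkern z w - (bern N (skern z w))%:E)%E.

Lemma lrem_ge0 N (z w : R[i]) : (0 <= lrem N z w)%E.
Proof. by rewrite sube_ge0//; exact: lkern_ge_bern. Qed.

Lemma lremE N (z w : R[i]) : z != w -> lrem N z w = (log_rem N (skern z w))%:E.
Proof. by move=> zw; rewrite /lrem (lkern_bern N zw) addeAC subee// add0e. Qed.

Lemma measurable_lrem N z : measurable_fun setT (lrem N z).
Proof.
apply: emeasurable_funB; first exact: measurable_lkern1.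
by apply/measurable_EFinP; apply: continuous_measurableC; exact: continuous_bern_skern.
Qed.

Lemma lpot_lrem N z : lpot P z = ((bpot P N z)%:E + \int[P]_w lrem N z w)%E.
Proof.
rewrite -(integral_EFin (integrable_bern_skern P1 N z)) -ge0_integralD//.
- by apply: eq_integral => w _; rewrite /lrem addeC subeK.
- by move=> w _; rewrite lee_fin bern_ge0// skern_ge0.
- by apply/measurable_EFinP; apply: continuous_measurableC; exact: continuous_bern_skern.
- by move=> w _; exact: lrem_ge0.
- exact: measurable_lrem.
Qed.

(** If [1 - skern z' w >= expR (- M)], the remainder at [z] is bounded by its value at a fixed point
    below 1, which tends to 0 with [N]. Otherwise [log_rem_quarter] gives the remainder at [z'] plus
    [ln 2]; but then [lkern z' w >= M / 2], so [ln 2] is at most [2 * ln 2 / M] times the kernel.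
    The integral of the last term is small when [M] is large. *)
Lemma lrem_nearest N z z' w (M : R) : 0 < M ->
  1 - skern z' w <= 4 * (1 - skern z w) ->
  (lrem N z w <= (log_rem N (1 - expR (- M) / 4))%:E + lrem N z' w
                 + (2 * ln 2 / M)%:E * lkern z' w)%E.
Proof.
move=> M0 h.
have ln20 : 0 < ln 2 :> R by rewrite ln_gt0// ltr1n.
have g0 : 0 < 2 * ln 2 / M by rewrite divr_gt0// mulr_gt0.
have [eM0 eM1] : 0 < expR (- M) /\ expR (- M) < 1.
  by rewrite expR_gt0 expR_lt1 oppr_lt0.
have r0 : 0 <= log_rem N (1 - expR (- M) / 4) by apply: log_rem_ge0; lra.
have [<-|zw] := eqVneq z' w.
  rewrite [X in (_ * X)%E]/lkern eqxx gt0_muley ?lte_fin// addey ?leey//.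
  by rewrite adde_eq_ninfty negb_or /= gt_eqF// (lt_le_trans (ltNyr 0))// lrem_ge0.
have x'0 : 0 < 1 - skern z' w by rewrite subr_gt0 skern_lt1.
have x0 : 0 < 1 - skern z w by lra.
have zw' : z != w by rewrite -skern_lt1 -subr_gt0.
rewrite !lremE// /lkern (negbTE zw) -EFinM -!EFinD lee_fin.
have k'0 := skern_ge0 z' w; have k0 := skern_ge0 z w.
move: (skern z' w) (skern z w) x'0 x0 k'0 k0 h => k' k x'0 x0 k'0 k0 h {z z' w zw zw'}.
have h1 : log_rem N k <= log_rem N (1 - (1 - k') / 4) by apply: le_log_rem; lra.
have l0 : 0 <= - 2^-1 * ln (1 - k').
  by rewrite mulNr oppr_ge0 pmulr_rle0// ln_le0//; lra.
have r' : 0 <= log_rem N k' by apply: log_rem_ge0; lra.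
have [xM|xM] := leP (expR (- M)) (1 - k').
  have h2 : log_rem N (1 - (1 - k') / 4) <= log_rem N (1 - expR (- M) / 4).
    by apply: le_log_rem; lra.
  have : 0 <= 2 * ln 2 / M * (- 2^-1 * ln (1 - k')) by rewrite mulr_ge0// ltW.
  lra.
have h2 : log_rem N (1 - (1 - k') / 4) <= log_rem N (1 - (1 - k')) + ln 2.
  by apply: log_rem_quarter; lra.
rewrite subKr in h2.
have : ln 2 <= 2 * ln 2 / M * (- 2^-1 * ln (1 - k')).
  have lM : M <= - ln (1 - k').
    rewrite lerNr -[leRHS]expRK ler_ln ?posrE//; exact: ltW.
  have -> : 2 * ln 2 / M * (- 2^-1 * ln (1 - k')) = ln 2 * (- ln (1 - k') / M).
    by field; rewrite gt_eqF.
  by rewrite ler_pMr// ler_pdivlMr// mul1r.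
lra.
Qed.

(* Compare [z] with the nearest point of [K], where Dini's theorem applies. *)
Lemma lpot_uniform (e : R) : 0 < e ->
  exists N, forall z, (lpot P z <= (bpot P N z + e)%:E)%E.
Proof.
move=> e0.
have K0 := concentrated_nonempty P1 PK.
have [p Kp gp] := EVT_maxC K0 cK cg.
have gp0 : 0 <= g p by rewrite -lee_fin -(lg Kp) lpot_ge0.
have ln20 : 0 < ln 2 :> R by rewrite ln_gt0// ltr1n.
have e3 : 0 < e / 3 by rewrite divr_gt0.
(* Makes [2 * ln 2 / M] times the maximum [g p] of the potential on [K] at most [e / 3]; the added 1
   keeps [M] positive. *)
pose M := 2 * ln 2 * (g p + 1) / (e / 3).
have M0 : 0 < M by rewrite divr_gt0// mulr_gt0 ?mulr_gt0// ltr_wpDl.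
have hM : 2 * ln 2 / M * g p <= e / 3.
  have gp1 : 0 < g p + 1 by rewrite ltr_wpDl.
  have -> : 2 * ln 2 / M = e / 3 / (g p + 1).
    by rewrite /M; field; rewrite !gt_eqF.
  by rewrite -mulrA ger_pMr// mulrC ler_pdivrMr// mul1r lerDl.
have [eM0 eM1] : 0 < expR (- M) /\ expR (- M) < 1.
  by rewrite expR_gt0 expR_lt1 oppr_lt0.
have [N1 hN1] := lpot_dini e3.
have [N2 _ hN2] : \forall N \near \oo, log_rem N (1 - expR (- M) / 4) < e / 3.
  have : 0 <= 1 - expR (- M) / 4 by lra.
  have : 1 - expR (- M) / 4 < 1 by lra.
  move=> x1 x0; have /cvgrPdist_lt/(_ _ e3) := log_rem_cvg0 x0 x1.
  by apply: filterS => N; rewrite sub0r normrN; exact: le_lt_trans (ler_norm _).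
pose N := maxn N1 N2; exists N => z.
have [z' Kz' hz'] := EVT_maxC K0 cK (@continuous_skern R z).
rewrite (lpot_lrem N) EFinD leeD2l//.
have mK : measurable K by apply: closed_measurableC; exact: compact_closedC.
have ml := measurable_lrem N.
have mlk := @measurable_lkern1 R.
have mc : measurable_fun setT (fun w => (2 * ln 2 / M)%:E * lkern z' w)%E by exact:
  measurable_funeM.
have mR : measurable_fun setT (fun w => (log_rem N (1 - expR (- M) / 4))%:E + lrem N z' w
                 + (2 * ln 2 / M)%:E * lkern z' w)%E.
  exact: emeasurable_funD (emeasurable_funD (measurable_cst _) (ml z')) mc.
have c0 : 0 <= log_rem N (1 - expR (- M) / 4) by apply: log_rem_ge0; lra.
have gm0 : 0 <= 2 * ln 2 / M by rewrite ltW// divr_gt0// mulr_gt0.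
apply: (@le_trans _ _ (\int[P]_w ((log_rem N (1 - expR (- M) / 4))%:E + lrem N z' w
                 + (2 * ln 2 / M)%:E * lkern z' w))%E).
  apply: ae_ge0_le_integral => //.
  - by move=> w _; exact: lrem_ge0.
  - move=> w _; apply: adde_ge0; last by apply: mule_ge0; [rewrite lee_fin|exact: lkern_ge0].
    by apply: adde_ge0; [rewrite lee_fin|exact: lrem_ge0].
  - exists (~` K); split => //; first exact: measurableC.
    move=> w /= hw Kw; apply: hw => _; apply: lrem_nearest => //.
    (* As [z'] is chordally nearest to [z], [1 - skern z' z <= 1 - skern z w], and the
       quasi-triangle inequality gives the factor 2 + 2. *)
    have := skern_quasi_triangle z' z w; have := hz' w Kw.
    by rewrite (skernC z' z); lra.
rewrite ge0_integralD//; last 3 first.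
- by move=> w _; apply: adde_ge0; [rewrite lee_fin|exact: lrem_ge0].
- by apply: emeasurable_funD.
- by move=> w _; apply: mule_ge0; [rewrite lee_fin|exact: lkern_ge0].
rewrite ge0_integralD//; last by move=> w _; exact: lrem_ge0.
rewrite integral_cst// P1 mule1 ge0_integralZl//; last by move=> w _; exact: lkern_ge0.
rewrite -/(lpot P z') (lg Kz') -EFinM.
have -> : (\int[P]_w lrem N z' w = (g z' - bpot P N z')%:E)%E.
  have := lpot_lrem N z'; rewrite (lg Kz') => h.
  by rewrite EFinB h addeAC subee// add0e.
rewrite -!EFinD lee_fin.
have h1 : g z' - bpot P N z' < e / 3.
  have := hN1 z' Kz'; have : bpot P N1 z' <= bpot P N z'.
    by apply: nondecreasing_bpot => //; exact: leq_maxl.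
  lra.
have h2 : log_rem N (1 - expR (- M) / 4) < e / 3 by apply: hN2; exact: leq_maxr.
have h3 : 2 * ln 2 / M * g z' <= 2 * ln 2 / M * g p by rewrite ler_wpM2l// gp.
lra.
Qed.

Lemma lpot_fin_num z : lpot P z \is a fin_num.
Proof.
have [N /(_ z)] := lpot_uniform ltr01.
by have := lpot_ge0 P z; case: (lpot P z).
Qed.

Lemma continuous_lpot : continuous (fun z => fine (lpot P z)).
Proof.
move=> z; apply/continuous_normcP => e e0.
have e3 : 0 < e / 3 by rewrite divr_gt0.
have [N hN] := lpot_uniform e3.
have /continuous_normcP/(_ _ e3)[d d0 hd] := @continuous_bpot R P P1 N z.
exists d => // w /hd h.
have b u : bpot P N u <= fine (lpot P u) <= bpot P N u + e / 3.
  have := hN u; have := bpot_le_lpot P1 N u.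
  by rewrite -(fineK (lpot_fin_num u)) !lee_fin => -> ->.
move: h; rewrite !ltr_norml.
have /andP[] := b w; have /andP[] := b z; lra.
Qed.

End uniform_approximation.

(** * Circles and mean values *)

Lemma RintegralN d (T : measurableType d) (R : realType) (m : {measure set T -> \bar R})
    (D : set T) (f : T -> R) : measurable D -> m.-integrable D (EFin \o f) ->
  \int[m]_(x in D) - f x = - \int[m]_(x in D) f x.
Proof.
move=> mD fi; rewrite -mulN1r -RintegralZl//.
by apply: eq_Rintegral => x _; rewrite mulN1r.
Qed.

Section unit_interval_integrals.
Context {R : realType}.
Local Notation mu := (@lebesgue_measure R).
Implicit Types (f : R -> R).

Lemma itv_integrable f (a b : R) : continuous f -> mu.-integrable `[a, b] (EFin \o f).
Proof.
move=> cf; apply: continuous_compact_integrable; first exact: segment_compact.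
exact: continuous_subspaceT.
Qed.

Lemma Rintegral_affine f (a b c d : R) : continuous f -> a <= b -> 0 < c ->
  \int[mu]_(x in `[c * a + d, c * b + d]) f x = c * \int[mu]_(x in `[a, b]) f (c * x + d).
Proof.
move=> cf ab c0.
have cF : continuous (fun x : R => c * x + d).
  apply: ctsD; last exact: cst_continuous.
  by apply: ctsM; [exact: cst_continuous|move=> ?; exact: cvg_id].
have dF (x : R) : is_derive x 1 (fun x => c * x + d) c.
  have -> : (fun x => c * x + d) = c \*: id + cst d by apply/funext.
  by apply: is_derive_eq; rewrite addr0 /GRing.scale/= mulr1.
have dE : derive1 (fun x => c * x + d) = cst c.
  by apply/funext => x; rewrite derive1E; apply: derive_val.
rewrite -RintegralZl//; last first.
  by apply: itv_integrable => x; apply: continuous_comp; [exact: cF|exact: cf].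
rewrite /Rintegral (@integration_by_substitution_increasing R (fun x => c * x + d) f a b)//.
- by congr fine; apply: eq_integral => x _ /=; rewrite !fctE dE mulrC.
- by move=> x y _ _ xy; rewrite ltrD2r ltr_pM2l.
- by rewrite dE => z _; exact: cst_continuous.
- by rewrite dE; exact: is_cvg_cst.
- by rewrite dE; exact: is_cvg_cst.
- split.
  + by move=> x _; apply: ex_derive; exact: dF.
  + by apply: cvg_at_right_filter; exact: cF.
  + by apply: cvg_at_left_filter; exact: cF.
- exact: continuous_subspaceT.
Qed.

Lemma Rintegral_half f : continuous f ->
  \int[mu]_(x in `[0, 1]) f x = \int[mu]_(x in `[0, 2^-1]) (f x + f (x + 2^-1)).
Proof.
move=> cf.
have h1 := @itv_integrable f 0 1 cf.
have hB : \int[mu]_(x in `[0, 1]) f x = \int[mu]_(x in `]2^-1, 1]) f x + \int[mu]_(x in `[0,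
  2^-1]) f x.
  apply/eqP; rewrite -subr_eq; apply/eqP.
  by apply: Rintegral_itvB => //; rewrite bnd_simp; lra.
rewrite hB.
rewrite Rintegral_itv_obnd_cbnd; last first.
  by apply: integrableS h1 => //; apply: subset_itvr; rewrite bnd_simp; lra.
have -> : \int[mu]_(x in `[2^-1, 1]) f x = \int[mu]_(x in `[0, 2^-1]) f (x + 2^-1).
  have := @Rintegral_affine f 0 2^-1 1 2^-1 cf _ ltr01.
  rewrite mulr0 add0r !mul1r (_ : 2^-1 + 2^-1 = 1); last by lra.
  by move=> ->; [apply: eq_Rintegral => x _; rewrite mul1r|rewrite invr_ge0].
rewrite addrC RintegralD//; first exact: itv_integrable.
apply: itv_integrable => x; apply: continuous_comp; last exact: cf.
by apply: (@ctsD R R id (cst 2^-1)); [move=> ?; exact: cvg_id|exact: cst_continuous].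
Qed.

Lemma Rintegral_double f : continuous f ->
  \int[mu]_(x in `[0, 2^-1]) f (2 * x) = 2^-1 * \int[mu]_(x in `[0, 1]) f x.
Proof.
move=> cf; have := @Rintegral_affine f 0 2^-1 2 0 cf.
rewrite mulr0 !addr0 mulfV// => ->//.
by rewrite mulKf//; apply: eq_Rintegral => x _; rewrite addr0.
Qed.

Lemma Rintegral_itv_cst (a b c : R) : a <= b -> \int[mu]_(x in `[a, b]) c = c * (b - a).
Proof.
move=> ab; rewrite Rintegral_cst//= lebesgue_measure_itv/= lte_fin.
by move: ab; rewrite le_eqVlt => /orP[/eqP ->|->//]; rewrite ltxx subrr.
Qed.

Lemma le_Rintegral01 f (a b : R) : continuous f -> (forall x, a <= f x <= b) ->
  a <= \int[mu]_(x in `[0, 1]) f x <= b.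
Proof.
move=> cf fab; apply/andP; split.
  rewrite -[leLHS]mulr1 -[X in _ * X]subr0 -Rintegral_itv_cst//.
  apply: le_Rintegral => //; [|exact: itv_integrable|by move=> x _; case/andP: (fab x)].
  exact: (@itv_integrable (cst a) 0 1 (@cst_continuous _ _ _)).
rewrite -[leRHS]mulr1 -[X in _ * X]subr0 -Rintegral_itv_cst//.
apply: le_Rintegral => //; [exact: itv_integrable| |by move=> x _; case/andP: (fab x)].
exact: (@itv_integrable (cst b) 0 1 (@cst_continuous _ _ _)).
Qed.

End unit_interval_integrals.

Section circle.
Context {R : realType}.
Implicit Types (p a z w : R[i]) (r x : R).
Local Notation mu := (@lebesgue_measure R).

Definition cis x : R[i] := cos (2 * pi * x) +i* sin (2 * pi * x).

Lemma normc_cis x : normc (cis x) = 1.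
Proof. by rewrite /= cos2Dsin2 sqrtr1. Qed.

Lemma cis_half x : cis (x + 2^-1) = - cis x.
Proof.
have -> : - cis x = (- cos (2 * pi * x)) +i* (- sin (2 * pi * x)) by [].
have h : 2 * pi * (x + 2^-1) = 2 * pi * x + pi by field.
by rewrite /cis h cosDpi sinDpi.
Qed.

Lemma sqr_cis x : cis x ^+ 2 = cis (2 * x).
Proof.
have -> : cis (2 * x) = (cos (2 * pi * x + 2 * pi * x)) +i* (sin (2 * pi * x + 2 * pi * x)).
  by rewrite /cis (_ : 2 * pi * (2 * x) = 2 * pi * x + 2 * pi * x)//; ring.
rewrite cosD sinD expr2 /cis; simpc.
by rewrite (addrC (sin _ * _)).
Qed.

Definition circle_map p r x : R[i] := p + r%:C * cis x.

Lemma circle_mapB p r x w : circle_map p r x - w = r%:C * cis x - (w - p).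
Proof. by rewrite /circle_map opprB (addrC p) -addrA. Qed.

Lemma normc_rcis r x : 0 <= r -> normc (r%:C * cis x) = r.
Proof. by move=> r0; rewrite Normc.normcM normc_cis mulr1 normc_real ger0_norm. Qed.

Lemma continuous_circle_map p r : continuous (circle_map p r).
Proof.
have ctr : continuous (fun x : R => 2 * pi * x).
  by apply: ctsM; [exact: cst_continuous|move=> ?; exact: cvg_id].
have cc : continuous (fun x : R => cos (2 * pi * x)).
  by move=> x; apply: continuous_comp; [exact: ctr|exact: continuous_cos].
have cs : continuous (fun x : R => sin (2 * pi * x)).
  by move=> x; apply: continuous_comp; [exact: ctr|exact: continuous_sin].
have cn x : (fun y => `|r| * (`|cos (2 * pi * y) - cos (2 * pi * x)| +
    `|sin (2 * pi * y) - sin (2 * pi * x)|)) @ x --> 0.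
  have -> : 0 = `|r| * (`|cos (2 * pi * x) - cos (2 * pi * x)| +
    `|sin (2 * pi * x) - sin (2 * pi * x)|) by rewrite !subrr !normr0 addr0 mulr0.
  have cb (h : R -> R) : continuous h -> continuous (fun y => `|h y - h x|).
    by move=> ch z; apply: cvg_norm; apply: (ctsB ch (@cst_continuous _ _ (h x))).
  exact: (ctsM (@cst_continuous _ _ `|r|) (ctsD (cb _ cc) (cb _ cs))).
move=> x A /nbhs_normcP[e e0 eA].
have /cvgrPdist_lt/(_ e e0) := cn x; apply: filterS => y.
rewrite sub0r normrN => h; apply: eA; apply: le_lt_trans h.
have -> : circle_map p r y - circle_map p r x = r%:C * (cis y - cis x).
  by rewrite /circle_map opprD addrACA subrr add0r mulrBr.
rewrite Normc.normcM normc_real [leRHS]ger0_norm ?mulr_ge0 ?addr_ge0//.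
by rewrite ler_wpM2l//; apply: le_trans (normc_le_ReIm _) _; rewrite ReB ImB.
Qed.

Lemma measurable_circle_map p r : measurable_fun setT (circle_map p r).
Proof.
apply: (measurability _ (erefl : @measurable _ R[i] = <<s open>>)).
move=> /= _ [A oA] <-; rewrite setTI; apply: open_measurable.
by apply: open_comp => // x _; exact: continuous_circle_map.
Qed.

Lemma continuous_circle p r (g : R[i] -> R) : continuous g ->
  continuous (fun x => g (circle_map p r x)).
Proof. by move=> cg x; apply: continuous_comp; [exact: continuous_circle_map|exact: cg]. Qed.

Definition lmean a r : R := \int[mu]_(x in `[0, 1]) ln (normc (r%:C * cis x - a)).

Lemma dist_circle a r x : 0 <= r ->
  `|normc a - r| <= normc (r%:C * cis x - a) <= normc a + r.
Proof.
move=> r0; rewrite -{1}(normc_rcis x r0) distrC normc_ge_dist/=.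
by apply: le_trans (normcD _ _) _; rewrite normcN normc_rcis// addrC.
Qed.

Lemma dist_circle_gt0 a r x : 0 <= r -> normc a != r -> 0 < normc (r%:C * cis x - a).
Proof.
move=> r0 ar; have /andP[h _] := dist_circle a x r0.
by apply: lt_le_trans h; rewrite normr_gt0 subr_eq0.
Qed.

Lemma continuous_ln_circle a r : 0 <= r -> normc a != r ->
  continuous (fun x => ln (normc (r%:C * cis x - a))).
Proof.
move=> r0 ar; apply: cts_ln; first by move=> x; exact: dist_circle_gt0.
have := @continuous_circle 0 r (fun z => normc (z - a)) (@continuous_shift_normc R a).
by under eq_fun do rewrite /circle_map add0r.
Qed.

(** Antipodal points are paired: [|u - a| |- u - a| = |u^2 - a^2|], and [u^2] runs through the
    circle of radius [r^2]. *)
Lemma lmean_double a r : 0 <= r -> normc a != r ->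
  lmean a r = 2^-1 * lmean (a ^+ 2) (r ^+ 2).
Proof.
move=> r0 ar; rewrite /lmean Rintegral_half; last exact: continuous_ln_circle.
rewrite -(@Rintegral_double R (fun x => ln (normc ((r ^+ 2)%:C * cis x - a ^+ 2)))); last first.
  apply: continuous_ln_circle; first exact: exprn_ge0.
  by rewrite expr2 Normc.normcM -expr2 eqrXn2 ?normc_ge0.
apply: eq_Rintegral => x _.
rewrite -lnM ?posrE ?dist_circle_gt0// -Normc.normcM cis_half -sqr_cis mulrN.
rewrite -opprD [X in normc X](_ : _ = - ((r%:C * cis x) ^+ 2 - a ^+ 2)); last by ring.
by rewrite normcN exprMn rmorphXn.
Qed.

Lemma lmean_iter a r n : 0 <= r -> normc a != r ->
  lmean a r = (2 ^+ n)^-1 * lmean (a ^+ (2 ^ n)) (r ^+ (2 ^ n)).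
Proof.
move=> r0 ar; elim: n => [|n ih]; first by rewrite expn0 !expr1 expr0 invr1 mul1r.
rewrite ih lmean_double ?exprn_ge0//.
  by rewrite mulrA -invfM -exprSr -!exprM expnSr.
have normcX k : normc (a ^+ k) = normc a ^+ k.
  by elim: k => [|k hk]; rewrite ?expr0 ?Normc.normc1// !exprS Normc.normcM hk.
by rewrite normcX eqrXn2 ?normc_ge0// expn_gt0.
Qed.

(** After [n] squarings the larger of [|a|] and [r] dominates: the integrand is [2^n * ln m] up to a
    bounded error, and dividing by [2^n] removes the error in the limit. No theory of harmonic
    functions is involved. *)
Lemma lmeanE a r : 0 < r -> normc a != r -> lmean a r = ln (Num.max (normc a) r).
Proof.
move=> r0 ar.
have normcX k : normc (a ^+ k) = normc a ^+ k.
  by elim: k => [|k hk]; rewrite ?expr0 ?Normc.normc1// !exprS Normc.normcM hk.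
set m := Num.max (normc a) r; set l := Num.min (normc a) r.
have m0 : 0 < m by rewrite lt_max r0 orbT.
have l0 : 0 <= l by rewrite le_min normc_ge0 ltW.
have lm : l < m.
  by rewrite /l /m minElt maxElt; case: (ltgtP (normc a) r) ar => //; rewrite eqxx.
have lm1 : l / m < 1 by rewrite ltr_pdivrMr// mul1r.
have lm0 : 0 <= l / m by rewrite divr_ge0// ltW.
(* The power [k = 2^n] satisfies [m^k (1 - l / m) <= m^k - l^k] and [m^k + l^k <= 2 m^k]; [C]
   dominates both logarithmic errors. *)
pose C := ln 2 - ln (1 - l / m).
have C0 : 0 <= C.
  rewrite subr_ge0 (@le_trans _ _ 0)// ?ln_ge0 ?ler1n//.
  by rewrite ln_le0// lerBlDr lerDl.
have ln20 : 0 <= ln 2 :> R by rewrite ln_ge0// ler1n.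
have ln10 : ln (1 - l / m) <= 0 by rewrite ln_le0// lerBlDr lerDl.
have key n : `|lmean a r - ln m| <= C / 2 ^+ n.
  have [k kE] : exists k, (2 ^ n = k.+1)%N by exists (2 ^ n).-1; rewrite prednK ?expn_gt0.
  have rn : 0 <= r ^+ (2 ^ n) by rewrite exprn_ge0 ?ltW.
  have an : normc (a ^+ (2 ^ n)) != r ^+ (2 ^ n).
    by rewrite normcX eqrXn2 ?normc_ge0 ?expn_gt0// ltW.
  have h x : ln m *+ (2 ^ n) - C <= ln (normc ((r ^+ (2 ^ n))%:C * cis x - a ^+ (2 ^ n)))
      <= ln m *+ (2 ^ n) + C.
    have /andP[h1 h2] := dist_circle (a ^+ (2 ^ n)) x rn.
    have {}h1 : m ^+ (2 ^ n) - l ^+ (2 ^ n) <= normc ((r ^+ (2 ^ n))%:C * cis x - a ^+ (2 ^ n)).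
      apply: le_trans h1; rewrite normcX /m /l.
      by case: (leP (normc a) r) => _; [rewrite distrC|]; exact: ler_norm.
    have {}h2 : normc ((r ^+ (2 ^ n))%:C * cis x - a ^+ (2 ^ n)) <= 2 * m ^+ (2 ^ n).
      apply: le_trans h2 _; rewrite normcX mulr_natl mulr2n lerD// lerXn2r ?nnegrE ?normc_ge0
        ?(ltW m0) ?(ltW r0)//.
        by rewrite le_max lexx.
      by rewrite le_max lexx orbT.
    have pos : 0 < normc ((r ^+ (2 ^ n))%:C * cis x - a ^+ (2 ^ n)) by exact: dist_circle_gt0.
    have lmn : (l / m) ^+ (2 ^ n) <= l / m.
      by rewrite kE exprS ler_piMr// exprn_ile1// ltW.
    have {}h1 : m ^+ (2 ^ n) * (1 - l / m) <= normc ((r ^+ (2 ^ n))%:C * cis x - a ^+ (2 ^ n)).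
      apply: le_trans h1.
      have -> : l ^+ (2 ^ n) = m ^+ (2 ^ n) * (l / m) ^+ (2 ^ n).
        by rewrite -exprMn mulrCA mulfV ?mulr1// gt_eqF.
      by rewrite -[X in _ <= X - _]mulr1 -mulrBr ler_pM2l ?exprn_gt0// lerD2l lerN2.
    apply/andP; split.
      have : ln (m ^+ (2 ^ n) * (1 - l / m)) <= ln (normc ((r ^+ (2 ^ n))%:C * cis x - a ^+ (2 ^
        n))).
        by rewrite ler_ln ?posrE// mulr_gt0 ?exprn_gt0// subr_gt0.
      rewrite lnM ?posrE ?exprn_gt0 ?subr_gt0// lnXn//; apply: le_trans.
      by rewrite /C; move: (ln m *+ _) => t; lra.
    have : ln (normc ((r ^+ (2 ^ n))%:C * cis x - a ^+ (2 ^ n))) <= ln (2 * m ^+ (2 ^ n)).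
      by rewrite ler_ln ?posrE// mulr_gt0 ?exprn_gt0.
    rewrite lnM ?posrE ?exprn_gt0// lnXn// => /le_trans; apply.
    by rewrite /C; move: (ln m *+ _) => t; lra.
  have cl := continuous_ln_circle rn an.
  have /andP[g1 g2] := le_Rintegral01 cl h.
  rewrite (lmean_iter n (ltW r0) ar).
  have n0 : 0 < 2 ^+ n :> R by rewrite exprn_gt0.
  have -> : (2 ^+ n)^-1 * lmean (a ^+ (2 ^ n)) (r ^+ (2 ^ n)) - ln m =
     (lmean (a ^+ (2 ^ n)) (r ^+ (2 ^ n)) - ln m *+ (2 ^ n)) / 2 ^+ n.
    by rewrite mulrBl mulrC -[ln m *+ _]mulr_natr natrX mulfK// gt_eqF.
  rewrite normf_div (gtr0_norm n0) ler_pM2r ?invr_gt0// ler_norml.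
  rewrite -/(lmean _ _) in g1 g2; lra.
have : C / 2 ^+ n @[n --> \oo] --> 0.
  have -> : (fun n => C / 2 ^+ n) = (fun n => C * (2^-1) ^+ n).
    by apply/funext => n; rewrite exprVn.
  rewrite -[X in _ --> X](mulr0 C); apply: cvgMl_tmp; apply: cvg_expr.
  by rewrite ger0_norm// invf_lt1// ltr1n.
move=> cC; apply/eqP; rewrite -subr_eq0; apply/negP => /negP d0.
have {}d0 : 0 < `|lmean a r - ln m| by rewrite normr_gt0.
have /cvgrPdist_lt/(_ _ d0)[n _ /(_ n (leqnn n))] := cC.
rewrite sub0r normrN ger0_norm; last by rewrite divr_ge0.
by rewrite ltNge key.
Qed.

End circle.

Section circle_measure.
Context {R : realType}.
Implicit Types (p a z w : R[i]) (r : R).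
Local Notation mu := (@lebesgue_measure R).

Definition circle_rv p r : measurableTypeR R -> R[i] := circle_map p r.

HB.instance Definition _ p r :=
  isMeasurableFun.Build _ _ _ _ (circle_rv p r) (@measurable_circle_map R p r).

Definition circ p r : probability R[i] R :=
  distribution (uniform_prob (@ltr01 R)) (circle_rv p r).

Definition sphere p r : set R[i] := [set z | normc (z - p) = r].

Lemma compact_sphere p r : compact (sphere p r).
Proof.
apply: (@compact_normcP R _ (r + normc p)).
  rewrite (_ : sphere p r = (fun z => normc (z - p)) @^-1` [set r])//.
  apply: preimage_closed; last exact: closed_eq.
  by move=> z _; exact: continuous_shift_normc.
by move=> z /= <-; rewrite -{1}(subrK p z) normcD.
Qed.

Lemma circle_map_sphere p r x : 0 <= r -> sphere p r (circle_map p r x).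
Proof. by move=> r0; rewrite /sphere/= /circle_map addrC addKr normc_rcis. Qed.

Lemma circ_sphere p r : 0 <= r -> circ p r (~` sphere p r) = 0%E.
Proof.
move=> r0; rewrite /circ/= /distribution /pushforward.
rewrite (_ : _ @^-1` _ = set0) ?measure0//.
by apply/seteqP; split => x //=; apply; exact: circle_map_sphere.
Qed.

Lemma circ1 p r : circ p r setT = 1%E.
Proof. exact: probability_setT. Qed.

Lemma ge0_integral_circ p r (F : R[i] -> \bar R) : measurable_fun setT F ->
  (forall z, (0 <= F z)%E) ->
  (\int[circ p r]_z F z = \int[mu]_(x in `[0%R, 1%R]) F (circle_map p r x))%E.
Proof.
move=> mF F0; rewrite ge0_integral_distribution// integral_uniform//.
- by rewrite subr0 invr1 mul1e.
- by apply: measurableT_comp => //; exact: measurable_circle_map.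
- by move=> x; exact: F0.
Qed.

Lemma ge0_Rintegral_circ p r (g : R[i] -> R) : continuous g -> (forall z, 0 <= g z) ->
  \int[circ p r]_z g z = \int[mu]_(x in `[0, 1]) g (circle_map p r x).
Proof.
move=> cg g0; rewrite /Rintegral ge0_integral_circ//.
by apply/measurable_EFinP; exact: continuous_measurableC.
Qed.

Lemma cmean_circ p r : 0 <= r ->
  cmean (circ p r) = \int[mu]_(x in `[0, 1]) cweight (circle_map p r x).
Proof.
move=> r0.
have cN := ctsN (@continuous_cweight R).
have ig := integrable_cweight (circ1 p r) (@compact_sphere p r) (circ_sphere p r0).
have := @ge0_Rintegral_circ p r (fun z => - cweight z) cN
  (fun z => ltac:(by rewrite oppr_ge0; exact: cweight_le0)).
rewrite RintegralN// RintegralN//; first by move=> /oppr_inj.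
by apply: itv_integrable; apply: continuous_circle; exact: continuous_cweight.
Qed.

Lemma cweight_lpot_circ_neq p r w : 0 < r -> normc (w - p) != r ->
  ((cweight w)%:E + lpot (circ p r) w = (- ln (Num.max (normc (w - p)) r) - cmean (circ p r))%:E)%E.
Proof.
move=> r0 wr.
rewrite /lpot.
rewrite ge0_integral_circ; last 2 first.
  - exact: measurable_lkern1.
  - by move=> z; exact: lkern_ge0.
have cw := @continuous_cweight R.
have cl := continuous_ln_circle (ltW r0) wr.
have -> : (\int[mu]_(x in `[0%R, 1%R]) lkern w (circle_map p r x) =
   \int[mu]_(x in `[0%R, 1%R]) (- ln (normc (r%:C * cis x - (w - p)))
      - cweight (circle_map p r x) - cweight w)%R%:E)%E.
  apply: eq_integral => x _.
  have ne : circle_map p r x != w.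
    by rewrite -subr_eq0 -normc_gt0 circle_mapB dist_circle_gt0// ltW.
  have h := log_kernelE (circle_map p r x) w; rewrite log_kernel_neq// circle_mapB in h.
  rewrite lkernC.
  have hf : lkern (circle_map p r x) w \is a fin_num by rewrite /lkern (negbTE ne).
  move: h; rewrite -(fineK hf) -EFinD => -[->]; congr _%:E; ring.
have i1 := itv_integrable 0 1 (ctsN cl).
have i2 := itv_integrable 0 1 (ctsN (continuous_circle (p := p) (r := r) cw)).
have i3 := itv_integrable 0 1 (@cst_continuous R R (- cweight w)).
have i12 := itv_integrable 0 1 (ctsD (ctsN cl) (ctsN (continuous_circle (p := p) (r := r) cw))).
have i123 := itv_integrable 0 1 (ctsD (ctsD (ctsN cl) (ctsN (continuous_circle (p := p) (r := r)
  cw)))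
   (@cst_continuous R R (- cweight w))).
have hR (f : R -> R) : mu.-integrable `[0, 1] (EFin \o f) ->
    (\int[mu]_(x in `[0%R, 1%R]) (f x)%:E)%E = (\int[mu]_(x in `[0, 1]) f x)%:E.
  by move=> fi; rewrite /Rintegral fineK// integrable_fin_num.
rewrite hR// -EFinD; congr _%:E.
rewrite RintegralD// RintegralD// Rintegral_itv_cst// subr0 mulr1.
rewrite RintegralN//; last exact: itv_integrable.
rewrite RintegralN//; last by apply: itv_integrable; exact: continuous_circle.
rewrite -cmean_circ ?ltW// -/(lmean _ _) lmeanE//; ring.
Qed.

Lemma cweight_lpot_circ p r w : 0 < r ->
  ((cweight w)%:E + lpot (circ p r) w = (- ln (Num.max (normc (w - p)) r) - cmean (circ p r))%:E)%E.
Proof.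
move=> r0; have [wr|/cweight_lpot_circ_neq->//] := eqVneq (normc (w - p)) r.
(* The remaining case is a limit from outside of the disc. *)
pose wb b := p + b%:C * (w - p).
have nwb b : 1 < b -> normc (wb b - p) = b * r.
  move=> b1; rewrite /wb addrC addKr Normc.normcM normc_real wr ger0_norm//.
  by rewrite ltW// (lt_trans ltr01).
have hb b : 1 < b ->
    ((cweight (wb b))%:E + lpot (circ p r) (wb b) = (- ln (b * r) - cmean (circ p r))%:E)%E.
  move=> b1; have br : r < b * r by rewrite ltr_pMl.
  rewrite cweight_lpot_circ_neq// nwb// ?gt_eqF//.
  by rewrite max_l// ltW.
rewrite wr maxxx; apply/eqP; rewrite eq_le; apply/andP; split.
  (* Upper bound: the sublevel set at [c] is closed, and the points [wb b] with [b > 1] lie in it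
     and approach [w]. *)
  pose c : \bar R := (- ln r - cmean (circ p r))%:E.
  have := @lpot_lsc R (circ p r) (circ1 p r) cweight c (@continuous_cweight R).
  apply => B /nbhs_normcP[e e0 eB].
  pose b := 1 + e / (2 * r).
  have b1 : 1 < b by rewrite ltrDl divr_gt0// mulr_gt0.
  exists (wb b); split.
    rewrite /= hb// lee_fin lerD2r lerN2 ler_ln ?posrE ?mulr_gt0 ?(lt_trans ltr01 b1)//.
    by rewrite ler_pMl// ltW.
  apply: eB.
  have -> : wb b - w = (b - 1)%:C * (w - p).
    by rewrite /wb rmorphB rmorph1; ring.
  rewrite Normc.normcM normc_real wr /b addrAC subrr add0r ger0_norm; last first.
    by rewrite divr_ge0 ?mulr_ge0// ltW.
  by rewrite invfM mulrA mulfVK ?gt_eqF// ltr_pdivrMr// ltr_pMr// ltr1n.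
apply/lee_addgt0Pr => e e0.
(* Lower bound: moving from [w] to [wb b] multiplies the squared distance to each point of the
   circle by at least [b], so the log kernel drops by at least [e], whereas the value outside drops
   by exactly [2 * e]. The summand [|k|] below keeps the integrands nonnegative. *)
pose b := expR (2 * e).
have b1 : 1 < b by rewrite expR_gt1 mulr_gt0.
have b0 : 0 < b by exact: lt_trans b1.
pose k := cweight (wb b) - cweight w + e.
have pw z : sphere p r z -> (lkern (wb b) z + (k + `|k|)%:E <= lkern w z + `|k|%:E)%E.
  move=> zr; have [<-|wz] := eqVneq w z; first by rewrite [X in (_ <= X + _)%E]/lkern eqxx
    addye// leey.
  have bz : wb b != z.
    apply/eqP => h; have := nwb b b1; rewrite h zr.
    by move=> hr; have : r < b * r by [rewrite ltr_pMl|]; rewrite -hr ltxx.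
  have fw : lkern w z \is a fin_num by rewrite /lkern (negbTE wz).
  have fb : lkern (wb b) z \is a fin_num by rewrite /lkern (negbTE bz).
  have := log_kernelE w z; have := log_kernelE (wb b) z.
  rewrite !log_kernel_neq// -(fineK fw) -(fineK fb) -!EFinD => -[hb'] [hw'].
  rewrite lee_fin.
  suff : ln (normc (wb b - z)) >= ln (normc (w - z)) + e by rewrite /k; lra.
  have wz0 : 0 < normc (w - z) by rewrite normc_gt0 subr_eq0.
  have bz0 : 0 < normc (wb b - z) by rewrite normc_gt0 subr_eq0.
  suff h : b * normc (w - z) ^+ 2 <= normc (wb b - z) ^+ 2.
    have : ln (b * normc (w - z) ^+ 2) <= ln (normc (wb b - z) ^+ 2).
      by rewrite ler_ln ?posrE ?mulr_gt0 ?exprn_gt0.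
    rewrite lnM ?posrE ?exprn_gt0// !lnXn// /b expRK !mulr2n; lra.
  (* [|b a - u|^2 - b |a - u|^2 = (b - 1)^2 r^2] when [|a| = |u| = r]. *)
  have -> : wb b - z = b%:C * (w - p) - (z - p) by rewrite /wb; ring.
  have -> : w - z = (w - p) - (z - p) by rewrite opprB addrA subrK.
  have wr2 : normc (w - p) ^+ 2 = normc (z - p) ^+ 2 by rewrite wr zr.
  move: wr2; move: (w - p) (z - p) => [a1 a2] [u1 u2].
  rewrite !sqr_normc/= => wr2.
  rewrite -subr_ge0 (_ : _ - _ = (b - 1) ^+ 2 * (a1 ^+ 2 + a2 ^+ 2)).
    by rewrite mulr_ge0 ?sqr_ge0 ?addr_ge0 ?sqr_ge0.
  have u1E : u1 ^+ 2 = a1 ^+ 2 + a2 ^+ 2 - u2 ^+ 2 by rewrite wr2 addrK.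
  by ring: u1E.
have k0 : 0 <= k + `|k| by rewrite -lerBlDr sub0r lerNl -normrN ler_norm.
have mint : (lpot (circ p r) (wb b) + (k + `|k|)%:E <= lpot (circ p r) w + `|k|%:E)%E.
  have hC c (u : R[i]) : 0 <= c -> (\int[circ p r]_z (lkern u z + c%:E) = lpot (circ p r) u +
    c%:E)%E.
    move=> c0; rewrite ge0_integralD//.
    - by rewrite integral_cst// [X in (_ * X)%E]circ1 mule1.
    - by move=> z _; exact: lkern_ge0.
    - exact: measurable_lkern1.
  rewrite -!hC//; apply: ae_ge0_le_integral => //.
  - by move=> z _; rewrite adde_ge0// ?lkern_ge0// lee_fin.
  - by apply: emeasurable_funD => //; exact: measurable_lkern1.
  - by move=> z _; rewrite adde_ge0// ?lkern_ge0// lee_fin.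
  - by apply: emeasurable_funD => //; exact: measurable_lkern1.
  - exists (~` sphere p r); split.
    + by apply: measurableC; apply: closed_measurableC; apply: compact_closedC;
      exact: compact_sphere.
    + by apply: circ_sphere; exact: ltW.
    + by move=> z /= hz zr; apply: hz => _; exact: pw.
have hbb := hb b b1.
have fb : lpot (circ p r) (wb b) \is a fin_num.
  by move: hbb; have := lpot_ge0 (circ p r) (wb b); case: (lpot _ _).
move: mint hbb; have := lpot_ge0 (circ p r) w.
rewrite -(fineK fb); case: (lpot (circ p r) w) => [s||]// _; last by move=> _ _;
  rewrite addey// addye// leey.
rewrite -!EFinD !lee_fin => hm [hbb].
have : ln (b * r) = 2 * e + ln r by rewrite lnM ?posrE// /b expRK.
rewrite /k in hm; lra.
Qed.

End circle_measure.

Lemma ge0_integralDc (R : realType) (Q : {measure set R[i] -> \bar R}) (f : R[i] -> \bar R) (c :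
  R) :
  Q setT = 1%E -> measurable_fun setT f -> (forall z, (0 <= f z)%E) ->
  0 <= c -> (\int[Q]_z (f z + c%:E) = \int[Q]_z f z + c%:E)%E.
Proof.
move=> Q1 mf f0 c0; rewrite ge0_integralD//.
by rewrite integral_cst// [X in (_ * X)%E]Q1 mule1.
Qed.

(** * Mean value inequalities for potentials *)

Section mean_value.
Context {R : realType} (P : probability R[i] R).
Implicit Types (p z w : R[i]) (r c d : R).
Local Notation mu := (@lebesgue_measure R).

(** The parallelogram law on antipodal points. The excess [r ^+ 2] over the value at the center is
    what turns weak extremum inequalities into contradictions later. *)
Lemma integral_circ_sqr_normc p r : \int[circ p r]_z (normc z ^+ 2) = normc p ^+ 2 + r ^+ 2.
Proof.
have cn := @continuous_sqr_normc R.
rewrite ge0_Rintegral_circ//; last by move=> z; exact: sqr_ge0.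
rewrite Rintegral_half; last exact: (continuous_circle cn).
have h x : normc (circle_map p r x) ^+ 2 + normc (circle_map p r (x + 2^-1)) ^+ 2 =
    2 * (normc p ^+ 2 + r ^+ 2).
  rewrite /circle_map cis_half.
  have := congr1 (fun x => x ^+ 2) (normc_cis x).
  rewrite expr1n !sqr_normc; case: p => a b; rewrite /cis.
  move: (cos _) (sin _) => u v /= h.
  have {}h : u ^+ 2 = 1 - v ^+ 2 by rewrite -h addrK.
  by ring: h.
under eq_Rintegral do rewrite h.
by rewrite Rintegral_itv_cst ?invr_ge0//; field.
Qed.

Lemma integral_circ_cts p r (g : R[i] -> R) : 0 <= r -> continuous g ->
  (\int[circ p r]_z (g z)%:E = (\int[circ p r]_z g z)%:E)%E.
Proof.
move=> r0 cg; rewrite integral_EFin//.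
exact: (integrable_cts (circ1 p r) (@compact_sphere R p r) (circ_sphere p r0)).
Qed.

Lemma lpot_circ_le p r w : 0 < r ->
  (lpot (circ p r) w + (- cweight p)%:E <= lkern p w + (- cmean (circ p r))%:E)%E.
Proof.
move=> r0.
have [<-|pw] := eqVneq p w; first by rewrite [X in (_ <= X + _)%E]/lkern eqxx addye// leey.
have fl : lkern p w \is a fin_num by rewrite /lkern (negbTE pw).
have := log_kernelE p w; rewrite log_kernel_neq// -(fineK fl) => -[h].
have := @cweight_lpot_circ R p r w r0.
case: (lpot (circ p r) w) => [s|//|//]; rewrite -!EFinD => -[hs].
rewrite lee_fin.
have : ln (normc (p - w)) <= ln (Num.max (normc (w - p)) r).
  rewrite normcC ler_ln ?posrE ?le_max ?lexx ?lt_max ?r0 ?orbT// normc_gt0.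
  by rewrite subr_eq0 eq_sym.
lra.
Qed.

Lemma lpot_circ_eq p r w : 0 < r -> r <= normc (w - p) ->
  (lpot (circ p r) w + (- cweight p)%:E = lkern p w + (- cmean (circ p r))%:E)%E.
Proof.
move=> r0 rw.
have pw : p != w.
  by apply/eqP => h; move: rw; rewrite h subrr Normc.normc0 leNgt r0.
have fl : lkern p w \is a fin_num by rewrite /lkern (negbTE pw).
have := log_kernelE p w; rewrite log_kernel_neq// -(fineK fl) => -[h].
have := @cweight_lpot_circ R p r w r0.
case: (lpot (circ p r) w) => [s|//|//]; rewrite -!EFinD => -[hs].
congr _%:E; move: h hs; rewrite max_l// (normcC w); lra.
Qed.

(** Tonelli exchanges [P] with the circle measure and reduces the claim to the pointwise
    [lpot_circ_le]. The constants stand on the sides where they are nonnegative, so that only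
    nonnegative integrands occur. *)
Lemma integral_circ_lpot_le p r : 0 < r ->
  (\int[circ p r]_z lpot P z + (- cweight p)%:E <= lpot P p + (- cmean (circ p r))%:E)%E.
Proof.
move=> r0; rewrite integral_lpotC.
have cm0 : 0 <= - cmean (circ p r).
  rewrite oppr_ge0 -oppr_ge0 -RintegralN//; last first.
    exact: (integrable_cweight (circ1 p r) (@compact_sphere R p r) (circ_sphere p (ltW r0))).
  by apply: Rintegral_ge0 => z _; rewrite oppr_ge0 cweight_le0.
rewrite -(ge0_integralDc (probability_setT P)) ?oppr_ge0 ?cweight_le0//; last 2 first.
- by apply: measurable_lpot; exact: circ1.
- exact: lpot_ge0.
rewrite -(ge0_integralDc (probability_setT P))//; last 2 first.
- exact: measurable_lkern1.
- exact: lkern_ge0.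
apply: ge0_le_integral => //.
- by move=> w _; apply: adde_ge0; [exact: lpot_ge0|rewrite lee_fin oppr_ge0 cweight_le0].
- by apply: emeasurable_funD => //; apply: measurable_lpot; exact: circ1.
- by apply: emeasurable_funD => //; exact: measurable_lkern1.
- by move=> w _; exact: lpot_circ_le.
Qed.

(** The kernel has the exact mean value property on the circle as seen from a pole outside the open
    disk, and [P] has almost all its poles there. *)
Lemma integral_circ_lpot_eq p r : 0 < r -> P [set w | normc (w - p) < r] = 0%E ->
  (\int[circ p r]_z lpot P z + (- cweight p)%:E = lpot P p + (- cmean (circ p r))%:E)%E.
Proof.
move=> r0 Pr; rewrite integral_lpotC.
have cm0 : 0 <= - cmean (circ p r).
  rewrite oppr_ge0 -oppr_ge0 -RintegralN//; last first.
    exact: (integrable_cweight (circ1 p r) (@compact_sphere R p r) (circ_sphere p (ltW r0))).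
  by apply: Rintegral_ge0 => z _; rewrite oppr_ge0 cweight_le0.
rewrite -(ge0_integralDc (probability_setT P)) ?oppr_ge0 ?cweight_le0//; last 2 first.
- by apply: measurable_lpot; exact: circ1.
- exact: lpot_ge0.
rewrite -(ge0_integralDc (probability_setT P))//; last 2 first.
- exact: measurable_lkern1.
- exact: lkern_ge0.
apply: ae_eq_integral => //.
- by apply: emeasurable_funD => //; apply: measurable_lpot; exact: circ1.
- by apply: emeasurable_funD => //; exact: measurable_lkern1.
- exists [set w | normc (w - p) < r]; split => //.
    apply: open_measurableC.
    rewrite (_ : [set _ | _] = (fun w => normc (w - p)) @^-1` [set x | x < r])//.
    by apply: open_comp; [move=> w _; exact: continuous_shift_normc|exact: open_lt].
  move=> w /= hw; rewrite ltNge; apply/negP => rw; apply: hw => _.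
  exact: lpot_circ_eq.
Qed.

(** The quadratic minorant is the form in which a minimum of a perturbed potential is exploited: its
    mean over the circle exceeds its value at [p] by [d * r ^+ 2]. *)
Lemma super_mean_value p r c d : 0 < r -> 0 <= d ->
  (forall z, sphere p r z -> ((c + d * normc z ^+ 2)%:E <= (cweight z)%:E + lpot P z)%E) ->
  ((c + d * (normc p ^+ 2 + r ^+ 2))%:E <= (cweight p)%:E + lpot P p)%E.
Proof.
move=> r0 d0 hs.
have c0 : 0 <= c + `|c| by rewrite -lerBlDr sub0r lerNl -normrN ler_norm.
have cg : continuous (fun z : R[i] => d * normc z ^+ 2).
  by apply: ctsM; [exact: cst_continuous|exact: continuous_sqr_normc].
have cw := ctsN (@continuous_cweight R).
have : ((c + `|c| + d * (normc p ^+ 2 + r ^+ 2) - cmean (circ p r))%:E <=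
    \int[circ p r]_z lpot P z + `|c|%:E)%E.
  have -> : (c + `|c| + d * (normc p ^+ 2 + r ^+ 2) - cmean (circ p r))%:E =
      (\int[circ p r]_z (c + `|c| + d * normc z ^+ 2 - cweight z)%:E)%E.
    have ii (g : R[i] -> R) := @integrable_cts R (circ p r) _ (circ1 p r) (@compact_sphere R p r)
      (circ_sphere p (ltW r0)) g.
    have cc := @cst_continuous R[i] R (c + `|c|).
    rewrite integral_circ_cts ?ltW//; last exact: ctsB (ctsD cc cg) (@continuous_cweight R).
    rewrite RintegralB//; [|exact: (ii _ (ctsD cc cg))|exact: (ii _ (@continuous_cweight R))].
    rewrite RintegralD//; [|exact: (ii _ cc)|exact: (ii _ cg)].
    rewrite RintegralM1; last exact: circ1.
    rewrite RintegralZl//; last exact: (ii _ (@continuous_sqr_normc R)).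
    by rewrite integral_circ_sqr_normc.
  have -> : (\int[circ p r]_z lpot P z + `|c|%:E = \int[circ p r]_z (lpot P z + `|c|%:E))%E.
    rewrite (ge0_integralDc (circ1 p r))//; last exact: lpot_ge0.
    by apply: measurable_lpot; exact: probability_setT.
  apply: ae_ge0_le_integral => //.
  - move=> z _; rewrite lee_fin addr_ge0 ?oppr_ge0 ?cweight_le0// addr_ge0//.
    by rewrite mulr_ge0 ?sqr_ge0.
  - apply/measurable_EFinP; apply: continuous_measurableC.
    exact: ctsB (ctsD (@cst_continuous _ _ _) cg) (@continuous_cweight R).
  - by move=> z _; apply: adde_ge0; [exact: lpot_ge0|rewrite lee_fin normr_ge0].
  - by apply: emeasurable_funD => //; apply: measurable_lpot; exact: probability_setT.
  - exists (~` sphere p r); split.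
    + by apply: measurableC; apply: closed_measurableC; apply: compact_closedC;
      exact: compact_sphere.
    + by apply: circ_sphere; exact: ltW.
    + move=> z /= hz zr; apply: hz => _.
      have := hs z zr; have := lpot_ge0 P z; case: (lpot P z) => [s||]// _; last by move=> _;
        rewrite addye// leey.
      rewrite -!EFinD !lee_fin; lra.
have := integral_circ_lpot_le p r0.
case: (\int[circ p r]_z lpot P z)%E (lpot P p) (lpot_ge0 P p) => [s||//] [t||//] _;
  rewrite -?EFinD ?lee_fin.
- lra.
- by move=> *; rewrite leey.
- by rewrite addye// leye_eq.
- by move=> *; rewrite leey.
Qed.

Lemma sub_mean_value p r c d : 0 < r -> 0 <= d -> lpot P p \is a fin_num ->
  P [set w | normc (w - p) < r] = 0%E ->
  (forall z, sphere p r z -> ((cweight z)%:E + lpot P z <= (c - d * normc z ^+ 2)%:E)%E) ->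
  ((cweight p)%:E + lpot P p <= (c - d * (normc p ^+ 2 + r ^+ 2))%:E)%E.
Proof.
move=> r0 d0 fp Pr hs.
have c0 : 0 <= c + `|c| by rewrite -lerBlDr sub0r lerNl -normrN ler_norm.
have cg : continuous (fun z : R[i] => d * normc z ^+ 2).
  by apply: ctsM; [exact: cst_continuous|exact: continuous_sqr_normc].
have g0 (z : R[i]) : 0 <= d * normc z ^+ 2 by rewrite mulr_ge0 ?sqr_ge0.
have ii (g : R[i] -> R) := @integrable_cts R (circ p r) _ (circ1 p r) (@compact_sphere R p r)
  (circ_sphere p (ltW r0)) g.
have cc := @cst_continuous R[i] R `|c|.
have cc' := @cst_continuous R[i] R (c + `|c|).
have : (\int[circ p r]_z lpot P z + (d * (normc p ^+ 2 + r ^+ 2) + `|c|)%:E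
    <= (c + `|c| - cmean (circ p r))%:E)%E.
  have -> : (c + `|c| - cmean (circ p r))%:E =
      (\int[circ p r]_z (c + `|c| - cweight z)%:E)%E.
    rewrite integral_circ_cts ?ltW//; last exact: ctsB cc' (@continuous_cweight R).
    rewrite RintegralB//; [|exact: (ii _ cc')|exact: (ii _ (@continuous_cweight R))].
    by rewrite RintegralM1//; exact: circ1.
  have -> : (\int[circ p r]_z lpot P z + (d * (normc p ^+ 2 + r ^+ 2) + `|c|)%:E =
      \int[circ p r]_z (lpot P z + (d * normc z ^+ 2 + `|c|)%:E))%E.
    rewrite [RHS]ge0_integralD//; last 4 first.
    - by move=> z _; exact: lpot_ge0.
    - by apply: measurable_lpot; exact: probability_setT.
    - by move=> z _; rewrite lee_fin addr_ge0.
    - by apply/measurable_EFinP; apply: continuous_measurableC; exact: ctsD cg cc.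
    congr (_ + _)%E.
    rewrite integral_circ_cts ?ltW//; last exact: ctsD cg cc.
    rewrite RintegralD//; [|exact: (ii _ cg)|exact: (ii _ cc)].
    rewrite RintegralM1; last exact: circ1.
    rewrite RintegralZl//; last exact: (ii _ (@continuous_sqr_normc R)).
    by rewrite integral_circ_sqr_normc.
  apply: ae_ge0_le_integral => //.
  - by move=> z _; apply: adde_ge0; [exact: lpot_ge0|rewrite lee_fin addr_ge0 ?normr_ge0].
  - apply: emeasurable_funD; first by apply: measurable_lpot; exact: probability_setT.
    by apply/measurable_EFinP; apply: continuous_measurableC; exact: ctsD cg cc.
  - by move=> z _; rewrite lee_fin addr_ge0// oppr_ge0 cweight_le0.
  - by apply/measurable_EFinP; apply: continuous_measurableC;
    exact: ctsB cc' (@continuous_cweight R).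
  - exists (~` sphere p r); split.
    + by apply: measurableC; apply: closed_measurableC; apply: compact_closedC;
      exact: compact_sphere.
    + by apply: circ_sphere; exact: ltW.
    + move=> z /= hz zr; apply: hz => _.
      have := hs z zr; have := lpot_ge0 P z; case: (lpot P z) => [s||]// _.
      rewrite -!EFinD !lee_fin; lra.
move: fp (integral_circ_lpot_eq r0 Pr); case: (lpot P p) => [t||]// _.
case: (\int[circ p r]_z lpot P z)%E => [s||]//.
rewrite -!EFinD => -[h]. rewrite !lee_fin; lra.
Qed.

End mean_value.

(** * The potential of the equilibrium measure *)

Section potential_bounds.
Context {R : realType} (P : {measure set R[i] -> \bar R}) (K : set R[i]).
Hypotheses (P1 : P setT = 1%E) (cK : compact K) (PK : P (~` K) = 0%E).

Let mK : measurable K.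
Proof. by apply: closed_measurableC; exact: compact_closedC. Qed.

(** A bound [c] on [log_kernel z w], rewritten as one on [lkern z w] and raised by [|c|] to be
    nonnegative. *)
Let cgc (c : R) z : continuous (fun w : R[i] => c + `|c| - cweight z - cweight w).
Proof.
by apply: ctsB; [exact: (@cst_continuous _ _ (c + `|c| - cweight z))|exact: continuous_cweight].
Qed.

Let cgc_ge0 (c : R) (z w : R[i]) : 0 <= c + `|c| - cweight z - cweight w.
Proof.
have : 0 <= c + `|c| by rewrite -lerBlDr sub0r lerNl -normrN ler_norm.
have := cweight_le0 z; have := cweight_le0 w; lra.
Qed.

Let int_cgc (c : R) z :
  (\int[P]_w (c + `|c| - cweight z - cweight w)%:E = (c + `|c| - cweight z - cmean P)%:E)%E.
Proof.
have ig := integrable_cts P1 cK PK (@cgc c z).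
rewrite integral_EFin//; congr _%:E.
rewrite RintegralB//; first by rewrite RintegralM1.
- exact: (integrable_cst1 P1).
- exact: (integrable_cweight P1 cK PK).
Qed.

Lemma potential_le c z : (forall w, K w -> (log_kernel z w <= c%:E)%E) ->
  (potential P z <= c%:E)%E.
Proof.
move=> h.
suff : (lpot P z + `|c|%:E <= (c + `|c| - cweight z - cmean P)%:E)%E.
  rewrite (potentialE P1 cK PK); have := lpot_ge0 P z; case: (lpot P z) => [s||]// _.
  by rewrite -!EFinD !lee_fin; lra.
rewrite -int_cgc /lpot -(ge0_integralDc P1)//; [|exact: measurable_lkern1|exact: lkern_ge0].
apply: ae_ge0_le_integral => //.
- by move=> w _; apply: adde_ge0; [exact: lkern_ge0|rewrite lee_fin normr_ge0].
- by apply: emeasurable_funD => //; exact: measurable_lkern1.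
- by move=> w _; rewrite lee_fin.
- by apply/measurable_EFinP; apply: continuous_measurableC; exact: cgc.
- exists (~` K); split => //; first exact: measurableC.
  move=> w /= hw Kw; apply: hw => _; have := h w Kw; rewrite log_kernelE.
  have := lkern_ge0 z w; case: (lkern z w) => [s||]// _.
  by rewrite -!EFinD !lee_fin; lra.
Qed.

Lemma potential_ge c z : (forall w, K w -> (c%:E <= log_kernel z w)%E) ->
  (c%:E <= potential P z)%E.
Proof.
move=> h.
suff : ((c + `|c| - cweight z - cmean P)%:E <= lpot P z + `|c|%:E)%E.
  rewrite (potentialE P1 cK PK); have := lpot_ge0 P z; case: (lpot P z) => [s||]// _.
    by rewrite -!EFinD !lee_fin; lra.
  by move=> _; rewrite addey// leey.
rewrite -int_cgc /lpot -(ge0_integralDc P1)//; [|exact: measurable_lkern1|exact: lkern_ge0].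
apply: ae_ge0_le_integral => //.
- by move=> w _; rewrite lee_fin.
- by apply/measurable_EFinP; apply: continuous_measurableC; exact: cgc.
- by move=> w _; apply: adde_ge0; [exact: lkern_ge0|rewrite lee_fin normr_ge0].
- by apply: emeasurable_funD => //; exact: measurable_lkern1.
- exists (~` K); split => //; first exact: measurableC.
  move=> w /= hw Kw; apply: hw => _; have := h w Kw; rewrite log_kernelE.
  have := lkern_ge0 z w; case: (lkern z w) => [s||]// _; last by move=> _; rewrite addye// leey.
  by rewrite -!EFinD !lee_fin; lra.
Qed.

End potential_bounds.

Section equilibrium_potential.
Context {R : realType} (P : probability R[i] R) (E D : set R[i]) (V : R).
Hypotheses (cE : compact E) (PE : P (~` E) = 0%E) (PV : energy P = V%:E).
Hypotheses (oD : open D) (DE : D `<=` ~` E) (cD : compact (~` D)).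
Hypothesis regD : forall w, closure D w -> ~ D w -> forall v : R, v < V ->
  exists2 e, 0 < e & forall z, D z -> normc (z - w) < e -> (v%:E < potential P z)%E.

Let P1 : P setT = 1%E. Proof. exact: probability_setT. Qed.
Let potE := potentialE P1 cE PE.
Local Notation cm := (cmean P).

(* Minimum principle on the complement of [D]: otherwise a subharmonic
   perturbation of the potential has a minimum that contradicts the super mean
   value property; this works even on the boundary of [D], near which the
   potential is almost [V] in [D]. *)
Lemma potential_ge_compl z0 : ~ D z0 -> (V%:E <= potential P z0)%E.
Proof.
move=> Dz0; rewrite leNgt; apply/negP => hz0.
have [Rb Rb0 hRb] := compact_bounded_normc cD.
have : potential P z0 \is a fin_num.
  move: hz0; rewrite potE; have := lpot_ge0 P z0.
  by case: (lpot P z0).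
move=> fz0; move: hz0; rewrite -(fineK fz0) lte_fin; set v0 := fine _ => v0V.
have hv0 : potential P z0 = v0%:E by rewrite /v0 fineK.
(* The perturbation [d * |z|^2] is then at most [(V - v0) / 2] on the disk of radius [2 * Rb], which
   contains every circle of radius at most [Rb] about a point of the complement of [D]. *)
pose d := (V - v0) / (8 * Rb ^+ 2).
have d0 : 0 < d by rewrite divr_gt0 ?subr_gt0// mulr_gt0// exprn_gt0.
have dR : d * (2 * Rb) ^+ 2 = (V - v0) / 2.
  by rewrite /d; field; rewrite gt_eqF.
have cf : continuous (fun z : R[i] => cweight z + cm - d * normc z ^+ 2).
  apply: ctsB; first by apply: ctsD; [exact: continuous_cweight|exact: cst_continuous].
  by apply: ctsM; [exact: cst_continuous|exact: continuous_sqr_normc].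
have [p Kp pmin] := compact_lsc_min (ex_intro _ z0 Dz0) cD (fun c => @lpot_lsc R P P1 _ c cf).
have shift z : ((cweight z + cm - d * normc z ^+ 2)%:E + lpot P z =
    potential P z - (d * normc z ^+ 2)%:E)%E.
  rewrite potE; have := lpot_ge0 P z; case: (lpot P z) => [s||]// _.
  by rewrite -!EFinD; congr _%:E; ring.
have := pmin z0 Dz0; rewrite !shift hv0.
have fp : potential P p \is a fin_num.
  move: (pmin z0 Dz0); rewrite !shift hv0 potE; have := lpot_ge0 P p.
  by case: (lpot P p) => //; rewrite addey// addye.
rewrite -(fineK fp) -!EFinB lee_fin; set hp := fine (potential P p) => hpz0.
have hphi z : ~ D z -> ((hp - d * normc p ^+ 2 + d * normc z ^+ 2)%:E <= potential P z)%E.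
  move=> Dz; have := pmin z Dz; rewrite !shift -(fineK fp) -/hp.
  case: (potential P z) => [s||]//; last by move=> _; rewrite leey.
  by rewrite -!EFinB !lee_fin; lra.
have sq0 (z : R[i]) : 0 <= d * normc z ^+ 2 by rewrite mulr_ge0 ?sqr_ge0 ?ltW.
(* Either [p] is in the closure of [D], where the boundary hypothesis applies, or a whole
   neighbourhood of [p] misses [D]. *)
have [e e0 he] : exists2 e, 0 < e & forall z, normc (z - p) < e -> D z ->
    ((v0 + (V - v0) / 2)%:E < potential P z)%E.
  have [clp|nclp] := pselect (closure D p).
    have [|e e0 he] := regD clp Kp (v := v0 + (V - v0) / 2); first by lra.
    by exists e => // z pz Dz; exact: he.
  have /nbhs_normcP[e e0 he] : nbhs p (~` D).
    by apply: contrapT => h; apply: nclp => B Bp; apply: contrapT => hB; apply: h;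
       apply: filterS Bp => z Bz Dz; apply: hB; exists z.
  by exists e => // z /he.
pose r := Num.min Rb (e / 2).
have r0 : 0 < r by rewrite lt_min Rb0 divr_gt0.
have := @super_mean_value R P p r (hp - d * normc p ^+ 2 - cm) d r0 (ltW d0).
have hsph z : sphere p r z -> ((hp - d * normc p ^+ 2 + d * normc z ^+ 2)%:E <= potential P z)%E.
  move=> zr; have [Dz|] := pselect (D z); last exact: hphi.
  have ze : normc (z - p) < e.
    have : r <= e / 2 by rewrite /r ge_min lexx orbT.
    rewrite zr; lra.
  apply: le_trans (ltW (he z ze Dz)); rewrite lee_fin -dR.
  have : d * normc z ^+ 2 <= d * (2 * Rb) ^+ 2.
    rewrite ler_pM2l// lerXn2r ?nnegrE ?normc_ge0 ?mulr_ge0 ?(ltW Rb0)//.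
    rewrite -(subrK p z) (le_trans (normcD _ _))// zr.
    by rewrite mulr_natl mulr2n lerD// ?ge_min ?lexx// hRb.
  have := sq0 z0; lra.
have -> : ((hp - d * normc p ^+ 2 - cm + d * (normc p ^+ 2 + r ^+ 2))%:E
    <= (cweight p)%:E + lpot P p)%E = false.
  apply/negbTE; rewrite -ltNge.
  have : potential P p = hp%:E by rewrite /hp fineK.
  rewrite potE; case: (lpot P p) => [s|//|//]; rewrite -!EFinD => -[<-].
  rewrite lte_fin; have : 0 < d * r ^+ 2 by rewrite mulr_gt0// exprn_gt0.
  lra.
move=> smv; suff : false by []; apply: smv => z /hsph; rewrite potE; have := lpot_ge0 P z;
  case: (lpot P z) => [s||]// _; last by move=> _; rewrite addey// leey.
by rewrite -!EFinD !lee_fin; lra.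
Qed.

Let g z : R := V - cm - cweight z.

Let cg : continuous g.
Proof. by apply: ctsB; [exact: (@cst_continuous _ _ (V - cm))|exact: continuous_cweight]. Qed.

(** The part of [E] where the potential is at most [V]. Together with the minimum principle this
    makes [lpot P] equal there to the continuous [g], the situation in which [lpot_uniform]
    applies. *)
Definition carrier : set R[i] := [set z | E z /\ (lpot P z <= (g z)%:E)%E].

Lemma lpot_ge_E z : E z -> ((g z)%:E <= lpot P z)%E.
Proof.
move=> Ez; have := @potential_ge_compl z (fun Dz => DE Dz Ez); rewrite potE.
have := lpot_ge0 P z; case: (lpot P z) => [s||]// _; last by move=> _; rewrite leey.
by rewrite -!EFinD !lee_fin /g; lra.
Qed.

Lemma lpot_carrier z : carrier z -> lpot P z = (g z)%:E.
Proof. by move=> [Ez h]; apply/eqP; rewrite eq_le h lpot_ge_E. Qed.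

Lemma closed_carrier : closed carrier.
Proof.
have -> : carrier = E `&` [set z | ((- g z)%:E + lpot P z <= 0)%E].
  apply/seteqP; split => z /= [Ez h]; split => //=.
    by rewrite EFinN addeC sube_le0.
  by move: h; rewrite EFinN addeC sube_le0.
by apply: closedI; [exact: compact_closedC|exact: (@lpot_lsc R P P1 _ 0%E (ctsN cg))].
Qed.

Lemma compact_carrier : compact carrier.
Proof.
apply: subclosed_compact closed_carrier cE _.
by move=> z [].
Qed.

(** The potential is at least [V] on [E] and its mean, the energy, is [V]; hence it equals [V]
    almost everywhere. *)
Lemma carrier_full : P (~` carrier) = 0%E.
Proof.
have mE : measurable E by apply: closed_measurableC; exact: compact_closedC.
have mS : measurable carrier by apply: closed_measurableC; exact: closed_carrier.
have ml := @measurable_lpot R P P1.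
have en := energyE P1 cE PE; rewrite PV in en.
have intl : (\int[P]_z lpot P z = (V - 2 * cm)%:E)%E.
  move: en; case: (integral P setT (lpot P)) => [s||]//.
  by rewrite -EFinD => -[->]; congr _%:E; ring.
have il : P.-integrable setT (lpot P).
  apply/integrableP; split => //.
  by under eq_integral do rewrite gee0_abs ?lpot_ge0//; rewrite intl ltry.
have ig := integrable_cts P1 cE PE cg.
have ing : (\int[P]_z (g z)%:E = (V - 2 * cm)%:E)%E.
  rewrite integral_EFin//; congr _%:E.
  rewrite RintegralB//; [|exact: (integrable_cst1 P1)|exact: (integrable_cweight P1 cE PE)].
  by rewrite RintegralM1// /cmean; ring.
have int0 : (\int[P]_z `|lpot P z - (g z)%:E| = 0)%E.
  have -> : (\int[P]_z `|lpot P z - (g z)%:E| = \int[P]_z (lpot P z - (g z)%:E))%E.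
    apply: ae_eq_integral => //.
    - apply: measurableT_comp => //; apply: emeasurable_funB => //.
      by apply/measurable_EFinP; exact: continuous_measurableC.
    - apply: emeasurable_funB => //.
      by apply/measurable_EFinP; exact: continuous_measurableC.
    - exists (~` E); split => //; first exact: measurableC.
      move=> z /= hz Ez; apply: hz => _.
      have h : (0 <= lpot P z - (g z)%:E)%E by rewrite sube_ge0// lpot_ge_E.
      by rewrite gee0_abs.
  by rewrite integralB// intl ing -EFinB subrr.
have mlg : measurable_fun setT (fun z => (lpot P z - (g z)%:E)%E).
  apply: emeasurable_funB => //.
  by apply/measurable_EFinP; exact: continuous_measurableC.
have /(ae_eq_integral_abs P measurableT mlg)[N [mN N0 hN]] := int0.
apply: (@subset_measure0 _ _ _ P _ (~` E `|` N)).
- exact: measurableC.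
- by apply: measurableU => //; exact: measurableC.
- move=> z /= nS; have [Ez|] := pselect (E z); last by left.
  right; apply: hN => /= h; apply: nS; split => //.
  by rewrite -sube_le0 h.
- have mE' : measurable (~` E) by exact: measurableC.
  have := measureU2 P mE' mN.
  rewrite [X in (_ <= X + _)%E]PE [X in (_ <= _ + X)%E]N0 adde0 => h.
  by apply/eqP; rewrite eq_le h measure_ge0.
Qed.

Lemma equilibrium_uniform (e : R) : 0 < e ->
  exists N, forall z, (lpot P z <= (bpot P N z + e)%:E)%E.
Proof. exact: (lpot_uniform P1 compact_carrier carrier_full cg lpot_carrier). Qed.

Lemma equilibrium_fin z : lpot P z \is a fin_num.
Proof. exact: (lpot_fin_num P1 compact_carrier carrier_full cg lpot_carrier). Qed.

Definition eqpot z : R := cweight z + cm + fine (lpot P z).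

Lemma eqpotE z : potential P z = (eqpot z)%:E.
Proof. by rewrite potE /eqpot -[in LHS](fineK (equilibrium_fin z)). Qed.

Lemma continuous_eqpot : continuous eqpot.
Proof.
apply: ctsD; first by apply: ctsD; [exact: continuous_cweight|exact: cst_continuous].
exact: (continuous_lpot P1 compact_carrier carrier_full cg lpot_carrier).
Qed.

(** A point [p] with potential above [V] is off the closed carrier, so [P] has no mass near it and
    the mean value property holds on small circles. If the bound failed, the potential plus
    [d * |z|^2] would have its maximum over a large disk at such a point in the interior,
    contradicting that property. *)
Lemma eqpot_le z0 : eqpot z0 <= V.
Proof.
rewrite leNgt; apply/negP => hz0.
have [RE RE0 hRE] := compact_bounded_normc cE.
(* Beyond [R1] every point of [E] is at distance at least [expR (- V)], so the kernel, and with it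
   the potential, is at most [V]. *)
pose R1 := RE + normc z0 + expR (- V) + 1.
have eV := expR_gt0 (- V).
have R10 : 0 < R1 by rewrite /R1; have := normc_ge0 z0; lra.
have far z : R1 <= normc z -> eqpot z <= V.
  move=> zR; rewrite -lee_fin -eqpotE; apply: (potential_le P1 cE PE) => w Ew.
  have h : expR (- V) <= normc (z - w).
    have := normc_ge_distl z w; have := hRE w Ew; have := normc_ge0 z0; rewrite /R1 in zR; lra.
  rewrite log_kernel_neq; last by rewrite -subr_eq0 -normc_gt0 (lt_le_trans eV).
  rewrite lee_fin lerNl -[leLHS]expRK ler_ln ?posrE//.
  exact: lt_le_trans eV h.
pose d := (eqpot z0 - V) / (2 * R1 ^+ 2).
have d0 : 0 < d by rewrite divr_gt0 ?subr_gt0// mulr_gt0// exprn_gt0.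
have dR : d * R1 ^+ 2 = (eqpot z0 - V) / 2 by rewrite /d; field; rewrite gt_eqF.
have cf : continuous (fun z : R[i] => eqpot z + d * normc z ^+ 2).
  apply: ctsD; first exact: continuous_eqpot.
  by apply: ctsM; [exact: cst_continuous|exact: continuous_sqr_normc].
have [|p pR pmax] := EVT_maxC (K := [set z | normc z <= R1]) _ (@compact_normc_le R R1) cf.
  by exists z0; rewrite /= /R1; lra.
have sq0 (z : R[i]) : 0 <= d * normc z ^+ 2 by rewrite mulr_ge0 ?sqr_ge0 ?ltW.
have sqR (z : R[i]) : normc z <= R1 -> d * normc z ^+ 2 <= d * R1 ^+ 2.
  by move=> zR; rewrite ler_pM2l// lerXn2r ?nnegrE ?normc_ge0// ltW.
have hp : V < eqpot p.
  have := pmax z0 _; rewrite /= => /(_ _)/le_trans => h.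
  have z0R : normc z0 <= R1 by rewrite /R1; lra.
  have := pmax z0 z0R; have := sqR p pR; have := sq0 z0; rewrite dR; lra.
have pR1 : normc p < R1 by rewrite ltNge; apply/negP => /far; rewrite leNgt hp.
have pS : ~ carrier p.
  move=> /lpot_carrier h; move: hp; rewrite /eqpot h /= /g; lra.
have /nbhs_normcP[e e0 he] : nbhs p (~` carrier).
  by apply: open_nbhs_nbhs; split => //; apply: closed_openC; exact: closed_carrier.
pose r := Num.min (R1 - normc p) (e / 2).
have r0 : 0 < r by rewrite lt_min subr_gt0 pR1 divr_gt0.
have Pr : P [set w | normc (w - p) < r] = 0%E.
  apply: (@subset_measure0 _ _ _ P _ (~` carrier)).
  - apply: open_measurableC.
    rewrite (_ : [set _ | _] = (fun w => normc (w - p)) @^-1` [set x | x < r])//.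
    by apply: open_comp; [move=> w _; exact: continuous_shift_normc|exact: open_lt].
  - by apply: measurableC; apply: closed_measurableC; exact: closed_carrier.
  - by move=> w /= wr; apply: he; apply: lt_le_trans wr _; rewrite ge_min; apply/orP; right; lra.
  - exact: carrier_full.
have := @sub_mean_value R P p r (eqpot p + d * normc p ^+ 2 - cm) d r0 (ltW d0) (equilibrium_fin
  p) Pr.
have fE z : ((cweight z)%:E + lpot P z = (eqpot z - cm)%:E)%E.
  by rewrite -(fineK (equilibrium_fin z)) -EFinD; congr _%:E; rewrite /eqpot; ring.
rewrite fE lee_fin leNgt => /(_ _)/negP h.
have : 0 < d * r ^+ 2 by rewrite mulr_gt0// exprn_gt0.
have : forall z, sphere p r z -> ((cweight z)%:E + lpot P z <= (eqpot p + d * normc p ^+ 2 - cm -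
  d * normc z ^+ 2)%:E)%E.
  move=> z zr; rewrite fE lee_fin.
  suff : normc z <= R1 by move=> /pmax; lra.
  rewrite -(subrK p z) (le_trans (normcD _ _))// zr -lerBrDr.
  by rewrite /r ge_min lexx.
move=> /h hh dr; apply: hh; lra.
Qed.

Lemma eqpot_compl z : ~ D z -> eqpot z = V.
Proof.
move=> Dz; apply/eqP; rewrite eq_le eqpot_le/=.
by rewrite -lee_fin -eqpotE potential_ge_compl.
Qed.

End equilibrium_potential.

(** * The outer domain in the one-point compactification *)

Section outer_domain.
Context {R : realType}.
Implicit Types (E : set R[i]) (z w : R[i]).
Local Notation opc := (one_point_compactification R[i]).

Definition line z w (t : R) : R[i] := z + t%:C * (w - z).

Lemma continuous_line z w : continuous (line z w).
Proof.
move=> x A /nbhs_normcP[e e0 eA].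
have n0 : 0 < normc (w - z) + 1 by rewrite ltr_wpDl// normc_ge0.
exists (e / (normc (w - z) + 1)); first by rewrite /= divr_gt0.
move=> y /=; rewrite ltr_pdivlMr// => xy; apply: eA.
have -> : line z w y - line z w x = (y - x)%:C * (w - z).
  by rewrite /line rmorphB; ring.
rewrite Normc.normcM normc_real distrC; apply: le_lt_trans xy.
by rewrite ler_wpM2l// lerDl.
Qed.

Lemma connected_line (z w : R[i]) (I : interval R) :
  connected ((fun t => Some (line z w t) : opc) @` [set` I]).
Proof.
apply: (@connected_continuous_connected _ opc).
  exact/connected_intervalP/interval_is_interval.
apply: continuous_subspaceT => t.
apply: continuous_comp; first exact: continuous_line.
exact: one_point_compactification_some_continuous.
Qed.

Lemma finite_outer_domain_sub E : finite_outer_domain E `<=` ~` E.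
Proof.
move=> z /connected_component_sub hz Ez; apply: hz.
by exists z.
Qed.

Lemma outer_segment E z w : finite_outer_domain E z ->
  (forall t, 0 <= t <= 1 -> ~ E (line z w t)) -> finite_outer_domain E w.
Proof.
move=> Dz h; rewrite /finite_outer_domain/= /outer_domain.
apply: (@connected_component_trans opc _ (Some z) None) => //.
have := @connected_line z w `[0, 1]%R; set B := _ @` _ => cB.
have z0 : line z w 0 = z by rewrite /line mul0r addr0.
have w1 : line z w 1 = w by rewrite /line mul1r addrC subrK.
apply: (@connected_component_max opc _ B _ _ _ cB).
- by exists 0; rewrite /= ?in_itv/= ?lexx ?ler01// z0.
- move=> _ [t /= t01 <-] [u Eu [tu]]; move: t01; rewrite in_itv/= => /h.
  by rewrite -tu.
- by exists 1; rewrite /= ?in_itv/= ?lexx ?ler01// w1.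
Qed.

Lemma outer_ball E z (e : R) : finite_outer_domain E z ->
  (forall w, normc (w - z) < e -> ~ E w) ->
  forall w, normc (w - z) < e -> finite_outer_domain E w.
Proof.
move=> Dz h w wz; apply: (outer_segment Dz) => t /andP[t0 t1]; apply: h.
rewrite /line addrC addKr Normc.normcM normc_real ger0_norm//.
by apply: le_lt_trans wz; rewrite ler_piMl// normc_ge0.
Qed.

Lemma open_finite_outer_domain E : closed E -> open (finite_outer_domain E).
Proof.
move=> cE; rewrite openE => z Dz.
have /nbhs_normcP[e e0 he] : nbhs z (~` E).
  by apply: open_nbhs_nbhs; split; [exact: closed_openC|exact: finite_outer_domain_sub].
by apply/nbhs_normcP; exists e => // w; exact: (outer_ball Dz he).
Qed.

(** The radial ray from [z] outwards is connected and accumulates at infinity; its closure in the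
    compactification is a connected set through [z] and infinity that avoids [E]. *)
Lemma outer_far E (r : R) : 0 < r -> (forall w, E w -> normc w <= r) ->
  forall z, r < normc z -> finite_outer_domain E z.
Proof.
move=> r0 hE z rz; rewrite /finite_outer_domain/= /outer_domain.
have := @connected_line 0 z `[1, +oo[%R; set B := _ @` _ => /connected_closure cB.
apply: (@connected_component_max opc _ (closure B) _ _ _ cB).
- move=> U [C [cptC _] hU].
  have [rC rC0 hC] := compact_bounded_normc cptC.
  pose t : R := 1 + rC / normc z.
  have z0 : 0 < normc z by exact: lt_trans rz.
  have t1 : 1 <= t by rewrite lerDl divr_ge0// ltW.
  exists (Some (line 0 z t)); split.
    by exists t => //=; rewrite in_itv/= t1.
  apply: hU; left; exists (line 0 z t) => //= /hC.
  rewrite /line add0r subr0 Normc.normcM normc_real ger0_norm ?(le_trans ler01)//.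
  by rewrite /t mulrDl mulfVK ?gt_eqF// mul1r leNgt ltrDr z0.
- suff hcl : closure B `<=` ~` (Some @` [set w | normc w < normc z]).
    move=> x Bx [w Ew wx]; apply: (hcl x Bx); exists w => //=.
    exact: le_lt_trans (hE w Ew) rz.
  have cS : closed (~` (Some @` [set w | normc w < normc z]) : set opc).
    apply: open_closedC; apply: one_point_compactification_open_some.
    rewrite (_ : [set _ | _] = (@Normc.normc R) @^-1` [set x | x < normc z])//.
    by apply: open_comp; [move=> w _; exact: continuous_normc|exact: open_lt].
  apply: subset_trans (closure_subset _) cS.
  move=> _ [t /= t1 <-] [w /= wz [tw]]; move: wz; rewrite tw.
  rewrite /line add0r subr0 Normc.normcM normc_real.
  move: t1; rewrite in_itv/= andbT => t1; rewrite ger0_norm ?(le_trans ler01)//.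
  by rewrite ltNge ler_peMl// normc_ge0.
- apply: subset_closure; exists 1; rewrite /= ?in_itv/= ?lexx//.
  by rewrite /line mul1r add0r subr0.
Qed.

Lemma compact_outer_compl E : compact E -> compact (~` finite_outer_domain E).
Proof.
move=> cE; have [r r0 hr] := compact_bounded_normc cE.
apply: (@compact_normcP R _ r).
  by apply: open_closedC; apply: open_finite_outer_domain; exact: compact_closedC.
by move=> z Dz; rewrite leNgt; apply/negP => /(outer_far r0 hr).
Qed.

Lemma regular_near E (P : {measure set R[i] -> \bar R}) (V : R) w :
  (V%:E - potential P z)%E @[z --> within (finite_outer_domain E) (nbhs w)] --> 0%E ->
  forall e : R, 0 < e -> exists2 d, 0 < d & forall z, finite_outer_domain E z ->
    normc (z - w) < d -> potential P z \is a fin_num /\ `|V - fine (potential P z)| < e.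
Proof.
move=> /fine_cvgP[hf /cvgrPdist_lt hc] e e0.
have /nbhs_normcP[d1 d10 h1] : within (finite_outer_domain E) (nbhs w)
  (fun z => V%:E - potential P z \is a fin_num)%E := hf.
have /nbhs_normcP[d2 d20 h2] := hc e e0.
exists (Num.min d1 d2); first by rewrite lt_min d10.
move=> z Dz; rewrite lt_min => /andP[/h1/(_ Dz) f1 /h2/(_ Dz)].
have fp : potential P z \is a fin_num by move: f1; case: (potential P z).
by rewrite /= -(fineK fp) -EFinB /= sub0r normrN.
Qed.

End outer_domain.

(** * Weak closeness from moments *)

Section feature_polynomials.
Context {R : realType}.
Implicit Types (z w : R[i]) (p q : R[i] -> R).

Definition wordm (s : seq 'I_4) z : R := \prod_(i <- s) feat i z.

(** The explicit list exposes the two quantities that [qform_fpoly] reads off: the sum of the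
    absolute coefficients and the greatest word length. *)
Definition fpoly p := exists l : seq (R * seq 'I_4), forall z,
  p z = \sum_(x <- l) x.1 * wordm x.2 z.

Lemma fpoly_cst c : fpoly (fun=> c).
Proof. by exists [:: (c, [::])] => z; rewrite big_seq1 /wordm big_nil mulr1. Qed.

Lemma fpoly_feat i : fpoly (feat i).
Proof. by exists [:: (1, [:: i])] => z; rewrite big_seq1 /wordm big_seq1 mul1r. Qed.

Lemma fpolyD p q : fpoly p -> fpoly q -> fpoly (fun z => p z + q z).
Proof. by move=> [l hl] [m hm]; exists (l ++ m) => z; rewrite big_cat hl hm. Qed.

Lemma fpolyM p q : fpoly p -> fpoly q -> fpoly (fun z => p z * q z).
Proof.
move=> [l hl] [m hm].
exists [seq (x.1 * y.1, x.2 ++ y.2) | x <- l, y <- m] => z.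
rewrite big_allpairs_dep hl hm mulr_suml; apply: eq_bigr => x _.
rewrite mulr_sumr; apply: eq_bigr => y _.
by rewrite /wordm big_cat/= mulrACA.
Qed.

Lemma fpolyX p n : fpoly p -> fpoly (fun z => p z ^+ n).
Proof.
move=> hp; elim: n => [|n ih].
  by under eq_fun do rewrite expr0; exact: fpoly_cst.
by under eq_fun do rewrite exprS; exact: fpolyM.
Qed.

Lemma fpoly_sum I (s : seq I) (F : I -> R[i] -> R) :
  (forall i, fpoly (F i)) -> fpoly (fun z => \sum_(i <- s) F i z).
Proof.
move=> hF; elim: s => [|i s ih].
  by under eq_fun do rewrite big_nil; exact: fpoly_cst.
by under eq_fun do rewrite big_cons; exact: fpolyD.
Qed.

Lemma fpoly_skern w : fpoly (skern w).
Proof. by apply: fpoly_sum => i; apply: fpolyM; [exact: fpoly_cst|exact: fpoly_feat]. Qed.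

Lemma wordm_mono (s : seq 'I_4) z :
  wordm s z = mono [ffun j : 'I_(size s) => nth ord0 s j] z.
Proof.
rewrite /wordm (big_nth ord0) big_mkord /mono; apply: eq_bigr => j _.
by rewrite ffunE.
Qed.

Lemma continuous_wordm s : continuous (wordm s).
Proof. by apply: cts_prod => i; exact: continuous_feat. Qed.

Lemma le_wordm1 s z : `|wordm s z| <= 1.
Proof. by rewrite wordm_mono le_mono1. Qed.

Lemma continuous_fpoly p : fpoly p -> continuous p.
Proof.
move=> [l hl]; rewrite (_ : p = fun z => \sum_(x <- l) x.1 * wordm x.2 z); last exact/funext.
by apply: cts_sum => x; apply: ctsM; [exact: cst_continuous|exact: continuous_wordm].
Qed.

Lemma fpoly_bounded p : fpoly p -> exists M, forall z, `|p z| <= M.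
Proof.
move=> [l hl]; exists (\sum_(x <- l) `|x.1|) => z; rewrite hl.
apply: le_trans (ler_norm_sum _ _ _) _; apply: ler_sum => x _.
by rewrite normrM ler_piMr// le_wordm1.
Qed.

(** The integral of [p] is a fixed combination of moments of order at most [M], and [mom_diff_le]
    bounds each difference of moments. The choice of [M] and [d] precedes the measures. *)
Lemma qform_fpoly p (e : R) : fpoly p -> 0 < e -> exists M, exists2 d, 0 < d &
  forall P Q : {measure set R[i] -> \bar R}, P setT = 1%E -> Q setT = 1%E ->
  qform P Q M <= d -> `|\int[P]_z p z - \int[Q]_z p z| <= e.
Proof.
move=> [l hl] e0.
pose A : R := \sum_(x <- l) `|x.1| + 1.
have A0 : 0 < A by rewrite ltr_wpDl// sumr_ge0.
pose M := (\max_(x <- l) size x.2)%N.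
pose d : R := (e / A) ^+ 2 / (2 * M.+1%:R).
have eA : 0 < e / A by rewrite divr_gt0.
have M0 : 0 < 2 * M.+1%:R :> R by rewrite mulr_gt0// ltr0Sn.
exists M, d; first by rewrite divr_gt0// exprn_gt0.
move=> P Q P1 Q1 hq.
have hw (s : seq 'I_4) : (size s <= M)%N ->
    `|\int[P]_z wordm s z - \int[Q]_z wordm s z| <= e / A.
  move=> sM; have -> : wordm s = mono [ffun j : 'I_(size s) => nth ord0 s j].
    by apply/funext => z; exact: wordm_mono.
  rewrite -/(mom P _) -/(mom Q _).
  move: [ffun j => _] sM; case: (size s) => [v _|k v kM].
    (* The empty word does not occur in [qform], whose words have length at least 1; its moment is 1
       for every probability. *)
    have h (T : {measure set R[i] -> \bar R}) : T setT = 1%E -> mom T v = 1.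
      move=> T1; rewrite /mom; under eq_Rintegral do rewrite /mono big_ord0.
      exact: RintegralM1.
    by rewrite !h// subrr normr0 ltW.
  rewrite -ler_sqr ?nnegrE// ?(ltW eA)// real_normK ?num_real//.
  apply: le_trans (mom_diff_le P Q v kM) _.
  apply: le_trans (_ : 2 * k.+1%:R * d <= _); first by rewrite ler_pM2l// mulr_gt0.
  rewrite /d mulrA ler_pdivrMr ?mulr_gt0// mulrC ler_pM2l ?exprn_gt0//.
  by rewrite ler_pM2l// ler_nat ltnW.
have hint (T : {measure set R[i] -> \bar R}) : T setT = 1%E ->
    \int[T]_z p z = \sum_(x <- l) x.1 * \int[T]_z wordm x.2 z.
  move=> T1; under eq_Rintegral do rewrite hl.
  have iw s : T.-integrable setT (EFin \o wordm s).
    apply: (bounded_integrable T1 (M := 1)); last exact: le_wordm1.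
    by apply: continuous_measurableC; exact: continuous_wordm.
  rewrite (Rintegral_sum T1); last first.
    move=> x; apply: (bounded_integrable T1 (M := `|x.1|)).
      apply: continuous_measurableC; apply: ctsM; first exact: cst_continuous.
      exact: continuous_wordm.
    by move=> z; rewrite normrM ler_piMr// le_wordm1.
  by apply: eq_bigr => x _; rewrite RintegralZl.
rewrite !hint// -sumrB.
apply: le_trans (ler_norm_sum _ _ _) _.
apply: (@le_trans _ _ (\sum_(x <- l) `|x.1| * (e / A))).
  rewrite big_seq_cond [leRHS]big_seq_cond; apply: ler_sum => x /andP[xl _].
  by rewrite -mulrBr normrM ler_wpM2l// hw//; exact: (leq_bigmax_seq _ xl).
rewrite -mulr_suml mulrCA ger_pMr// ler_pdivrMr// mul1r /A.
by rewrite lerDl.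
Qed.

End feature_polynomials.

Lemma sqr_le_sum (R : realType) (x a b : R) : 0 <= x -> x <= a + b ->
  x ^+ 2 <= 2 * a ^+ 2 + 2 * b ^+ 2.
Proof.
move=> x0 xab; have : x ^+ 2 <= (a + b) ^+ 2 by rewrite lerXn2r ?nnegrE// (le_trans x0).
move=> /le_trans; apply; rewrite -subr_ge0.
by rewrite (_ : _ - _ = (a - b) ^+ 2) ?sqr_ge0//; ring.
Qed.

Section density.
Context {R : realType}.
Implicit Types (z w : R[i]) (phi : R[i] -> R).

Lemma compact_support_normc phi : compact (closure [set z | phi z != 0]) ->
  exists2 r, 0 < r & forall z, r < normc z -> phi z = 0.
Proof.
move=> /compact_bounded_normc[r r0 hr]; exists r => // z rz.
apply: contrapT => /eqP pz; have := hr z (@subset_closure _ [set z | phi z != 0] z pz).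
by rewrite leNgt rz.
Qed.

Lemma compact_support_bounded phi : continuous phi ->
  compact (closure [set z | phi z != 0]) -> exists2 M, 0 < M & forall z, `|phi z| <= M.
Proof.
move=> cphi /compact_support_normc[r r0 hr].
have [|p _ pmax] := EVT_maxC (K := [set z | normc z <= r]) _ (@compact_normc_le R r)
  (fun z => cvg_norm (cphi z)).
  by exists 0; rewrite /mkset Normc.normc0 ltW.
exists (`|phi p| + 1); first by rewrite ltr_wpDl.
move=> z; have [zr|/hr ->] := leP (normc z) r.
  by apply: le_trans (pmax z zr) _; rewrite lerDl.
by rewrite normr0 addr_ge0.
Qed.

Lemma uniform_continuity phi (r e : R) : continuous phi -> 0 < e ->
  exists2 d, 0 < d & forall z w, normc z <= r -> normc (w - z) < d -> `|phi w - phi z| < e.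
Proof.
move=> cphi e0.
have : \forall n \near \oo, forall z, normc z <= r ->
    forall w, normc (w - z) < n.+1%:R^-1 -> `|phi w - phi z| < e.
  have /compact_near_coveringP := @compact_normc_le R r; apply => z _.
  have e2 : 0 < e / 2 by rewrite divr_gt0.
  have /continuous_normcP/(_ _ e2)[d d0 hd] := cphi z.
  have d2 : 0 < d / 2 by rewrite divr_gt0.
  have [N _ hN] : \forall n \near \oo, n.+1%:R^-1 < d / 2 :> R.
    by have /cvgrPdist_lt/(_ _ d2) := @cvg_harmonic R; apply: filterS => n;
       rewrite sub0r normrN; apply: le_lt_trans; exact: ler_norm.
  exists ([set z' | normc (z' - z) < d / 2], [set n | (N <= n)%N]) => /=.
    by split; [apply/nbhs_normcP; exists (d / 2)|exists N].
  move=> [z' n] /= [z'z Nn] w wz'.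
  have h1 : `|phi z' - phi z| < e / 2 by apply: hd; lra.
  have h2 : `|phi w - phi z| < e / 2.
    apply: hd; rewrite -(subrKA z').
    apply: le_lt_trans (normcD _ _) _.
    have := lt_trans wz' (hN n Nn); lra.
  rewrite -(subrKA (phi z)); apply: le_lt_trans (ler_normD _ _) _.
  rewrite (distrC (phi z)); lra.
move=> [N _ /(_ N (leqnn _)) h]; exists N.+1%:R^-1; first by rewrite invr_gt0.
by move=> z w zr; exact: h.
Qed.

(** The chordal distance controls the distance in the plane only while one of the points stays
    bounded; if both are outside the support, both values vanish. *)
Lemma chordal_continuity phi (e : R) : continuous phi ->
  compact (closure [set z | phi z != 0]) -> 0 < e ->
  exists2 t, 0 < t < 1 & forall z w, 1 - skern z w <= t -> `|phi w - phi z| <= e.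
Proof.
move=> cphi /compact_support_normc[r r0 hr] e0.
have [d d0 hd] := uniform_continuity r cphi e0.
pose A : R := 1 + r ^+ 2.
have A0 : 1 < A by rewrite ltrDl exprn_gt0.
have B0 : 0 < 1 + 2 * r ^+ 2 by rewrite ltr_wpDr// mulr_ge0 ?sqr_ge0.
(* In [|z - w|^2 <= t * A * (1 + 2 * r^2 + 2 * |z - w|^2)] the first bound on [t] lets half of the
   left side absorb the last term, and the second makes the rest at most [d^2 / 4]. *)
pose t := Num.min (1 / (4 * A)) (d ^+ 2 / (4 * (A * (1 + 2 * r ^+ 2)))).
have t0 : 0 < t.
  by rewrite lt_min !divr_gt0 ?exprn_gt0 ?mulr_gt0// (lt_trans ltr01).
have A4 : 0 < 4 * A by lra.
have tA : t * A <= 1 / 4.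
  have : t <= 1 / (4 * A) by rewrite ge_min lexx.
  by rewrite ler_pdivlMr//; lra.
have tB : t * A * (1 + 2 * r ^+ 2) <= d ^+ 2 / 4.
  have AB0 : 0 < 4 * (A * (1 + 2 * r ^+ 2)) by rewrite !mulr_gt0// (lt_trans ltr01).
  have : t <= d ^+ 2 / (4 * (A * (1 + 2 * r ^+ 2))) by rewrite ge_min lexx orbT.
  by rewrite ler_pdivlMr//; lra.
have t1 : t < 1.
  have : t * 1 < 1; last by rewrite mulr1.
  by apply: le_lt_trans (_ : t * A < 1); [rewrite ler_pM2l// ltW|lra].
exists t; first by rewrite t0.
have near0 z w : normc z <= r -> 1 - skern z w <= t -> `|phi w - phi z| <= e.
  move=> zr; rewrite skernE ler_pdivrMr ?mulr_gt0 ?den_gt0// => hzw.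
  apply/ltW/hd => //; rewrite normcC.
  have z2 : 1 + normc z ^+ 2 <= A by rewrite lerD2l lerXn2r ?nnegrE ?normc_ge0// ltW.
  have w2 : normc w ^+ 2 <= 2 * r ^+ 2 + 2 * normc (z - w) ^+ 2.
    apply: sqr_le_sum; first exact: normc_ge0.
    rewrite -{1}(subrK z w) addrC; apply: le_trans (normcD _ _) _.
    by rewrite normcC lerD2r.
  have : normc (z - w) ^+ 2 <= t * A * (1 + 2 * r ^+ 2 + 2 * normc (z - w) ^+ 2).
    apply: le_trans hzw _; rewrite mulrA ler_pM ?mulr_ge0 ?(ltW t0)// ?(ltW (den_gt0 _))//.
      by rewrite ler_pM2l.
    by rewrite -addrA lerD2l.
  move=> h.
  have s0 := sqr_ge0 (normc (z - w)).
  have : normc (z - w) ^+ 2 <= d ^+ 2 / 2 by nra.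
  move=> h'; rewrite -ltr_sqr ?nnegrE ?normc_ge0 ?(ltW d0)//.
  apply: le_lt_trans h' _; rewrite ltr_pdivrMr// ltr_pMr ?exprn_gt0//; lra.
move=> z w hzw; have [zr|rz] := leP (normc z) r; first exact: near0.
have [wr|rw] := leP (normc w) r; first by rewrite distrC near0// skernC.
by rewrite !hr// subrr normr0 ltW.
Qed.

(** Total boundedness of the sphere: a disk is compact, and all points outside a large one are
    chordally close to each other, so a single real point serves them. *)
Lemma chordal_net (t : R) : 0 < t -> exists ws : seq R[i],
  forall z, exists2 w, w \in ws & 1 - skern z w < t.
Proof.
move=> t0.
(* For [|z| > rho], [|z - rho|^2 <= 4 * |z|^2 = t * rho^2 * |z|^2], which is below [t] times the
   denominator in [skernE]. *)
pose rho := Num.sqrt (4 / t).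
have rho2 : rho ^+ 2 = 4 / t by rewrite sqr_sqrtr// divr_ge0// ltW.
have rho0 : 0 <= rho by exact: sqrtr_ge0.
have := @compact_normc_le R rho; rewrite compact_cover.
move=> /(_ R[i] [set z | normc z <= rho] (fun w => [set z | 1 - skern z w < t])).
case.
- move=> w _.
  rewrite (_ : [set _ | _] = (fun z => 1 - skern w z) @^-1` [set x | x < t]); last first.
    by apply/seteqP; split => z /=; rewrite skernC.
  apply: open_comp; last exact: open_lt.
  move=> z _; apply: ctsB; [exact: cst_continuous|exact: continuous_skern].
- by move=> z zr; exists z => //=; rewrite skernzz subrr.
move=> D' _ hD'.
exists (rho%:C :: finmap.enum_fset D') => z.
have [zr|rz] := leP (normc z) rho.
  have [w wD hw] := hD' z zr.
  by exists w => //; rewrite inE; apply/orP; right.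
exists rho%:C; first by rewrite inE eqxx.
rewrite skernE normc_real ger0_norm// ltr_pdivrMr ?mulr_gt0 ?ltr_pwDl ?sqr_ge0//.
have h1 : normc (z - rho%:C) ^+ 2 <= 2 * normc z ^+ 2 + 2 * rho ^+ 2.
  apply: sqr_le_sum; first exact: normc_ge0.
  by apply: le_trans (normcD _ _) _; rewrite normcN normc_real ger0_norm.
have h2 : rho ^+ 2 < normc z ^+ 2 by rewrite ltrXn2r ?nnegrE ?normc_ge0.
have h3 : t * rho ^+ 2 = 4 by rewrite rho2 mulrCA mulfV ?mulr1// gt_eqF.
have r20 := sqr_ge0 rho.
nra.
Qed.

Lemma expr_small (x c e : R) : 0 <= x -> x < 1 -> 0 < e -> exists n, c * x ^+ n <= e.
Proof.
move=> x0 x1 e0.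
have : c * x ^+ n @[n --> \oo] --> 0.
  by rewrite -[X in _ --> X](mulr0 c); apply: cvgMl_tmp; apply: cvg_expr; rewrite ger0_norm.
move=> /cvgrPdist_lt/(_ _ e0)[n _ /(_ n (leqnn _))]; rewrite sub0r normrN => h.
by exists n; apply: ltW; apply: le_lt_trans h; exact: ler_norm.
Qed.

(* Stone-Weierstrass by hand: [S] below is a positive feature polynomial for
   which [p0 / S] is close to [phi], and [1 / S] is a geometric series. *)
Lemma fpoly_dense phi (e : R) : continuous phi ->
  compact (closure [set z | phi z != 0]) -> 0 < e ->
  exists2 p, fpoly p & forall z, `|phi z - p z| <= e.
Proof.
move=> cphi sphi e0.
have e3 : 0 < e / 3 by rewrite divr_gt0.
have [M M0 hM] := compact_support_bounded cphi sphi.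
have [t /andP[t0 t1] ht] := chordal_continuity cphi sphi e3.
have t2 : 0 < t / 2 by rewrite divr_gt0.
have [ws hws] := chordal_net t2.
have ws0 : (0 < size ws)%N by case: ws hws => // /(_ 0)[].
pose m : R := (size ws)%:R.
have m0 : 0 < m by rewrite ltr0n.
(* Centers [w] farther than [t] from [z] contribute at most [(1 - t) ^+ N] each, while the net point
   near [z] alone gives [S z >= (1 - t / 2) ^+ N]; [rho ^+ N] is the ratio. *)
pose rho := (1 - t) / (1 - t / 2).
have [rho0 rho1] : 0 <= rho /\ rho < 1.
  by rewrite divr_ge0 ?ltr_pdivrMr; lra.
have [N hN] := @expr_small rho (2 * M * m) _ rho0 rho1 e3.
pose S z := \sum_(w <- ws) skern w z ^+ N.
pose p0 z := \sum_(w <- ws) phi w * skern w z ^+ N.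
have fS : fpoly S by apply: fpoly_sum => w; apply: fpolyX; exact: fpoly_skern.
have fp0 : fpoly p0.
  apply: fpoly_sum => w; apply: fpolyM; first exact: fpoly_cst.
  by apply: fpolyX; exact: fpoly_skern.
have kN0 w z : 0 <= skern w z ^+ N by rewrite exprn_ge0// skern_ge0.
have s00 : 0 < (1 - t / 2) ^+ N by rewrite exprn_gt0//; lra.
have Sge z : (1 - t / 2) ^+ N <= S z.
  have [w wws hw] := hws z.
  rewrite /S (big_rem w)//= -[leLHS]addr0 lerD ?sumr_ge0//.
  rewrite lerXn2r ?nnegrE ?skern_ge0//; first by lra.
  by rewrite skernC; lra.
have Sle z : S z <= m.
  have -> : m = \sum_(w <- ws) 1 by rewrite big_const_seq count_predT iter_addr addr0.
  by apply: ler_sum => w _; rewrite exprn_ile1 ?skern_ge0 ?skern_le1.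
have close z : `|phi z * S z - p0 z| <= e / 3 * 2 * S z.
  rewrite /S /p0 mulr_sumr -sumrB.
  apply: le_trans (ler_norm_sum _ _ _) _.
  apply: (@le_trans _ _ (\sum_(w <- ws) (e / 3 * skern w z ^+ N + 2 * M * (1 - t) ^+ N))).
    apply: ler_sum => w _; rewrite -mulrBl normrM (ger0_norm (kN0 w z)).
    have T0 : 0 <= (1 - t) ^+ N by rewrite exprn_ge0//; lra.
    have [hw|hw] := leP (1 - skern w z) t.
      rewrite -[leLHS]addr0 lerD//; first by rewrite ler_wpM2r// ht.
      by rewrite !mulr_ge0// ltW.
    rewrite -[leLHS]add0r; apply: lerD; first by rewrite mulr_ge0// ltW.
    apply: ler_pM => //.
      apply: le_trans (ler_normB _ _) _.
      have := hM z; have := hM w; lra.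
    by rewrite lerXn2r ?nnegrE ?skern_ge0//; lra.
  rewrite big_split/= -mulr_sumr -/(S z) big_const_seq count_predT iter_addr addr0 -[_ *+ size
    ws]mulr_natr -/m.
  suff : 2 * M * m * (1 - t) ^+ N <= e / 3 * S z.
    by rewrite (_ : 2 * M * (1 - t) ^+ N * m = 2 * M * m * (1 - t) ^+ N); [lra|ring].
  have -> : 2 * M * m * (1 - t) ^+ N = 2 * M * m * rho ^+ N * (1 - t / 2) ^+ N.
    by rewrite /rho expr_div_n -!mulrA mulVf ?mulr1// gt_eqF.
  apply: ler_pM => //; last exact: ltW.
  by rewrite !mulr_ge0 ?exprn_ge0// ltW.
(* A bound below 1 for [1 - S z / m], uniform in [z]: the ratio of the geometric series for
   [1 / S]. *)
pose y := 1 - (1 - t / 2) ^+ N / m.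
have [y0 y1] : 0 <= y /\ y < 1.
  split; last by rewrite ltrBlDr ltrDl divr_gt0.
  by rewrite subr_ge0 ler_pdivrMr// mul1r (le_trans (Sge 0)).
have [J hJ] := @expr_small y M _ y0 y1 e3.
pose G z := \sum_(j < J) m^-1 * (1 - S z / m) ^+ j.
have fG : fpoly G.
  apply: fpoly_sum => j; apply: fpolyM; first exact: fpoly_cst.
  apply: fpolyX; rewrite (_ : (fun z => _) = fun z => 1 + (- m^-1) * S z); last first.
    by apply/funext => z; rewrite mulNr mulrC.
  apply: fpolyD; first exact: fpoly_cst.
  by apply: fpolyM => //; exact: fpoly_cst.
have SG z : S z * G z = 1 - (1 - S z / m) ^+ J.
  rewrite /G -mulr_sumr mulrA; set u := 1 - S z / m.
  have -> : S z / m = - (u - 1) by rewrite /u opprB subKr.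
  by rewrite mulNr -subrX1 opprB.
exists (fun z => p0 z * G z); first exact: fpolyM.
move=> z.
have u0 : 0 <= 1 - S z / m by rewrite subr_ge0 ler_pdivrMr// mul1r.
have uy : 1 - S z / m <= y by rewrite lerD2l lerN2 ler_pM2r ?invr_gt0.
have G0 : 0 <= G z by apply: sumr_ge0 => j _; rewrite mulr_ge0 ?invr_ge0 ?exprn_ge0// ltW.
have uJ : 0 <= (1 - S z / m) ^+ J by rewrite exprn_ge0.
have -> : phi z - p0 z * G z = phi z * (1 - S z / m) ^+ J + (phi z * S z - p0 z) * G z.
  have -> : (1 - S z / m) ^+ J = 1 - S z * G z by rewrite SG subKr.
  by ring.
apply: le_trans (ler_normD _ _) _; rewrite !normrM (ger0_norm G0) (ger0_norm uJ).
have h1 : `|phi z| * (1 - S z / m) ^+ J <= e / 3.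
  apply: le_trans hJ; rewrite ler_pM//.
  by rewrite lerXn2r ?nnegrE.
have h2 : `|phi z * S z - p0 z| * G z <= e / 3 * 2.
  apply: (@le_trans _ _ (e / 3 * 2 * S z * G z)); first by rewrite ler_wpM2r.
  by rewrite -mulrA SG ger_pMr ?mulr_gt0// lerBlDr lerDl.
lra.
Qed.

(** [M] and [d] depend on [phi] and [e] only, so the estimate applies alike to the measures
    [tau (Z n)] and to near-minimizers of the energy. *)
Lemma weak_close phi (e : R) : continuous phi ->
  compact (closure [set z | phi z != 0]) -> 0 < e -> exists M, exists2 d, 0 < d &
  forall P Q : {measure set R[i] -> \bar R}, P setT = 1%E -> Q setT = 1%E ->
  qform P Q M <= d -> `|\int[P]_z phi z - \int[Q]_z phi z| <= e.
Proof.
move=> cphi sphi e0.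
have e3 : 0 < e / 3 by rewrite divr_gt0.
have [p fp hp] := fpoly_dense cphi sphi e3.
have [M [d d0 hd]] := qform_fpoly fp e3.
have [B _ hB] := compact_support_bounded cphi sphi.
have [B' hB'] := fpoly_bounded fp.
have cp := continuous_fpoly fp.
exists M, d => // P Q P1 Q1 /(hd P Q P1 Q1) h.
have close (T : {measure set R[i] -> \bar R}) : T setT = 1%E ->
    `|\int[T]_z phi z - \int[T]_z p z| <= e / 3.
  move=> T1.
  have i1 := bounded_integrable T1 (continuous_measurableC cphi) hB.
  have i2 := bounded_integrable T1 (continuous_measurableC cp) hB'.
  rewrite -RintegralB//.
  apply: le_trans (le_normr_Rintegral measurableT _) _.
    exact: (bounded_integrable T1 (continuous_measurableC (ctsB cphi cp)) hp).
  rewrite -[leRHS](RintegralM1 T1); apply: le_Rintegral => //.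
  - apply: (bounded_integrable T1 (f := fun z => `|phi z - p z|) (M := e / 3)).
      by apply: measurableT_comp => //; exact: (continuous_measurableC (ctsB cphi cp)).
    by move=> z; rewrite normr_id.
  - by apply: (bounded_integrable T1 (f := fun=> e / 3) (M := `|e / 3|)).
have := close P P1; have := close Q Q1.
move: h; rewrite !ler_norml => /andP[a1 a2] /andP[b1 b2] /andP[c1 c2].
by apply/andP; split; lra.
Qed.

End density.

(** * Existence of the equilibrium measure *)

Section energy_estimates.
Context {R : realType}.
Implicit Types (P Q : probability R[i] R) (K E : set R[i]).

Lemma cmean_ge (P : {measure set R[i] -> \bar R}) K c : P setT = 1%E -> compact K ->
  P (~` K) = 0%E -> c <= 0 -> (forall z, K z -> c <= cweight z) -> c <= cmean P.
Proof.
move=> P1 cK PK c0 hc.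
have mK : measurable K by apply: closed_measurableC; exact: compact_closedC.
have icw := integrable_cweight P1 cK PK.
rewrite -lerN2 -RintegralN// -lee_fin.
rewrite -integral_EFin; last first.
  exact: (integrable_cts P1 cK PK (ctsN (@continuous_cweight R))).
apply: (@le_trans _ _ (\int[P]_z (- c)%:E)%E).
  apply: ae_ge0_le_integral => //.
  - by move=> z _; rewrite lee_fin oppr_ge0 cweight_le0.
  - apply/measurable_EFinP; apply: continuous_measurableC.
    exact: ctsN (@continuous_cweight R).
  - by move=> z _; rewrite lee_fin oppr_ge0.
  - exists (~` K); split => //; first exact: measurableC.
    by move=> z /= hz Kz; apply: hz => _; rewrite lee_fin lerN2 hc.
by rewrite integral_cst// P1 mule1.
Qed.

Lemma mutual_le_energy P K (V : R) N : compact K -> P (~` K) = 0%E ->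
  energy P = V%:E -> mutual P P N <= V - 2 * cmean P.
Proof.
move=> cK PK; rewrite (energyE (probability_setT P) cK PK) => hV.
have P1 := probability_setT P.
have hb : (\int[P]_z lpot P z = (V - 2 * cmean P)%:E)%E.
  move: hV; case: (integral P setT (lpot P)) => [s||]//.
  by rewrite -EFinD => -[<-]; congr _%:E; ring.
have cb := @continuous_bpot R P P1 N.
rewrite -lee_fin -hb -(integral_bpot N P1 P1).
rewrite -integral_EFin; last exact: (integrable_cts P1 cK PK cb).
apply: ge0_le_integral => //.
- move=> z _; rewrite lee_fin; apply: Rintegral_ge0 => w _.
  by apply: bern_ge0; exact: skern_ge0.
- by apply/measurable_EFinP; exact: continuous_measurableC.
- exact: measurable_lpot.
- by move=> z _; exact: bpot_le_lpot.
Qed.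

(* [P - Q] has energy [W - V] when the potential of [Q] equals [V] on the
   carrier of [P]. *)
Lemma qform_le_energy P Q K L (V W e : R) N :
  compact K -> P (~` K) = 0%E -> compact L -> Q (~` L) = 0%E ->
  energy P = W%:E -> energy Q = V%:E ->
  (forall z, K z -> (V%:E <= potential Q z)%E) ->
  (forall z, (lpot Q z <= (bpot Q N z + e)%:E)%E) ->
  qform P Q N <= W - V + 2 * e.
Proof.
move=> cK PK cL QL hW hV hVQ hN.
have P1 := probability_setT P; have Q1 := probability_setT Q.
have hP := mutual_le_energy N cK PK hW.
have hQ := mutual_le_energy N cL QL hV.
rewrite qformE.
suff : V - cmean P - cmean Q - e <= mutual P Q N by lra.
have mK : measurable K by apply: closed_measurableC; exact: compact_closedC.
have cb := @continuous_bpot R Q Q1 N.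
have icw := integrable_cweight P1 cK PK.
rewrite -(integral_bpot N P1 Q1).
pose g z := V - cmean Q - e - cweight z.
have cg : continuous g.
  by apply: ctsB; [exact: (@cst_continuous _ _ (V - cmean Q - e))|exact: continuous_cweight].
have -> : V - cmean P - cmean Q - e = \int[P]_z g z.
  rewrite RintegralB//; last exact: (integrable_cst1 P1).
  by rewrite (RintegralM1 P1) -/(cmean P); ring.
rewrite -subr_ge0 -RintegralB//; [|exact: (integrable_cts P1 cK PK cb)|exact: (integrable_cts P1
  cK PK cg)].
have cbg := ctsB cb cg.
(* The integrand is known to be nonnegative on [K], hence only almost everywhere. *)
have -> : \int[P]_z (bpot Q N z - g z) = \int[P]_z `|bpot Q N z - g z|; last exact: Rintegral_ge0.
rewrite /Rintegral; congr fine; apply: ae_eq_integral => //.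
- by apply/measurable_EFinP; exact: continuous_measurableC.
- apply/measurable_EFinP; apply: measurableT_comp => //; exact: continuous_measurableC.
- exists (~` K); split => //; first exact: measurableC.
  move=> z /= hz Kz; apply: hz => _; rewrite ger0_norm//.
  have := hVQ z Kz; rewrite (potentialE Q1 cL QL); have := hN z; have := lpot_ge0 Q z.
  case: (lpot Q z) => [s||]// _; rewrite -EFinD !lee_fin /g; lra.
Qed.

End energy_estimates.

Section distance_to_set.
Context {R : realType} (E : set R[i]).
Hypothesis (E0 : E !=set0).

Definition dist_set (z : R[i]) : R := inf [set normc (z - w) | w in E].

Let hasinf z : has_inf [set normc (z - w) | w in E].
Proof.
case: E0 => w Ew; split; first by exists (normc (z - w)), w.
by exists 0 => _ [u _ <-]; exact: normc_ge0.
Qed.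

Lemma dist_set_ge0 z : 0 <= dist_set z.
Proof. by apply: lb_le_inf; [case: (hasinf z)|move=> _ [u _ <-]; exact: normc_ge0]. Qed.

Lemma dist_set_eq0 z : E z -> dist_set z = 0.
Proof.
move=> Ez; apply/eqP; rewrite eq_le dist_set_ge0 andbT.
apply: inf_lbound; first by case: (hasinf z).
by exists z => //; rewrite subrr Normc.normc0.
Qed.

Lemma dist_set_gt0 z : closed E -> ~ E z -> 0 < dist_set z.
Proof.
move=> cE nEz; have /nbhs_normcP[e e0 he] : nbhs z (~` E).
  by apply: open_nbhs_nbhs; split => //; exact: closed_openC.
apply: lt_le_trans e0 _; apply: lb_le_inf; first by case: (hasinf z).
move=> _ [u Eu <-]; rewrite leNgt; apply/negP => h; apply: (he u) => //.
by rewrite normcC.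
Qed.

Lemma continuous_dist_set : continuous dist_set.
Proof.
have lip z w : dist_set z <= dist_set w + normc (z - w).
  rewrite -lerBlDr; apply: lb_le_inf; first by case: (hasinf w).
  move=> _ [u Eu <-]; rewrite lerBlDr.
  apply: (@le_trans _ _ (normc (z - u))).
    by apply: inf_lbound; [case: (hasinf z)|exists u].
  by rewrite [leRHS]addrC (_ : z - u = (z - w) + (w - u)) ?normcD//; ring.
move=> z; apply/continuous_normcP => e e0; exists e => // w wz.
rewrite ltr_norml; have := lip w z; have := lip z w; rewrite (normcC z w); lra.
Qed.

End distance_to_set.

Section circle_potential.
Context {R : realType}.
Implicit Types (p z : R[i]) (r : R).

Lemma potential_circ p r z : 0 < r ->
  potential (circ p r) z = (- ln (Num.max (normc (z - p)) r))%:E.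
Proof.
move=> r0.
rewrite (potentialE (circ1 p r) (@compact_sphere R p r) (circ_sphere p (ltW r0))).
have := @cweight_lpot_circ R p r z r0.
by case: (lpot (circ p r) z) => [s|//|//]; rewrite -!EFinD => -[h]; congr _%:E; lra.
Qed.

Lemma potential_circ_disk p r z : 0 < r -> normc (z - p) <= r ->
  potential (circ p r) z = (- ln r)%:E.
Proof. by move=> r0 zr; rewrite potential_circ// max_r. Qed.

Lemma energy_circ p r : 0 < r -> energy (circ p r) = (- ln r)%:E.
Proof.
move=> r0.
transitivity (\int[circ p r]_z (- ln r)%:E)%E; last first.
  by rewrite integral_cst// [X in (_ * X)%E]circ1 mule1.
apply: ae_eq_integral => //.
- rewrite (_ : (fun z => _) = fun z => ((cweight z + cmean (circ p r))%:E + lpot (circ p r) z)%E).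
    apply: emeasurable_funD; last by apply: measurable_lpot; exact: circ1.
    apply/measurable_EFinP; apply: continuous_measurableC.
    by apply: ctsD; [exact: continuous_cweight|exact: cst_continuous].
  apply/funext => z.
  exact: (potentialE (circ1 p r) (@compact_sphere R p r) (circ_sphere p (ltW r0))).
- exists (~` sphere p r); split.
  + by apply: measurableC; apply: closed_measurableC; apply: compact_closedC; exact: compact_sphere.
  + by apply: circ_sphere; exact: ltW.
  + move=> z /= hz zr; apply: hz => _.
    by apply: potential_circ_disk => //; rewrite zr.
Qed.

Lemma lpot_circ_uniform p r (e : R) : 0 < r -> 0 < e ->
  exists N, forall z, (lpot (circ p r) z <= (bpot (circ p r) N z + e)%:E)%E.
Proof.
move=> r0 e0.
pose g z := - ln r - cmean (circ p r) - cweight z.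
have cg : continuous g.
  by apply: ctsB; [exact: (@cst_continuous _ _ (- ln r - cmean (circ p r)))|exact:
    continuous_cweight].
apply: (@lpot_uniform R (circ p r) (sphere p r) (circ1 p r) (@compact_sphere R p r) (circ_sphere
  p (ltW r0)) g cg _ e e0).
move=> z zr; have := @cweight_lpot_circ R p r z r0.
rewrite zr maxxx; case: (lpot (circ p r) z) => [s|//|//].
by rewrite -EFinD => -[h]; congr _%:E; rewrite /g -h; ring.
Qed.

End circle_potential.

(** * Attainment of the Robin constant *)

Section minimizer.
Context {R : realType} (E : set R[i]).
Hypotheses (cE : compact E) (rE : regular E).
Local Notation D := (finite_outer_domain E).

(** Positive capacity excludes [+oo]; [-oo] is excluded because [lkern] is nonnegative and the
    weight is bounded below on the compact [E]. *)
Lemma robin_fin : exists V : R, robin E = V%:E.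
Proof.
case: rE => cap0 _.
suff : robin E \is a fin_num by move=> h; exists (fine (robin E)); rewrite fineK.
have [r r0 hr] := compact_bounded_normc cE.
pose c : R := - 2^-1 * ln (1 + r ^+ 2).
have c0 : c <= 0.
  by rewrite /c mulNr oppr_le0 mulr_ge0 ?invr_ge0// ln_ge0// lerDl sqr_ge0.
have hc z : E z -> c <= cweight z.
  move=> /hr zr; rewrite /c /cweight !mulNr lerN2 ler_pM2l ?invr_gt0//.
  rewrite ler_ln ?posrE ?den_gt0 ?ltr_pwDl ?sqr_ge0// lerD2l.
  by rewrite lerXn2r ?nnegrE ?normc_ge0// ltW.
have lb : ((2 * c)%:E <= robin E)%E.
  apply: le_ereal_inf_tmp => _ [mu /= muE <-].
  rewrite (energyE (probability_setT mu) cE muE).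
  apply: (@le_trans _ _ (2 * cmean mu)%:E).
    by rewrite lee_fin ler_pM2l// (cmean_ge (probability_setT mu) cE muE).
  by rewrite leeDl// integral_ge0// => z _; exact: lpot_ge0.
move: cap0; rewrite /capacity; case: (robin E) lb => //=.
by rewrite ltxx.
Qed.

Lemma outer_boundaryP w : closure D w -> ~ D w -> outer_boundary E w.
Proof. by move=> cw Dw; split=> // /interior_subset. Qed.

Lemma potential_dirac0 z : potential (\d_(0 : R[i])) z = log_kernel z 0.
Proof.
rewrite /potential integral_dirac//; first by rewrite diracE in_setT mul1e.
rewrite (_ : log_kernel z = fun w => ((cweight z + cweight w)%:E + lkern z w)%E).
  apply: emeasurable_funD; last exact: measurable_lkern1.
  apply/measurable_EFinP; apply: continuous_measurableC.
  by apply: ctsD; [exact: cst_continuous|exact: continuous_cweight].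
by apply/funext => w; exact: log_kernelE.
Qed.

(* If the infimum were not attained, [equilibrium E] would be the Dirac mass at
   the origin, whose potential is radial.  Regularity then puts the outer
   boundary on a circle whose radius is the capacity; the uniform measure of
   that circle has energy [robin E], and a minimizing sequence tends to it. *)
Lemma minimizer_exists :
  exists mu, supported_probabilities E mu /\ energy mu = robin E.
Proof.
apply: contrapT => nmin.
have eqd : equilibrium E = \d_(0 : R[i]).
  by rewrite /equilibrium xgetPN// => mu hmu; apply: nmin; exists mu.
have [V hV] := robin_fin.
pose r := expR (- V).
have r0 : 0 < r by exact: expR_gt0.
have cD := compact_outer_compl cE.
(* For the Dirac mass the Green function reads [V + ln |z|]; its limit 0 at [w] forces
   [|w| = expR (- V)]. *)
have bdr w : closure D w -> ~ D w -> normc w = r.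
  move=> clw Dw; apply/eqP; apply: contrapT => /negP wr.
  pose eta := `|normc w - r|.
  have eta2 : 0 < eta / 2 by rewrite divr_gt0// normr_gt0 subr_eq0.
  have /cvgrPdist_lt/(_ _ eta2)/nbhs_ballP[e /= e0 he] := @continuous_expR R (- V).
  have reg := rE.2 w (outer_boundaryP clw Dw).
  rewrite /green hV eqd in reg.
  have [d d0 hd] := regular_near reg e0.
  have [|z [Dz]] := clw [set z | normc (z - w) < Num.min d (eta / 2)].
    by apply/nbhs_normcP; exists (Num.min d (eta / 2)); rewrite // lt_min d0 eta2.
  rewrite /mkset lt_min => /andP[zd zeta].
  have := hd z Dz zd; rewrite potential_dirac0 => -[fz hz].
  have z0 : z != 0 by apply/eqP => z0; move: fz; rewrite z0 log_kernelzz.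
  rewrite log_kernel_neq// subr0 /= in hz.
  have : ball (- V) e (ln (normc z)) by rewrite /ball/= -normrN opprD !opprK; move: hz;
    rewrite opprK.
  move=> /he; rewrite lnK ?posrE ?normc_gt0// -/r => hzr.
  have := normc_ge_dist z w.
  have : eta <= `|normc z - normc w| + `|r - normc z|.
    rewrite /eta -(subrKA (normc z)) (distrC (normc z)) (distrC r).
    by apply: ler_normD.
  lra.
(* Otherwise a point of greatest modulus in the complement of [D] would be a boundary point of
   modulus larger than [r]. *)
have far z : r < normc z -> D z.
  move=> rz; apply: contrapT => Dz.
  have [p Dp pmax] := EVT_maxC (ex_intro _ z Dz) cD (@continuous_normc R).
  have rp : r < normc p by exact: lt_le_trans rz (pmax z Dz).
  have p0 : 0 < normc p by exact: lt_trans rp.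
  suff /bdr/(_ Dp) h : closure D p by rewrite h ltxx in rp.
  move=> B /nbhs_normcP[e e0 eB].
  pose t := e / (2 * normc p).
  have t0 : 0 < t by rewrite divr_gt0// mulr_gt0.
  exists ((1 + t)%:C * p); split.
    apply: contrapT => /pmax; rewrite Normc.normcM normc_real gtr0_norm ?addr_gt0//.
    by rewrite leNgt ltr_pMl// ltrDl t0.
  apply: eB; rewrite (_ : _ - p = t%:C * p); last by rewrite rmorphD rmorph1; ring.
  rewrite Normc.normcM normc_real gtr0_norm// /t invfM mulrA mulfVK ?gt_eqF//.
  by rewrite ltr_pdivrMr// ltr_pMr// ltr1n.
have Er z : E z -> normc (z - 0) <= r.
  move=> Ez; rewrite subr0 leNgt; apply/negP => /far Dz.
  exact: (finite_outer_domain_sub Dz).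
have lnr : - ln r = V by rewrite /r expRK opprK.
have enl : energy (circ 0 r) = V%:E by rewrite energy_circ// lnr.
have clE := compact_closedC cE.
have mE := closed_measurableC clE.
apply: nmin; exists (circ 0 r); split; last by rewrite enl hV.
rewrite /supported_probabilities/=.
have E0 : E !=set0.
  apply/set0P/negP => /eqP E0; move: hV; rewrite /robin.
  rewrite (_ : [set energy mu | mu in supported_probabilities E] = set0) ?ereal_inf0//.
  apply/seteqP; split=> // _ [mu /= muE _].
  by have [z] := concentrated_nonempty (probability_setT mu) muE; rewrite E0.
(* [bump] equals [r] on the circle and makes the support of [phi] compact. So [phi] vanishes on [E],
   is positive on the rest of the circle, and detects whether the circle measure charges the
   complement of [E]. *)
pose bump z := Num.max 0 (2 * r - normc z).
have cb : continuous bump.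
  move=> z; apply: (@continuous_max _ _ (fun=> 0) (fun z => 2 * r - normc z)).
    exact: cst_continuous.
  exact: (ctsB (@cst_continuous _ _ (2 * r)) (@continuous_normc R)).
pose phi z := bump z * dist_set E z.
have cphi : continuous phi by apply: ctsM => //; exact: continuous_dist_set.
have b0 z : 0 <= bump z by rewrite le_max lexx.
have phi0 z : 0 <= phi z by rewrite mulr_ge0// dist_set_ge0.
have sphi : compact (closure [set z | phi z != 0]).
  apply: (@compact_normcP R _ (2 * r)); first exact: closed_closure.
  have sub : [set z | phi z != 0] `<=` [set z | normc (z - 0) <= 2 * r].
    move=> z /=; rewrite subr0 leNgt; apply: contra => rz.
    by rewrite /phi /bump max_l ?mul0r// subr_le0 ltW.
  move=> z /(closureS sub); rewrite -(closure_id _).1; last exact: closed_ballC.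
  by rewrite /= subr0.
pose c := \int[circ 0 r]_z phi z.
have ip (P : {measure set R[i] -> \bar R}) : P setT = 1%E -> P.-integrable setT (EFin \o phi).
  have [B _ hB] := compact_support_bounded cphi sphi.
  by move=> P1; exact: (bounded_integrable P1 (continuous_measurableC cphi) hB).
have c_eq0 : c = 0.
  apply/eqP; rewrite eq_le Rintegral_ge0 ?andbT; last by move=> z _; exact: phi0.
  rewrite leNgt; apply/negP => c0.
  have c2 : 0 < c / 2 by rewrite divr_gt0.
  have [M [d d0 hd]] := weak_close cphi sphi c2.
  (* An energy excess below [d / 2] and twice the truncation error [d / 4] add up to [d] in
     [qform_le_energy]. *)
  have d4 : 0 < d / 4 by rewrite divr_gt0.
  have [N hN] := lpot_circ_uniform 0 r0 d4.
  pose N' := maxn M N.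
  have hN' z : (lpot (circ 0%R r) z <= (bpot (circ 0 r) N' z + d / 4)%:E)%E.
    apply: le_trans (hN z) _; rewrite lee_fin lerD2r.
    by apply: nondecreasing_bpot; [exact: circ1|exact: leq_maxr].
  have : (robin E < (V + d / 2)%:E)%E by rewrite hV lte_fin ltrDl divr_gt0.
  move=> /ereal_inf_lt[_ [nu /= nuE <-] hnu].
  have nu1 := probability_setT nu.
  have [W hW] : exists W : R, energy nu = W%:E.
    have : (V%:E <= energy nu)%E by rewrite -hV; apply: ereal_inf_lbound; exists nu.
    by case: (energy nu) hnu => // W _ _; exists W.
  have := @qform_le_energy R nu (circ 0 r) E (sphere 0 r) V W (d / 4) N' cE nuE
    (@compact_sphere R 0 r) (circ_sphere 0 (ltW r0)) hW enl _ hN'.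
  move=> hq; have {}hq : qform nu (circ 0 r) M <= d.
    apply: le_trans (le_qform _ _ (leq_maxl M N)) _; apply: le_trans (hq _) _.
      by move=> z Ez; rewrite potential_circ_disk ?Er// lnr.
    by move: hnu; rewrite hW lte_fin; lra.
  have := hd nu (circ 0 r) nu1 (circ1 0 r) hq.
  have -> : \int[nu]_z phi z = 0.
    rewrite -[RHS](RintegralM1 nu1 0) /Rintegral; congr fine; apply: ae_eq_integral => //.
    - by apply/measurable_EFinP; exact: continuous_measurableC.
    - exists (~` E); split => //; first exact: measurableC.
      by move=> z /= hz Ez; apply: hz => _; rewrite /phi dist_set_eq0// mulr0.
  rewrite -/c sub0r normrN ger0_norm ?(ltW c0)//; lra.
have l1 := circ1 0 r.
have mphi : measurable_fun setT (EFin \o phi).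
  by apply/measurable_EFinP; exact: continuous_measurableC.
have : (\int[circ 0%R r]_z `|(EFin \o phi) z| = 0)%E.
  under eq_integral do rewrite /= ger0_norm//.
  by rewrite (integral_EFin (ip _ l1)) -/c c_eq0.
move=> /(ae_eq_integral_abs (circ 0 r) measurableT mphi)[S [mS S0 hS]].
apply: (@subset_measure0 _ _ _ (circ 0 r) _ (~` sphere 0 r `|` S)).
- exact: measurableC.
- apply: measurableU => //; apply: measurableC; apply: closed_measurableC.
  by apply: compact_closedC; exact: compact_sphere.
- move=> z nEz; have [zr|] := pselect (sphere 0 r z); last by left.
  right; apply: hS => /= /(_ I)[] /eqP; rewrite /phi mulf_eq0 => /orP[|].
  - rewrite /bump; move: zr; rewrite /sphere/= subr0 => ->.
    by rewrite max_r ?gt_eqF//; lra.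
  - by rewrite gt_eqF// dist_set_gt0.
- have mS' : measurable (~` sphere 0 r).
    apply: measurableC; apply: closed_measurableC.
    by apply: compact_closedC; exact: compact_sphere.
  have := measureU2 (circ 0 r) mS' mS.
  rewrite [X in (_ <= X + _)%E](circ_sphere 0 (ltW r0)) [X in (_ <= _ + X)%E]S0 adde0 => h.
  by apply/eqP; rewrite eq_le h measure_ge0.
Qed.

End minimizer.

Section regular_equilibrium.
Context {R : realType} (E : set R[i]).
Hypotheses (cE : compact E) (rE : regular E).
Local Notation D := (finite_outer_domain E).
Local Notation mu := (equilibrium E).

Lemma equilibriumP : mu (~` E) = 0%E /\ energy mu = robin E.
Proof.
have [nu hnu] := minimizer_exists cE rE.
by rewrite /equilibrium; case: xgetP => [P _ //|/(_ nu)].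
Qed.

Lemma regular_equilibrium : exists (V : R) (h : R[i] -> R),
  [/\ robin E = V%:E, continuous h, forall z, potential mu z = (h z)%:E,
      forall z, h z <= V & forall z, ~ D z -> h z = V] /\
  forall e : R, 0 < e ->
    exists N, forall z, (lpot mu z <= (bpot mu N z + e)%:E)%E.
Proof.
have [muE en] := equilibriumP.
have [V hV] := robin_fin cE rE; rewrite hV in en.
have oD := open_finite_outer_domain (compact_closedC cE).
have DE : D `<=` ~` E by move=> z; exact: finite_outer_domain_sub.
have cD := compact_outer_compl cE.
have regD w : closure D w -> ~ D w -> forall v : R, v < V ->
    exists2 e, 0 < e & forall z, D z -> normc (z - w) < e -> (v%:E < potential mu z)%E.
  move=> cw Dw v vV.
  have reg := rE.2 w (outer_boundaryP cw Dw); rewrite /green hV in reg.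
  have vV0 : 0 < V - v by rewrite subr_gt0.
  have [d d0 hd] := regular_near reg vV0.
  exists d => // z Dz zw; have [fz] := hd z Dz zw.
  by rewrite -(fineK fz) lte_fin ltr_norml; lra.
exists V, (eqpot mu); split; last exact: (equilibrium_uniform cE muE en DE cD regD).
split=> //.
- exact: (continuous_eqpot cE muE en DE cD regD).
- exact: (eqpotE cE muE en DE cD regD).
- exact: (eqpot_le cE muE en DE cD regD).
- exact: (eqpot_compl cE muE en DE cD regD).
Qed.

End regular_equilibrium.

Section potential_growth.
Context {R : realType} (P : {measure set R[i] -> \bar R}) (E : set R[i]).
Hypotheses (P1 : P setT = 1%E) (cE : compact E) (PE : P (~` E) = 0%E).

(** For large [|z|] all points of [E] are at distance between [|z| / 2] and [2 * |z|], so [V - h z]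
    differs from [ln |z|] by at most [ln 2 + |V|]. The radius makes this at most half of [ln |z|],
    whence the constants. *)
Lemma potential_growth (V : R) (h : R[i] -> R) :
  (forall z, potential P z = (h z)%:E) ->
  exists2 r : R, 1 < r & forall z, r <= normc z ->
    2^-1 * ln (normc z) <= V - h z <= 2 * ln (normc z).
Proof.
move=> hE; have [q q0 hq] := compact_bounded_normc cE.
pose r := 1 + 2 * q + expR (2 * (ln 2 + `|V|)).
have e0 := expR_gt0 (2 * (ln 2 + `|V|)).
exists r => [|z rz]; first by rewrite /r; lra.
have z0 : 0 < normc z by move: rz; rewrite /r; lra.
have lz : 2 * (ln 2 + `|V|) <= ln (normc z).
  rewrite -[leLHS]expRK ler_ln ?posrE//; apply: le_trans rz; rewrite /r; lra.
have lek w : E w -> normc z / 2 <= normc (z - w) <= 2 * normc z.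
  move=> /hq wq; have := normc_ge_distl z w; have := normcD z (- w); rewrite normcN.
  move: rz; rewrite /r; lra.
have kE w : E w -> log_kernel z w = (- ln (normc (z - w)))%:E.
  move=> /lek/andP[lo _]; rewrite log_kernel_neq// -subr_eq0 -normc_gt0.
  by apply: lt_le_trans lo; rewrite divr_gt0.
have V1 := ler_norm V; have V2 : - V <= `|V| by rewrite -normrN ler_norm.
have hi : h z <= ln 2 - ln (normc z).
  rewrite -lee_fin -hE; apply: (potential_le P1 cE PE) => w Ew.
  rewrite kE// lee_fin -[leRHS]opprB lerN2 -ln_div ?posrE//.
  have /andP[lo _] := lek w Ew.
  have lz0 : 0 < normc z / 2 by rewrite divr_gt0.
  by rewrite ler_ln ?posrE// (lt_le_trans lz0).
have lo : - (ln 2 + ln (normc z)) <= h z.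
  rewrite -lee_fin -hE; apply: (potential_ge P1 cE PE) => w Ew.
  rewrite kE// lee_fin lerN2 -lnM ?posrE//.
  have /andP[lo up] := lek w Ew.
  have lz0 : 0 < normc z / 2 by rewrite divr_gt0.
  by rewrite ler_ln ?posrE ?mulr_gt0// (lt_le_trans lz0).
apply/andP; split; lra.
Qed.

Lemma integral_le_on (f : R[i] -> R) (F : R[i] -> \bar R) : continuous f ->
  measurable_fun setT F -> (forall z, 0 <= F z)%E ->
  (forall z, E z -> ((f z)%:E <= F z)%E) ->
  ((\int[P]_z f z)%:E <= \int[P]_z F z)%E.
Proof.
move=> cf mF F0 fF.
have cm : continuous (fun z => Num.max (f z) 0).
  by move=> z; apply: continuous_max; [exact: cf|exact: cst_continuous].
have mE : measurable E by apply: closed_measurableC; exact: compact_closedC.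
apply: (@le_trans _ _ (\int[P]_z Num.max (f z) 0)%:E).
  rewrite lee_fin; apply: le_Rintegral => //; try exact: (integrable_cts P1 cE PE).
  by move=> z _; rewrite le_max lexx.
rewrite -integral_EFin; last exact: (integrable_cts P1 cE PE).
apply: ae_ge0_le_integral => //.
- by move=> z _; rewrite lee_fin le_max lexx orbT.
- by apply/measurable_EFinP; exact: continuous_measurableC.
- exists (~` E); split => //; first exact: measurableC.
  move=> z /= hz Ez; apply: hz => _.
  by rewrite EFin_max ge_max fF//= F0.
Qed.

Lemma integral_eq0_on (f : R[i] -> R) : continuous f -> (forall z, E z -> f z = 0) ->
  \int[P]_z f z = 0.
Proof.
move=> cf f0; rewrite -[RHS](RintegralM1 P1 0) /Rintegral; congr fine.
have mE : measurable E by apply: closed_measurableC; exact: compact_closedC.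
apply: ae_eq_integral => //.
- by apply/measurable_EFinP; exact: continuous_measurableC.
- exists (~` E); split => //; first exact: measurableC.
  by move=> z /= hz Ez; apply: hz => _; rewrite f0.
Qed.

End potential_growth.

(** * Discrete measures and node polynomials *)

Section point_averages.
Context {R : realType}.
Implicit Types (Z : seq R[i]) (f g : R[i] -> R).

Definition avg Z f : R := (size Z)%:R^-1 * \sum_(z <- Z) f z.

Lemma avgD Z f g : avg Z (fun z => f z + g z) = avg Z f + avg Z g.
Proof. by rewrite /avg big_split mulrDr. Qed.

Lemma avgN Z f : avg Z (fun z => - f z) = - avg Z f.
Proof. by rewrite /avg sumrN mulrN. Qed.

Lemma avgB Z f g : avg Z (fun z => f z - g z) = avg Z f - avg Z g.
Proof. by rewrite avgD avgN. Qed.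

Lemma avgZ Z c f : avg Z (fun z => c * f z) = c * avg Z f.
Proof. by rewrite /avg -mulr_sumr mulrCA. Qed.

Lemma avg_cst Z c : (0 < size Z)%N -> avg Z (fun=> c) = c.
Proof.
move=> Z0; rewrite /avg big_const_seq count_predT iter_addr_0 -[c *+ _]mulr_natl mulKf//.
by rewrite pnatr_eq0 -lt0n.
Qed.

Lemma le_avg Z f g : (forall z, z \in Z -> f z <= g z) -> avg Z f <= avg Z g.
Proof.
move=> fg; rewrite /avg ler_wpM2l ?invr_ge0// !big_seq.
by apply: ler_sum => z /fg.
Qed.

Lemma avg_ge0 Z f : (forall z, 0 <= f z) -> 0 <= avg Z f.
Proof. by move=> f0; rewrite mulr_ge0 ?invr_ge0// sumr_ge0. Qed.

Lemma ge0_integral_tau Z f : measurable_fun setT f -> (forall z, 0 <= f z) ->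
  (\int[tau Z]_z (f z)%:E = (avg Z f)%:E)%E.
Proof.
move=> mf f0; have mf' : measurable_fun setT (EFin \o f) by exact/measurable_EFinP.
rewrite /tau ge0_integral_mscale//; last by move=> z _; rewrite lee_fin.
rewrite ge0_integral_measure_sum//; last by move=> z _; rewrite lee_fin.
under eq_bigr => k _.
  rewrite (@integral_dirac _ _ _ _ _ measurableT (EFin \o f))//= diracE in_setT mul1e.
  over.
by rewrite sumEFin -EFinM /avg (big_nth 0) big_mkord.
Qed.

Lemma tau1 Z : (0 < size Z)%N -> tau Z setT = 1%E.
Proof.
move=> Z0; have := @ge0_integral_tau Z (fun=> 1) (@measurable_cst _ _ _ _ _ _) (fun=> ler01).
by rewrite integral_cst// avg_cst// mul1e.
Qed.

Lemma Rintegral_tau Z f M : (0 < size Z)%N -> measurable_fun setT f ->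
  (forall z, `|f z| <= M) -> \int[tau Z]_z f z = avg Z f.
Proof.
move=> Z0 mf fM; have t1 := tau1 Z0.
have fi := bounded_integrable t1 mf fM.
have := @ge0_integral_tau Z (fun z => f z + M).
have -> : (\int[tau Z]_z (f z + M)%:E = (\int[tau Z]_z f z + M)%:E)%E.
  rewrite integral_EFin.
    rewrite RintegralD//; last exact: (integrable_cst1 t1).
    by rewrite (RintegralM1 t1).
  by apply: (@integrableD _ _ _ _ _ _ (EFin \o f) (fun=> M%:E)) => //; exact: (integrable_cst1 t1).
rewrite avgD avg_cst// => h.
suff /addIr : \int[tau Z]_z f z + M = avg Z f + M by [].
apply: EFin_inj; apply: h; first exact: measurable_funD.
by move=> z; have := ler_norm (- f z); rewrite normrN; have := fM z; lra.
Qed.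

Lemma bpot_tau Z N z : (0 < size Z)%N -> bpot (tau Z) N z = avg Z (fun w => bern N (skern z w)).
Proof.
move=> Z0; apply: (@Rintegral_tau _ _ (bern N 1)) => //.
  by apply: continuous_measurableC; exact: continuous_bern_skern.
move=> w; rewrite ger0_norm ?bern_ge0 ?skern_ge0//.
by apply: le_bern; [exact: skern_ge0|exact: skern_le1].
Qed.

Lemma le_bpot1 (P : {measure set R[i] -> \bar R}) N z : P setT = 1%E -> `|bpot P N z| <= bern N 1.
Proof.
move=> P1; rewrite ger0_norm; last by apply: Rintegral_ge0 => w _; rewrite bern_ge0// skern_ge0.
rewrite -(RintegralM1 P1 (bern N 1)); apply: le_Rintegral => //.
- exact: integrable_bern_skern.
- exact: (integrable_cst1 P1).
- by move=> w _; apply: le_bern; [exact: skern_ge0|exact: skern_le1].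
Qed.

Lemma mutual_tau Z (Q : {measure set R[i] -> \bar R}) N : (0 < size Z)%N -> Q setT = 1%E ->
  mutual (tau Z) Q N = avg Z (bpot Q N).
Proof.
move=> Z0 Q1; rewrite -(integral_bpot N (tau1 Z0) Q1).
apply: (@Rintegral_tau _ _ (bern N 1)) => //.
  by apply: continuous_measurableC; exact: continuous_bpot.
by move=> z; exact: le_bpot1.
Qed.

Lemma sum_sym_pairs n (F : 'I_n -> 'I_n -> R) : (forall j k, F j k = F k j) ->
  \sum_j \sum_k F j k = \sum_j F j j + 2 * \sum_(j < n) \sum_(k < n | (j < k)%N) F j k.
Proof.
move=> FC.
have -> : \sum_j \sum_k F j k = 
    \sum_(j < n) (F j j + \sum_(k < n | (j < k)%N) F j k + \sum_(k < n | (k < j)%N) F j k).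
  apply: eq_bigr => j _; rewrite (bigD1 j)//= -addrA; congr (_ + _).
  rewrite (bigID (fun k : 'I_n => (j < k)%N))/=; congr (_ + _); apply: eq_bigl => k.
    by rewrite -val_eqE/=; case: ltngtP.
  by rewrite -val_eqE/=; case: ltngtP.
rewrite !big_split/= -addrA; congr (_ + _); rewrite mulr2n mulrDl !mul1r; congr (_ + _).
rewrite (exchange_big_dep xpredT)//=; apply: eq_bigr => k _.
by apply: eq_bigr => j _.
Qed.

(* The diagonal is harmless because the truncated kernel is bounded there. *)
Lemma mutual_tau_le Z N x : (1 < size Z)%N -> discrete_energy Z = x%:E ->
  mutual (tau Z) (tau Z) N + 2 * avg Z cweight <=
  bern N 1 / (size Z)%:R + (1 - (size Z)%:R^-1) * x.
Proof.
move=> Z1 hx; have Z0 : (0 < size Z)%N by exact: ltnW.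
set n := (size Z)%:R : R.
have n0 : 0 < n by rewrite ltr0n.
have n1 : 0 < n - 1 by rewrite subr_gt0 ltr1n.
pose F (j k : 'I_(size Z)) : R := cweight Z`_j + cweight Z`_k + bern N (skern Z`_j Z`_k).
have FC j k : F j k = F k j by rewrite /F skernC (addrC (cweight _)).
have S : \sum_j \sum_k F j k = n ^+ 2 * (mutual (tau Z) (tau Z) N + 2 * avg Z cweight).
  rewrite (mutual_tau N Z0 (tau1 Z0)).
  have avgE f : \sum_(j < size Z) f Z`_j = n * avg Z f.
    by rewrite /avg (big_nth 0) big_mkord mulVKf// gt_eqF.
  transitivity (\sum_(j < size Z) n * (cweight Z`_j + avg Z cweight + bpot (tau Z) N Z`_j)).
    apply: eq_bigr => j _; rewrite /F !big_split/= sumr_const card_ord -[_ *+ _]mulr_natl -/n.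
    by rewrite (avgE cweight) (avgE (fun w => bern N (skern Z`_j w))) bpot_tau// !mulrDr.
  rewrite -mulr_sumr !big_split/= (avgE cweight) (avgE (bpot (tau Z) N)).
  by rewrite sumr_const card_ord -[_ *+ _]mulr_natl -/n; ring.
have P : \sum_(j < size Z) \sum_(k < size Z | (j < k)%N) F j k <= n * (n - 1) / 2 * x.
  have h : ((\sum_(j < size Z) \sum_(k < size Z | (j < k)%N) F j k)%:E <=
      \sum_(j < size Z) \sum_(k < size Z | (j < k)%N) log_kernel Z`_j Z`_k)%E.
    rewrite -sumEFin; apply: lee_sum => j _; rewrite -sumEFin; apply: lee_sum => k _.
    by rewrite log_kernelE EFinD leeD2l// lkern_ge_bern.
  move: hx; rewrite /discrete_energy -/n; move: h.
  case: (\sum_(j < _) _)%E => [s||]//.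
    by rewrite lee_fin -EFinM => h [<-]; apply: le_trans h _; rewrite le_eqVlt; apply/orP;
      left; apply/eqP; field; rewrite !gt_eqF.
  by move=> _; rewrite gt0_muley// lte_fin divr_gt0// mulr_gt0.
have Dg : \sum_j F j j <= n * bern N 1.
  apply: (@le_trans _ _ (\sum_(j < size Z) bern N 1));
    last by rewrite sumr_const card_ord mulr_natl.
  by apply: ler_sum => j _; rewrite /F skernzz; have := cweight_le0 Z`_j; lra.
have := sum_sym_pairs FC; rewrite S => h.
rewrite -(ler_pM2l (exprn_gt0 2 n0)) h.
have -> : n ^+ 2 * (bern N 1 / n + (1 - n^-1) * x) = n * bern N 1 + 2 * (n * (n - 1) / 2 * x).
  by field; rewrite gt_eqF.
lra.
Qed.

End point_averages.

Section moment_distance.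
Context {R : realType}.
Implicit Types (P Q : {measure set R[i] -> \bar R}).

(** The weights [1 / (2 * k)] of [mutual] are at most 1 and so are the monomials; without the
    weights, this distance bounds differences of truncated potentials uniformly in [z]. *)
Definition mdist P Q N : R :=
  \sum_(k < N) \sum_(v : {ffun 'I_k.+1 -> 'I_4}) `|mom P v - mom Q v|.

Lemma mdistC P Q N : mdist P Q N = mdist Q P N.
Proof. by apply: eq_bigr => k _; apply: eq_bigr => v _; rewrite distrC. Qed.

Lemma bpot_le_mdist P Q N z : P setT = 1%E -> Q setT = 1%E ->
  bpot P N z - bpot Q N z <= mdist P Q N.
Proof.
move=> P1 Q1; rewrite !bpotE// -sumrB; apply: ler_sum => k _.
rewrite -mulrBl ler_pdivrMr ?mulr_gt0// -sumrB.
set S := \sum_v `|_|; have S0 : 0 <= S by apply: sumr_ge0.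
apply: (@le_trans _ _ S).
  apply: ler_sum => v _; rewrite -mulrBr; apply: le_trans (ler_norm _) _.
  by rewrite normrM ler_piMl// le_mono1.
rewrite ler_peMr// -natrM ler1n muln_gt0//.
Qed.

Lemma mutual_le_mdist P Q N : P setT = 1%E -> Q setT = 1%E ->
  mutual P Q N - mutual Q Q N <= mdist P Q N.
Proof.
move=> P1 Q1; rewrite mutualC -!integral_bpot//.
have ib P' : P' setT = 1%E -> Q.-integrable setT (EFin \o bpot P' N).
  move=> P'1; apply: (bounded_integrable Q1 (M := bern N 1)).
    by apply: continuous_measurableC; exact: continuous_bpot.
  by move=> z; exact: le_bpot1.
rewrite -RintegralB; [|by []|exact: ib|exact: ib].
rewrite -(RintegralM1 Q1 (mdist P Q N)); apply: le_Rintegral => //.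
- exact: (integrableB measurableT (ib P P1) (ib Q Q1)).
- exact: (integrable_cst1 Q1).
- by move=> z _; exact: bpot_le_mdist.
Qed.

Lemma mdist_small N (e : R) : 0 < e -> exists2 d, 0 < d &
  forall P Q, qform P Q N <= d -> mdist P Q N <= e.
Proof.
move=> e0; pose C : R := \sum_(k < N) \sum_(v : {ffun 'I_k.+1 -> 'I_4}) 1 + 1.
have C0 : 0 < C by rewrite ltr_wpDl// sumr_ge0// => k _; rewrite sumr_ge0.
pose t := e / C; have t0 : 0 < t by rewrite divr_gt0.
pose d := t ^+ 2 / (2 * N.+1%:R).
have d0 : 0 < d by rewrite divr_gt0 ?exprn_gt0// mulr_gt0.
exists d => // P Q hd.
have dt : 2 * N.+1%:R * d = t ^+ 2.
  by rewrite /d; field; rewrite nat1r pnatr_eq0.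
apply: (@le_trans _ _ (t * (C - 1))); last first.
  by rewrite mulrBr /t mulfVK ?gt_eqF// mulr1 gerBl ltW.
rewrite /C addrK mulr_sumr; apply: ler_sum => k _; rewrite mulr_sumr.
apply: ler_sum => v _.
rewrite mulr1 -(@ler_pXn2r _ 2)// ?nnegrE ?(ltW t0)// -normrX ger0_norm ?sqr_ge0//.
apply: le_trans (mom_diff_le P Q v (ltn_ord k)) _; rewrite -dt.
apply: ler_pM => //.
- rewrite /qform sumr_ge0// => j _; rewrite divr_ge0 ?mulr_ge0// sumr_ge0// => u _; exact: sqr_ge0.
- by rewrite ler_pM2l// ler_nat ltnW// ltnS.
Qed.

End moment_distance.

(** * Energy comparison and bounds for node polynomials *)

Section equilibrium_and_points.
Context {R : realType} (mu : probability R[i] R) (E : set R[i]) (V : R) (h : R[i] -> R).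
Hypotheses (cE : compact E) (muE : mu (~` E) = 0%E) (en : energy mu = V%:E).
Hypotheses (ch : continuous h) (hpot : forall z, potential mu z = (h z)%:E).
Hypotheses (hE : forall z, E z -> h z = V).
Implicit Types (Z : seq R[i]).

Let mu1 : mu setT = 1%E. Proof. exact: probability_setT. Qed.
Local Notation g := (fun z => V - h z).

Lemma lpot_eq z : lpot mu z = (h z - cweight z - cmean mu)%:E.
Proof.
have := hpot z; rewrite (potentialE mu1 cE muE).
by case: (lpot mu z) => [s||]//; rewrite -EFinD => -[<-]; congr _%:E; ring.
Qed.

(** The bound on the truncation error is evaluated at the nodes, which may be anywhere; this is the
    use of uniformity on the whole plane. *)
Lemma le_avg_bpot Z N (e : R) : (0 < size Z)%N ->
  (forall z, (lpot mu z <= (bpot mu N z + e)%:E)%E) ->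
  V - avg Z g - avg Z cweight - cmean mu - e <= avg Z (bpot mu N).
Proof.
move=> Z0 hN.
have -> : V - avg Z g - avg Z cweight - cmean mu - e =
    avg Z (fun z => h z - cweight z - (cmean mu + e)).
  by rewrite !avgB !avg_cst//; ring.
apply: le_avg => z _; have := hN z; rewrite lpot_eq lee_fin; lra.
Qed.

(** In [qform] the average weight of the nodes enters once through the self-energy and once, with
    the opposite sign, through the mutual energy; it cancels, as does [cmean mu]. *)
Lemma qform_tau_le Z N (e x : R) : (1 < size Z)%N -> discrete_energy Z = x%:E ->
  (forall z, (lpot mu z <= (bpot mu N z + e)%:E)%E) ->
  qform (tau Z) mu N <=
  bern N 1 / (size Z)%:R + (1 - (size Z)%:R^-1) * x - V + 2 * avg Z g + 2 * e.
Proof.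
move=> Z1 hx hN; have Z0 : (0 < size Z)%N by exact: ltnW.
have := mutual_tau_le N Z1 hx; have := mutual_le_energy N cE muE en.
have := le_avg_bpot Z0 hN; rewrite -(mutual_tau N Z0 mu1) qformE; lra.
Qed.

(** The weight is unbounded below, so weak closeness alone gives no such bound. It is forced by
    [le_avg_bpot], since the truncated mutual energy of [tau Z] and [mu] exceeds the self-energy of
    [mu] by at most [mdist]. *)
Lemma avg_cweight_ge Z N (e : R) : (0 < size Z)%N ->
  (forall z, (lpot mu z <= (bpot mu N z + e)%:E)%E) ->
  cmean mu - avg Z g - e - mdist (tau Z) mu N <= avg Z cweight.
Proof.
move=> Z0 hN; have := le_avg_bpot Z0 hN; rewrite -(mutual_tau N Z0 mu1).
have := mutual_le_energy N cE muE en.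
have := mutual_le_mdist N (tau1 Z0) mu1; lra.
Qed.

Lemma normc_node_poly Z z : normc (node_poly Z).[z] = \prod_(w <- Z) normc (z - w).
Proof.
rewrite /node_poly horner_prod; elim: Z => [|w Z ih]; first by rewrite !big_nil Normc.normc1.
by rewrite !big_cons Normc.normcM ih !hornerE.
Qed.

Lemma ln_normc_node_poly Z z : z \notin Z ->
  ln (normc (node_poly Z).[z]) = \sum_(w <- Z) ln (normc (z - w)).
Proof.
rewrite normc_node_poly; elim: Z => [|w Z ih]; first by rewrite !big_nil ln1.
rewrite inE negb_or => /andP[zw zZ]; rewrite !big_cons lnM ?ih// posrE.
  by rewrite normc_gt0 subr_eq0.
rewrite -normc_node_poly normc_gt0; rewrite /node_poly.
by rewrite -/(root _ _) root_prod_XsubC.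
Qed.

Lemma node_poly_neq0 Z z : z \notin Z -> 0 < normc (node_poly Z).[z].
Proof. by move=> zZ; rewrite normc_gt0 -/(root _ _) root_prod_XsubC. Qed.

(** Each factor is bounded through the truncated kernel, which turns the average into
    [bpot (tau Z) N z]. Passing from it to [lpot mu z] costs [e + mdist], and bounding the average
    weight of the nodes costs as much again. *)
Lemma node_poly_le Z N (e : R) : (0 < size Z)%N ->
  (forall z, (lpot mu z <= (bpot mu N z + e)%:E)%E) ->
  forall z, E z -> normc (node_poly Z).[z] <=
    expR ((avg Z g - V + 2 * e + 2 * mdist (tau Z) mu N) * (size Z)%:R).
Proof.
move=> Z0 hN z Ez; have [zZ|zZ] := boolP (z \in Z).
  have /rootP -> : root (node_poly Z) z by rewrite root_prod_XsubC.
  by rewrite Normc.normc0 expR_ge0.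
have n0 : 0 < (size Z)%:R :> R by rewrite ltr0n.
rewrite -[leLHS]lnK ?posrE ?node_poly_neq0// ler_expR ln_normc_node_poly//.
rewrite -ler_pdivrMr// mulrC -/(avg Z (fun w => ln (normc (z - w)))).
apply: (@le_trans _ _ (avg Z (fun w => - (cweight z + cweight w + bern N (skern z w))))).
  apply: le_avg => w wZ; have zw : z != w by apply: contraNneq zZ => ->.
  have := log_kernelE z w; rewrite log_kernel_neq//; have := lkern_ge_bern N z w.
  by case: (lkern z w) => [s||]//; rewrite -EFinD lee_fin => hs [hl]; lra.
rewrite avgN; set G := avg Z g; rewrite !avgD avg_cst// -(bpot_tau N z Z0).
have := avg_cweight_ge Z0 hN; rewrite -/G; have := bpot_le_mdist N z mu1 (tau1 Z0).
have := hN z; rewrite (mdistC mu) lpot_eq hE// lee_fin. lra.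
Qed.

(** The inequality to be integrated is written for the nonnegative sum [F] of kernels, infinite at
    the nodes, so that nodes on [E] cause no trouble. *)
Lemma node_poly_ge Z (s : R) : 0 < s -> (forall z, E z -> normc (node_poly Z).[z] <= s) ->
  - \sum_(w <- Z) h w <= ln s.
Proof.
move=> s0 hs.
pose F z := (\sum_(w <- Z) lkern w z)%E.
pose f z := - ln s - \sum_(w <- Z) cweight w - (size Z)%:R * cweight z.
have cf : continuous f.
  apply: ctsB; first exact: cst_continuous.
  by apply: ctsM; [exact: cst_continuous|exact: continuous_cweight].
have mF : measurable_fun setT F by apply: emeasurable_sum => w; exact: measurable_lkern1.
have F0 z : (0 <= F z)%E by apply: sume_ge0 => w _; exact: lkern_ge0.
have := integral_le_on mu1 cE muE cf mF F0.
have -> : (\int[mu]_z F z = (\sum_(w <- Z) (h w - cweight w - cmean mu))%:E)%E.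
  rewrite ge0_integral_sum//; first by rewrite -sumEFin; apply: eq_bigr => w _; exact: lpot_eq.
  - by move=> w; exact: measurable_lkern1.
  - by move=> w z _ ; exact: lkern_ge0.
have -> : \int[mu]_z f z = - ln s - \sum_(w <- Z) cweight w - (size Z)%:R * cmean mu.
  have ic := integrable_cweight mu1 cE muE.
  rewrite RintegralB//; last by apply: (integrable_cts mu1 cE muE); apply: ctsM;
    [exact: cst_continuous|exact: continuous_cweight].
    by rewrite (RintegralM1 mu1) RintegralZl.
  exact: (integrable_cst1 mu1).
rewrite lee_fin !sumrB big_const_seq count_predT iter_addr_0 -[cmean mu *+ _]mulr_natl => hh.
suff : forall z, E z -> ((f z)%:E <= F z)%E by move/hh; lra.
move=> z Ez; have [zZ|zZ] := boolP (z \in Z).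
  have lzz : lkern z z = +oo%E.
    by have := log_kernelE z z; rewrite log_kernelzz; case: (lkern z z).
  rewrite /F (big_rem z)//= lzz addye ?leey// gt_eqF// (lt_le_trans ltNy0)//.
  by apply: sume_ge0 => w _; exact: lkern_ge0.
have -> : F z = (\sum_(w <- Z) (- ln (normc (z - w)) - cweight w - cweight z))%:E.
  rewrite -sumEFin; apply: eq_big_seq => w wZ.
  have zw : z != w by apply: contraNneq zZ => ->.
  have := log_kernelE z w; rewrite log_kernel_neq// (lkernC z).
  by case: (lkern w z) => [t||]//; rewrite -EFinD => -[->]; congr _%:E; ring.
rewrite lee_fin !sumrB sumrN -ln_normc_node_poly// /f.
rewrite big_const_seq count_predT iter_addr_0 -[cweight z *+ _]mulr_natl.
rewrite !lerD2r lerN2 ler_ln ?posrE ?node_poly_neq0// hs//.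
Qed.

Lemma sup_norm_bounds Z N (e : R) : (0 < size Z)%N ->
  (forall z, (lpot mu z <= (bpot mu N z + e)%:E)%E) ->
  expR (avg Z g - V) <= sup_norm E (node_poly Z) `^ (size Z)%:R^-1 <=
  expR (avg Z g - V + 2 * e + 2 * mdist (tau Z) mu N).
Proof.
move=> Z0 hN; have n0 : 0 < (size Z)%:R :> R by rewrite ltr0n.
have E0 := concentrated_nonempty mu1 muE.
have le := node_poly_le Z0 hN.
set S := [set normc (node_poly Z).[z] | z in E].
have S0 : S !=set0 by case: E0 => z Ez; exists (normc (node_poly Z).[z]), z.
have ubS : has_sup S.
  by split => //; exists (expR ((avg Z g - V + 2 * e + 2 * mdist (tau Z) mu N) * (size Z)%:R)) =>
    _ [z Ez <-]; exact: le.
have sup_ge z : E z -> normc (node_poly Z).[z] <= sup S.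
  by move=> Ez; apply: ub_le_sup; [case: ubS|exists z].
have sup0 : 0 <= sup S.
  by case: E0 => z /sup_ge; apply: le_trans; exact: normc_ge0.
have hsum : - \sum_(w <- Z) h w = (avg Z g - V) * (size Z)%:R.
  rewrite avgB avg_cst// /avg addrAC subrr add0r mulNr; congr (- _).
  by rewrite mulrC mulVKf// gt_eqF.
have key (t : R) : 0 < t -> sup S <= t -> expR ((avg Z g - V) * (size Z)%:R) <= t.
  move=> t0 st; rewrite -[leRHS]lnK ?posrE// ler_expR -hsum.
  by apply: node_poly_ge => // z Ez; apply: le_trans (sup_ge z Ez) st.
have supe : expR ((avg Z g - V) * (size Z)%:R) <= sup S.
  rewrite leNgt; apply/negP => hlt.
  (* [sup S] is not yet known to be positive, as the logarithm in [node_poly_ge] requires; the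
     midpoint is, and it still lies below the exponential. *)
  pose t := (sup S + expR ((avg Z g - V) * (size Z)%:R)) / 2.
  by have := key t; rewrite /t; lra.
have pw (a : R) : expR a = expR (a * (size Z)%:R) `^ (size Z)%:R^-1.
  by rewrite -expRM mulfK// gt_eqF.
rewrite /sup_norm -/S; apply/andP; split; rewrite [X in _ <= X]pw || rewrite pw.
  by apply: ge0_ler_powR; rewrite ?invr_ge0// nnegrE ?expR_ge0.
apply: ge0_ler_powR; rewrite ?invr_ge0// ?nnegrE ?expR_ge0//.
by apply: ge_sup => // _ [z Ez <-]; exact: le.
Qed.

Lemma log_tailE Z (r : R) :
  log_tail Z r = avg Z (fun z => if r <= normc z then ln (normc z) else 0).
Proof. by rewrite /log_tail /avg -big_mkcond. Qed.

Lemma log_tail_ge0 Z (r : R) : 1 <= r -> 0 <= log_tail Z r.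
Proof.
move=> r1; rewrite log_tailE; apply: avg_ge0 => z; case: ifP => // rz.
by rewrite ln_ge0// (le_trans r1).
Qed.

Lemma log_tail_le Z (r : R) : (forall z, h z <= V) ->
  (forall z, r <= normc z -> 2^-1 * ln (normc z) <= V - h z) ->
  log_tail Z r <= 2 * avg Z g.
Proof.
move=> hV hr; rewrite log_tailE -avgZ; apply: le_avg => z _; case: ifP => [/hr|_]; first by lra.
by have := hV z; lra.
Qed.

Definition cutoff (r : R) (z : R[i]) : R := Num.max 0 (Num.min 1 (r + 1 - normc z)).

Lemma continuous_cutoff r : continuous (cutoff r).
Proof.
move=> z; apply: (@continuous_max _ _ (fun=> 0) (fun z => Num.min 1 (r + 1 - normc z)));
  first exact: cst_continuous.
apply: (@continuous_min _ _ (fun=> 1) (fun z => r + 1 - normc z)); first exact: cst_continuous.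
exact: (ctsB (@cst_continuous _ _ (r + 1)) (@continuous_normc R)).
Qed.

Lemma avg_le_cutoff Z (r : R) : (forall z, h z <= V) ->
  (forall z, r <= normc z -> V - h z <= 2 * ln (normc z)) ->
  avg Z g <= avg Z (fun z => (V - h z) * cutoff r z) + 2 * log_tail Z r.
Proof.
move=> hV hr; rewrite log_tailE -avgZ -avgD; apply: le_avg => z _.
have g0 : 0 <= V - h z by rewrite subr_ge0.
have c0 : 0 <= cutoff r z by rewrite le_max lexx.
case: ifP => [/hr rz|/negbT]; first by have := mulr_ge0 g0 c0; lra.
rewrite -ltNge => zr; rewrite /cutoff min_l ?max_r//; lra.
Qed.

End equilibrium_and_points.

(** * The limits *)

Section limits.
Context {R : realType} (mu : probability R[i] R) (E : set R[i]) (V : R) (h : R[i] -> R).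
Context (Z : forall n : nat, n.-tuple R[i]).
Hypotheses (cE : compact E) (muE : mu (~` E) = 0%E) (en : energy mu = V%:E).
Hypotheses (ch : continuous h) (hpot : forall z, potential mu z = (h z)%:E).
Hypotheses (hV : forall z, h z <= V) (hE : forall z, E z -> h z = V).
Hypothesis uni : forall e : R, 0 < e ->
  exists N, forall z, (lpot mu z <= (bpot mu N z + e)%:E)%E.

Let mu1 : mu setT = 1%E. Proof. exact: probability_setT. Qed.
Local Notation m n := (avg (Z n) (fun z => V - h z)).
Local Notation s n := (sup_norm E (node_poly (Z n)) `^ n%:R^-1).

Let m0 n : 0 <= m n.
Proof. by apply: avg_ge0 => z; rewrite subr_ge0. Qed.

Let Z0 n : (0 < n)%N -> (0 < size (Z n))%N.
Proof. by rewrite size_tuple. Qed.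

Lemma cvg_qform0 N (d : R) : discrete_energy (Z n) @[n --> \oo] --> V%:E ->
  m n @[n --> \oo] --> 0 -> 0 < d -> \forall n \near \oo, qform (tau (Z n)) mu N <= d.
Proof.
move=> /fine_cvgP[hf hc] hm d0.
have [N' hN'] := uni (divr_gt0 d0 (ltr0n R 8)).
(* [qform] increases with the truncation, so [N] may be raised until the uniform error is at most
   [d / 8]; for fixed [M] the diagonal term [bern M 1 / n] vanishes in the limit. *)
pose M := maxn N N'.
have hM z : (lpot mu z <= (bpot mu M z + d / 8)%:E)%E.
  apply: le_trans (hN' z) _; rewrite lee_fin lerD2r.
  by apply: nondecreasing_bpot => //; exact: leq_maxr.
have ninv : n%:R^-1 @[n --> \oo] --> (0 : R).
  apply/gtr0_cvgV0; last by apply/cvgrnyP; exact: cvg_id.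
  by near=> n; rewrite ltr0n; near: n; exact: nbhs_infty_gt.
have : bern M 1 * n%:R^-1 + (1 - n%:R^-1) * fine (discrete_energy (Z n)) - V
    + 2 * m n + 2 * (d / 8) @[n --> \oo] --> bern M 1 * 0 + (1 - 0) * V - V + 2 * 0 + 2 * (d / 8).
  apply: cvgD; last exact: cvg_cst.
  apply: cvgD; last by apply: cvgM => //; exact: cvg_cst.
  apply: cvgB; last exact: cvg_cst.
  apply: cvgD; first by apply: cvgM => //; exact: cvg_cst.
  by apply: cvgM => //; apply: cvgB => //; exact: cvg_cst.
move=> /cvgr_lt/(_ d) hd.
near=> n; have n1 : (1 < n)%N by near: n; exact: nbhs_infty_gt.
apply: le_trans (le_qform _ _ (leq_maxl N N')) _.
have fx : discrete_energy (Z n) \is a fin_num by near: n.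
have := @qform_tau_le R mu E V h cE muE en hpot (Z n) M (d / 8) (fine (discrete_energy (Z n))).
rewrite size_tuple fineK// => /(_ n1 erefl hM) hq; apply: le_trans hq _.
apply: ltW; near: n; apply: hd; lra.
Unshelve. all: by end_near. Qed.

Lemma cvg_weak_star : discrete_energy (Z n) @[n --> \oo] --> V%:E ->
  m n @[n --> \oo] --> 0 -> weak_star_cvg (fun n => tau (Z n)) mu.
Proof.
move=> hZ hm phi cphi sphi.
have [B _ hB] := compact_support_bounded cphi sphi.
have ip (P : {measure set R[i] -> \bar R}) : P setT = 1%E -> P.-integrable setT (EFin \o phi).
  by move=> P1; exact: (bounded_integrable P1 (continuous_measurableC cphi) hB).
rewrite (integral_EFin (ip _ mu1)); apply/fine_cvgP; split.
  near=> n; have n0 : (0 < n)%N by near: n; exact: nbhs_infty_gt.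
  by rewrite (integral_EFin (ip _ (tau1 (Z0 n0)))).
apply/cvgrPdistC_le => e e0.
have [M [d d0 hd]] := weak_close cphi sphi e0.
near=> n; have n0 : (0 < n)%N by near: n; exact: nbhs_infty_gt.
apply: hd => //; first exact: tau1 (Z0 n0).
near: n; exact: cvg_qform0.
Unshelve. all: by end_near. Qed.

Lemma cvg_log_tail : m n @[n --> \oo] --> 0 ->
  \forall r \near +oo, log_tail (Z n) r @[n --> \oo] --> 0.
Proof.
move=> hm; have [r r1 hr] := potential_growth mu1 cE muE V hpot.
near=> t; have rt : r <= t by near: t; apply: nbhs_pinfty_ge; exact: num_real.
apply: (@squeeze_cvgr _ _ _ _ (fun=> 0) (fun n => 2 * m n)); last 2 first.
- exact: cvg_cst.
- by rewrite -(mulr0 2); apply: cvgM => //; exact: cvg_cst.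
near=> n; rewrite log_tail_ge0 ?(le_trans (ltW r1))//=.
apply: log_tail_le => // z tz.
by have /andP[] := hr z (le_trans rt tz).
Unshelve. all: by end_near. Qed.

(** For one suitable radius, the cut-off [V - h] is a test function that vanishes on [E], so its
    averages tend to 0; the remainder is at most twice the logarithmic tail. *)
Lemma cvg_mean_of_weak_star : weak_star_cvg (fun n => tau (Z n)) mu ->
  (exists2 L : R -> R, (\forall r \near +oo, log_tail (Z n) r @[n --> \oo] --> L r) &
    L r @[r --> +oo] --> 0) ->
  m n @[n --> \oo] --> 0.
Proof.
move=> hw [L hL L0]; have [r0 r01 hr0] := potential_growth mu1 cE muE V hpot.
apply/cvgrPdistC_le => e e0.
have e4 : 0 < e / 8 by rewrite divr_gt0.
have [r [rr0 hLr Lr]] : exists r, [/\ r0 <= r, log_tail (Z n) r @[n --> \oo] --> L r & L r < e / 8].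
  have : \forall r \near +oo, [/\ r0 <= r, log_tail (Z n) r @[n --> \oo] --> L r & L r < e / 8].
    near=> r; split; near: r; [apply: nbhs_pinfty_ge;
      exact: num_real| exact: hL| exact: (cvgr_lt _ L0)].
  by move=> /filter_ex[r hr]; exists r.
pose phi z := (V - h z) * cutoff r z.
have cphi : continuous phi.
  apply: ctsM; last exact: continuous_cutoff.
  by apply: ctsB; [exact: cst_continuous|exact: ch].
have sphi : compact (closure [set z | phi z != 0]).
  apply: (@compact_normcP R _ (r + 1)); first exact: closed_closure.
  have sub : [set z | phi z != 0] `<=` [set z | normc (z - 0) <= r + 1].
    move=> z /=; rewrite subr0 leNgt; apply: contra => rz.
    rewrite /phi /cutoff max_l ?mulr0// ge_min; apply/orP; right; lra.
  move=> z /(closureS sub); rewrite -(closure_id _).1; last exact: closed_ballC.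
  by rewrite /= subr0.
have [B _ hB] := compact_support_bounded cphi sphi.
have := hw phi cphi sphi; rewrite integral_EFin; last exact: (integrable_cts mu1 cE muE cphi).
rewrite (integral_eq0_on mu1 cE muE); first last.
- by move=> z Ez; rewrite /phi hE// subrr mul0r.
- exact: cphi.
move=> /fine_cvgP[_ hc].
near=> n; have n0 : (0 < n)%N by near: n; exact: nbhs_infty_gt.
rewrite subr0 ger0_norm//.
have h1 : fine (\int[tau (Z n)]_z (phi z)%:E) < e / 2.
  by near: n; apply: (cvgr_lt _ hc); rewrite divr_gt0.
have h2 : log_tail (Z n) r < e / 8 by near: n; exact: (cvgr_lt _ hLr).
have := Rintegral_tau (Z0 n0) (continuous_measurableC cphi) hB.
rewrite /Rintegral => h3; rewrite h3 in h1.
have h4 : m n <= avg (Z n) phi + 2 * log_tail (Z n) r.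
  by apply: avg_le_cutoff => // z rz; have /andP[] := hr0 z (le_trans rr0 rz).
lra.
Unshelve. all: by end_near. Qed.

Lemma cvg_mean_of_norm : s n @[n --> \oo] --> expR (- V) -> m n @[n --> \oo] --> 0.
Proof.
(* Any truncation will do: the lower bound in [sup_norm_bounds] does not depend on it. *)
move=> hs; apply/cvgrPdistC_le => e e0; have [N hN] := uni ltr01.
near=> n; have n0 : (0 < n)%N by near: n; exact: nbhs_infty_gt.
rewrite subr0 ger0_norm//.
have /andP[lo _] := sup_norm_bounds cE muE en hpot hE (Z0 n0) hN.
rewrite size_tuple in lo.
have : s n < expR (e - V).
  by near: n; apply: (cvgr_lt _ hs); rewrite ltr_expR; lra.
by move=> /(le_lt_trans lo); rewrite ltr_expR; lra.
Unshelve. all: by end_near. Qed.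

Lemma cvg_norm_of_mean : discrete_energy (Z n) @[n --> \oo] --> V%:E ->
  m n @[n --> \oo] --> 0 -> s n @[n --> \oo] --> expR (- V).
Proof.
move=> hZ hm.
suff hl : ln (s n) @[n --> \oo] --> - V.
  have : expR (ln (s n)) @[n --> \oo] --> expR (- V).
    by apply: continuous_cvg hl; exact: continuous_expR.
  apply: cvg_trans; apply: near_eq_cvg.
  near=> n; have n0 : (0 < n)%N by near: n; exact: nbhs_infty_gt.
  have [N hN] := uni ltr01.
  have /andP[lo _] := sup_norm_bounds cE muE en hpot hE (Z0 n0) hN.
  by rewrite lnK// posrE; rewrite size_tuple in lo; exact: lt_le_trans (expR_gt0 _) lo.
apply/cvgrPdistC_le => e e0.
have e8 : 0 < e / 8 by rewrite divr_gt0.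
have [N hN] := uni e8.
have [d d0 hd] := mdist_small N e8.
near=> n; have n0 : (0 < n)%N by near: n; exact: nbhs_infty_gt.
have := sup_norm_bounds cE muE en hpot hE (Z0 n0) hN; rewrite size_tuple => /andP[lo up].
have s0 : 0 < s n by exact: lt_le_trans (expR_gt0 _) lo.
rewrite -[s n]lnK ?posrE// ler_expR in lo; rewrite -[s n]lnK ?posrE// ler_expR in up.
have hq : mdist (tau (Z n)) mu N <= e / 8.
  by apply: hd; near: n; exact: cvg_qform0.
have hmn : m n < e / 8 by near: n; exact: (cvgr_lt _ hm).
have := m0 n; rewrite ler_norml; lra.
Unshelve. all: by end_near. Qed.

End limits.

Theorem theorem1p2 (R : realType) (E : set R[i])
    (Z : forall n : nat, n.-tuple R[i]) :
  compact E -> regular E ->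
  discrete_energy (Z n) @[n --> \oo] --> robin E ->
  [<-> (sup_norm E (node_poly (Z n)) `^ n%:R^-1)%:E @[n --> \oo]
         --> capacity E;
       mean_green E (Z n) @[n --> \oo] --> 0%E;
       weak_star_cvg (fun n => tau (Z n)) (equilibrium E) /\
       exists2 L : R -> R,
         (\forall r \near +oo, log_tail (Z n) r @[n --> \oo] --> L r) &
         L r @[r --> +oo] --> 0].
Proof.
move=> cE rE hZ.
have [muE en] := equilibriumP cE rE.
have [V [h [[hV ch hpot hle hcompl] uni]]] := regular_equilibrium cE rE.
rewrite hV in en hZ.
have hE z : E z -> h z = V.
  by move=> Ez; apply: hcompl => Dz; exact: (finite_outer_domain_sub Dz).
have capE : capacity E = (expR (- V))%:E by rewrite /capacity hV.
(* Nodes off the outer domain contribute [V - h z = 0], so the restricted sum is a full average. *)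
have meanE n : mean_green E (Z n) = (avg (Z n) (fun z => V - h z))%:E.
  rewrite /mean_green /avg EFinM -sumEFin; congr (_ * _)%E.
  rewrite big_mkcond; apply: eq_bigr => z _; rewrite /green hV hpot.
  by case: ifPn => //; rewrite notin_setE => /hcompl ->; rewrite subrr.
have aP : (sup_norm E (node_poly (Z n)) `^ n%:R^-1)%:E @[n --> \oo] --> capacity E <->
    sup_norm E (node_poly (Z n)) `^ n%:R^-1 @[n --> \oo] --> expR (- V).
  by rewrite capE; split => [/fine_cvgP[]//|hs]; apply: cvg_EFin => //; exact: nearW.
have bP : mean_green E (Z n) @[n --> \oo] --> 0%E <->
    avg (Z n) (fun z => V - h z) @[n --> \oo] --> 0.
  under eq_fun do rewrite meanE.
  by split => [/fine_cvgP[]//|hs]; apply: cvg_EFin => //; exact: nearW.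
tfae.
- move=> /aP hs; apply/bP.
  exact: (cvg_mean_of_norm cE muE en hpot hle hE uni hs).
- move=> /bP hm; split.
    exact: (cvg_weak_star cE muE en hpot uni hZ hm).
  exists (fun=> 0); last exact: cvg_cst.
  exact: (cvg_log_tail cE muE hpot hle hm).
(* The cycle is closed through the second condition: it follows from the third and yields the
   first. *)
- move=> [hw hL]; apply/aP.
  apply: (cvg_norm_of_mean cE muE en hpot hle hE uni hZ).
  exact: (cvg_mean_of_weak_star cE muE ch hpot hle hE hw hL).
Qed.
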